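(* Suppose that $\ell_\ast(\mathcal G)=\inf_{e\in\mathcal E}|e|>0$. Then $$\lambda_0(\mathbf H)\le\frac{\pi^2}{2\,\ell_\ast(\mathcal G)}\,\alpha(\mathcal G),\qquad \lambda_0^{\mathrm{ess}}(\mathbf H)\le\frac{\pi^2}{2\,\ell_\ast^{\mathrm{ess}}(\mathcal G)}\,\alpha_{\mathrm{ess}}(\mathcal G).$$
   Context: Setting. $\mathcal G_d=(\mathcal V,\mathcal E)$ is an unoriented, connected, locally finite, simple graph with countably infinite $\mathcal V$ and $\mathcal E$. Each edge $e$ has a length $|e|\in(0,\infty)$ and is identified with $[0,|e|]$; gluing endpoints gives the metric graph $\mathcal G=(\mathcal V,\mathcal E,|\cdot|)$. $\mathcal E_v$ is the set of edges incident to $v$, $\deg_{\mathcal G}(v)=\#\mathcal E_v$. Standing assumptions: $\ell^\ast(\mathcal G):=\sup_{e}|e|<\infty$ and $\deg_{\mathcal G}(v)\ne2$ for all $v$. Put $\ell_\ast^{\mathrm{ess}}(\mathcal G)=\sup_{\widetilde{\mathcal E}}\inf_{e\in\mathcal E\setminus\widetilde{\mathcal E}}|e|$, the supremum over finite $\widetilde{\mathcal E}\subset\mathcal E$. Operator. The vertices of degree $1$ are partitioned into $\mathcal V_D$ (Dirichlet) and $\mathcal V_N$ (Neumann), either possibly empty. $L^2(\mathcal G)=\bigoplus_eL^2(e)$. $\mathbf H_0$ acts as $-d^2/dx_e^2$ on each edge, on functions $f=(f_e)_e$ with $f_e\in H^2(e)$, nonzero on only finitely many edges, such that $f(v)=0$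 for $v\in\mathcal V_D$ and, at every $v\in\mathcal V\setminus\mathcal V_D$, $f$ is continuous and $\sum_{e\in\mathcal E_v}f_e'(v)=0$ (derivatives from $v$ into the edge). The Kirchhoff Laplacian $\mathbf H$ is the self-adjoint operator associated with the closure of the form $f\mapsto\int_{\mathcal G}|f'|^2dx$ on $\mathrm{dom}(\mathbf H_0)$. $\lambda_0(\mathbf H)=\inf\sigma(\mathbf H)$, $\lambda_0^{\mathrm{ess}}(\mathbf H)=\inf\sigma_{\mathrm{ess}}(\mathbf H)$ ($=+\infty$ if $\sigma_{\mathrm{ess}}(\mathbf H)=\varnothing$). Isoperimetric constants. $\mathcal K_{\mathcal G}$ is the set of finite connected subgraphs (with at least one edge). For $\widetilde{\mathcal G}=(\widetilde{\mathcal V},\widetilde{\mathcal E})\in\mathcal K_{\mathcal G}$: $\mathrm{mes}(\widetilde{\mathcal G})=\sum_{e\in\widetilde{\mathcal E}}|e|$, $\partial_{\mathcal G}\widetilde{\mathcal G}=\{v\in\widetilde{\mathcal V}: v\in\mathcal V_D\text{ or }\deg_{\widetilde{\mathcal G}}(v)<\deg_{\mathcal G}(v)\}$, $\deg(\partial_{\mathcal G}\widetilde{\mathcal G})=\sum_{v\in\partial_{\mathcal G}\widetilde{\mathcal G}}\deg_{\widetilde{\mathcal G}}(v)$. Then $\alpha(\mathcal G)=\inf_{\widetilde{\mathcal G}\in\mathcal K_{\mathcal G}}\deg(\partial_{\mathcal G}\widetilde{\mathcal G})/\mathrm{mes}(\widetilde{\mathcal G})$ and $\alpha_{\mathrm{ess}}(\mathcal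 G)=\sup_{\widetilde{\mathcal G}\in\mathcal K_{\mathcal G}}\alpha(\mathcal G\setminus\widetilde{\mathcal G})$, where $\alpha(\mathcal G\setminus\widetilde{\mathcal G})$ is the infimum of $\deg(\partial_{\mathcal G}\mathcal Y)/\mathrm{mes}(\mathcal Y)$ over finite connected subgraphs $\mathcal Y$ consisting of edges not in $\widetilde{\mathcal G}$ (boundary taken with respect to $\mathcal G$). *)

(* Defs.v *)
From HB Require Import structures.
From mathcomp Require Import all_boot all_order all_algebra finmap.
From mathcomp Require Import all_classical all_reals all_analysis.
From mathcomp Require Export complex.

Set Implicit Arguments.
Unset Strict Implicit.
Unset Printing Implicit Defensive.

Import Order.TTheory GRing.Theory Num.Theory.
Import numFieldNormedType.Exports.
Local Open Scope classical_set_scope.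
Local Open Scope ring_scope.
Local Open Scope complex_scope.

(* [org e] and [dst e] are the endpoints of the unoriented edge [e]; [e] is
   identified with [0, len e] so that 0 is glued to [org e] and [len e] to
   [dst e].  Degree-1 vertices outside [dirichlet] carry Neumann conditions. *)
Record metric_graph (R : realType) := MetricGraph {
  vertex : countType;
  edge : countType;
  org : edge -> vertex;
  dst : edge -> vertex;
  len : edge -> R;
  dirichlet : set vertex;
  _ : infinite_set [set: vertex];
  _ : infinite_set [set: edge];
  _ : forall e, org e != dst e;
  _ : forall e e', org e = org e' -> dst e = dst e' -> e = e';
  _ : forall e e', org e = dst e' -> dst e = org e' -> e = e';
  _ : forall v, finite_set [set e | (v == org e) || (v == dst e)];
  _ : forall x y, exists p,
        path (fun a b => `[< exists e, (org e, dst e) = (a, b)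
                                    \/ (org e, dst e) = (b, a) >]) x p
        /\ last x p = y;
  _ : forall e, 0 < len e;
  _ : forall v, v \in dirichlet ->
        #|` fset_set [set e | (v == org e) || (v == dst e)] |%fset = 1%N
}.
Arguments org {R m}.
Arguments dst {R m}.
Arguments len {R m}.
Arguments dirichlet {R} m.

Section Combinatorics.
Context {R : realType} (G : metric_graph R).
Implicit Types (v : vertex G) (e : edge G).
Local Open Scope fset_scope.

Definition incident v e : bool := (v == org e) || (v == dst e).

Definition star v : {fset edge G} := fset_set [set e | incident v e].

Definition degree v : nat := #|` star v |.

Definition ell_inf : \bar R := ereal_inf [set (len e)%:E | e in [set: edge G]].

Definition ell_sup : \bar R := ereal_sup [set (len e)%:E | e in [set: edge G]].

Definition ell_inf_ess : \bar R :=
  ereal_sup [set ereal_inf [set (len e)%:E | e in [set e | e \notin S]]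
            | S in [set: {fset edge G}]].

Record fin_subgraph := FinSubgraph {
  sverts : {fset vertex G};
  sedges : {fset edge G};
  _ : forall e, e \in sedges -> (org e \in sverts) && (dst e \in sverts)
}.
Implicit Types K Y : fin_subgraph.

Definition sub_adj Y : rel (vertex G) := fun a b =>
  `[< exists2 e, e \in sedges Y &
        (org e, dst e) = (a, b) \/ (org e, dst e) = (b, a) >].

Definition sub_connected Y : Prop :=
  forall x y, x \in sverts Y -> y \in sverts Y ->
    exists p, path (sub_adj Y) x p /\ last x p = y.

Definition KG : set fin_subgraph :=
  [set Y | sedges Y != fset0 /\ sub_connected Y].

Definition sub_degree Y v : nat := #|` [fset e in sedges Y | incident v e] |.

Definition mes Y : R := (\sum_(e <- sedges Y) len e)%R.

Definition boundary Y : {fset vertex G} :=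
  [fset v in sverts Y |
     (v \in dirichlet G) || (sub_degree Y v < degree v)%N].

Definition deg_boundary Y : nat := (\sum_(v <- boundary Y) sub_degree Y v)%N.

Definition iso_quotient Y : \bar R := ((deg_boundary Y)%:R / mes Y)%:E.

Definition alpha : \bar R := ereal_inf [set iso_quotient Y | Y in KG].

(* alpha (G \ K), the boundary being taken with respect to G *)
Definition alpha_minus K : \bar R :=
  ereal_inf [set iso_quotient Y
            | Y in [set Y | KG Y /\ [disjoint sedges Y & sedges K]%fset]].

Definition alpha_ess : \bar R := ereal_sup [set alpha_minus K | K in KG].

End Combinatorics.

Section Operator.
Context {R : realType} (G : metric_graph R).
Local Notation mu := (@lebesgue_measure R).

(* A function on G is a family of functions on the edges: only the values
   [f e x] with x in [0, len e] are meaningful. *)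
Definition gfun := edge G -> R -> R[i].
Implicit Types (u v w f g : gfun).

Definition sqmod (z : R[i]) : R := complex.Re z ^+ 2 + complex.Im z ^+ 2.

Definition cintegral (A : set R) (h : R -> R[i]) : R[i] :=
  (\int[mu]_(x in A) complex.Re (h x)) +i* (\int[mu]_(x in A) complex.Im (h x)).

(* [\esum] is only meaningful for nonnegative terms; the sum of an absolutely
   summable real family is the difference of the sums of its two parts. *)
Definition rsum (a : edge G -> R) : R :=
  fine (\esum_(e in [set: edge G]) (Num.max (a e) 0)%:E)
  - fine (\esum_(e in [set: edge G]) (Num.max (- a e) 0)%:E).

Definition csum (a : edge G -> R[i]) : R[i] :=
  rsum (fun e => complex.Re (a e)) +i* rsum (fun e => complex.Im (a e)).

Definition meas_on (l : R) (h : R -> R[i]) : Prop :=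
  measurable_fun `[0, l] (fun x => complex.Re (h x)) /\
  measurable_fun `[0, l] (fun x => complex.Im (h x)).

Definition normsq_on (l : R) (h : R -> R[i]) : \bar R :=
  (\int[mu]_(x in `[0%R, l]) (sqmod (h x))%:E)%E.

Definition normsq f : \bar R :=
  \esum_(e in [set: edge G]) normsq_on (len e) (f e).

(* Elements of L^2(G) are represented by functions; two representatives f, g
   define the same element iff normsq (f - g) = 0. *)
Definition L2 f : Prop :=
  (forall e, meas_on (len e) (f e)) /\ (normsq f < +oo)%E.

Definition inner f g : R[i] :=
  csum (fun e => cintegral `[0, len e] (fun x => f e x * (g e x)^*)).

(* h in H^2(0, l), in its C^1([0, l]) representative, with first and second
   derivatives h1 and h2: h and h1 are absolutely continuous and h2 in L^2. *)
Definition sobolev2 (l : R) (h h1 h2 : R -> R[i]) : Prop :=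
  [/\ meas_on l h2, (normsq_on l h2 < +oo)%E,
      forall x, 0 <= x <= l -> h x = h 0 + cintegral `[0, x] h1 &
      forall x, 0 <= x <= l -> h1 x = h1 0 + cintegral `[0, x] h2].

Definition trace f (a : vertex G) (e : edge G) : R[i] :=
  if a == org e then f e 0 else f e (len e).

(* derivative at the endpoint a of e, from a into e, if f1 is f' *)
Definition inward f1 (a : vertex G) (e : edge G) : R[i] :=
  if a == org e then f1 e 0 else - f1 e (len e).

Definition dom_H0 f : Prop :=
  exists f1 f2,
  [/\ forall e, sobolev2 (len e) (f e) (f1 e) (f2 e),
      finite_set [set e | exists2 x, 0 <= x <= len e & f e x != 0],
      forall a, a \in dirichlet G ->
        forall e, incident a e -> trace f a e = 0,
      forall a, a \notin dirichlet G ->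
        forall e e', incident a e -> incident a e' ->
          trace f a e = trace f a e' &
      forall a, a \notin dirichlet G ->
        \sum_(e <- star a) inward f1 a e = 0].

Definition grad f : gfun := fun e x =>
  derive1 (fun t => complex.Re (f e t)) x
  +i* derive1 (fun t => complex.Im (f e t)) x.

(* the form t(f, g) = \int_G f' (g')^* on dom_H0, and t(f, f) *)
Definition form f g : R[i] := inner (grad f) (grad g).
Definition energy f : \bar R := normsq (grad f).

(* F lies in dom_H0, converges to u in L^2 and is Cauchy for t *)
Definition form_approx (F : nat -> gfun) u : Prop :=
  [/\ forall n, dom_H0 (F n),
      (fun n => normsq (fun e x => F n e x - u e x)) @ \oo --> (0%R)%:E &
      forall eps : R, 0 < eps -> exists N : nat, forall m n : nat,
        (N <= m)%N -> (N <= n)%N ->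
        (energy (fun e x => F m e x - F n e x)%R < eps%:E)%E].

Definition closed_form_dom u : Prop := L2 u /\ exists F, form_approx F u.

(* c is the value at (u, v) of the closure of t *)
Definition closed_form u v (c : R[i]) : Prop :=
  exists F F',
  [/\ form_approx F u, form_approx F' v,
      (fun n => complex.Re (form (F n) (F' n))) @ \oo --> complex.Re c &
      (fun n => complex.Im (form (F n) (F' n))) @ \oo --> complex.Im c].

(* u in dom(H) and H u = w (as elements of L^2(G)), where H is the
   self-adjoint operator associated with the closure of t *)
Definition kirchhoff u w : Prop :=
  [/\ closed_form_dom u, L2 w &
      forall v c, closed_form_dom v -> closed_form u v c -> c = inner w v].

(* H - z maps dom(H) onto L^2(G) and is bounded below; the bound also gives
   injectivity, so this says that (H - z)^{-1} exists and is bounded. *)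
Definition resolvent_set : set R[i] := [set z |
  (forall g, L2 g -> exists u, kirchhoff u (fun e x => z * u e x + g e x)) /\
  (exists C : R, forall u g, kirchhoff u (fun e x => z * u e x + g e x) ->
     (normsq u <= C%:E * normsq g)%E)].

Definition spectrum : set R[i] := ~` resolvent_set.

Definition eigenspace (z : R[i]) : set gfun := [set u |
  kirchhoff u (fun e x => z * u e x)].

Definition discrete_spectrum : set R[i] := [set z |
  [/\ exists2 eps : R, 0 < eps &
        forall y, spectrum y -> `|y - z| < eps%:C -> y = z,
      exists2 u, eigenspace z u & normsq u != 0%E &
      exists n (b : 'I_n -> gfun), (forall i, eigenspace z (b i)) /\
        forall u, eigenspace z u -> exists c : 'I_n -> R[i],
          normsq (fun e x => u e x - \sum_(i < n) c i * b i e x) = 0%E]].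

Definition essential_spectrum : set R[i] := spectrum `\` discrete_spectrum.

(* H is self-adjoint, so both spectra consist of real numbers. *)
Definition lambda0 : \bar R :=
  ereal_inf [set x%:E | x in [set x : R | spectrum x%:C]].

Definition lambda0_ess : \bar R :=
  ereal_inf [set x%:E | x in [set x : R | essential_spectrum x%:C]].

End Operator.

(* Main.v *)
Require Import Defs.
From HB Require Import structures.
From mathcomp Require Import all_boot all_order all_algebra finmap.
From mathcomp Require Import all_classical all_reals all_analysis.
From mathcomp Require Import measurable_realfun ring lra.

(** Both bounds follow from Rayleigh quotients of test functions.  On a finite
    connected subgraph take the function that is 1 at interior vertices, 0 at
    boundary vertices, and a quarter or half sine wave on the edges that meet the
    boundary: each boundary end of an edge [e] costs at most [pi ^ 2 / (4 |e|)] of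
    energy, while the squared norm is at least half of the measure.  The sine
    profile is flattened near its zeros so that the result lies in the domain of
    [H_0].

    That the infimum [m] of the Rayleigh quotient lies in the spectrum is seen by
    testing [(H - m) u = f], for a near minimiser [f], against [f] and applying the
    Cauchy-Schwarz inequality to the nonnegative form [t - m].  For the essential
    spectrum the same argument is applied to the supremum [m] of the lower bounds of
    the form on orthogonals of finite families.  If [m] were an isolated eigenvalue of
    finite multiplicity, then [1 + th (H - m - th)^-1] would be bounded below on the
    orthogonal of the eigenspace, which the near minimisers contradict.  Test
    functions with disjoint supports bound this [m] from above. *)

Set Implicit Arguments.
Unset Strict Implicit.
Unset Printing Implicit Defensive.

Import Order.TTheory GRing.Theory Num.Theory.
Import numFieldNormedType.Exports.
Local Open Scope classical_set_scope.
Local Open Scope ring_scope.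

(** * Spectrum of the operator of a closed form *)

(** No functional calculus is used. In a spectral gap of radius [k] around [y], the estimate
    [|(H - y) u| >= k |u|] is obtained by taking the largest admissible constant and improving it;
    the spectral projection at an isolated eigenvalue is replaced by a minimising sequence. The
    common tool is the Cauchy-Schwarz inequality for a quadratic form known only along lines.
    [discriminant_le] states it for scalars, so that it serves the shifted form [t - m], the form of
    [(H - y) ^ 2 - c ^ 2] and that of [1 + th (H - m - th)^-1] alike, none of which is set up as an
    inner product.

    The abstract space is real: the complex L2(G) enters with the real part of its inner product,
    and complex linearity returns as multiplication by ['i] when the operator and its eigenspaces
    are translated. Functions equal almost everywhere are not identified, so inner products are only
    semidefinite, and a resolvent picked by choice is linear only up to null vectors. *)

Lemma discriminant_le (R : realFieldType) (a b c : R) : 0 <= c ->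
  (forall t, 0 <= b + t * (2 * a) + t ^+ 2 * c) -> a ^+ 2 <= b * c.
Proof.
move=> c0 h; have [cE|cn0] := eqVneq c 0.
  have [->|an0] := eqVneq a 0; first by rewrite expr0n cE mulr0.
  have := h (- (b + 1) / (2 * a)).
  rewrite cE mulr0 addr0 divfK ?mulf_neq0 ?pnatr_eq0//; lra.
have {cn0}c0 : 0 < c by rewrite lt_def cn0.
have := h (- a / c).
have -> : b + - a / c * (2 * a) + (- a / c) ^+ 2 * c = (b * c - a ^+ 2) / c.
  by field; rewrite gt_eqF.
by rewrite pmulr_lge0 ?invr_gt0// subr_ge0.
Qed.

Record semi_inner (R : realType) (X : lmodType R) (ip : X -> X -> R) : Prop := {
  ipC : forall x y, ip x y = ip y x;
  ipDl : forall x y z, ip (x + y) z = ip x z + ip y z;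
  ipZl : forall a x z, ip (a *: x) z = a * ip x z;
  ip_ge0 : forall x, 0 <= ip x x }.

Definition ip_complete (R : realType) (X : lmodType R) (ip : X -> X -> R) :=
  forall x : nat -> X,
    (forall e, 0 < e -> exists N : nat, forall m n, (N <= m)%N -> (N <= n)%N ->
       ip (x m - x n) (x m - x n) < e) ->
    exists h, forall e, 0 < e -> exists N : nat, forall n, (N <= n)%N ->
       ip (x n - h) (x n - h) < e.

Section SemiInnerTheory.
Variables (R : realType) (X : lmodType R) (ip : X -> X -> R).
Hypothesis sip : semi_inner ip.
Implicit Types x y z : X.

Lemma ipDr x y z : ip z (x + y) = ip z x + ip z y.
Proof. by rewrite (ipC sip) (ipDl sip) !(ipC sip z). Qed.

Lemma ipZr a x z : ip z (a *: x) = a * ip z x.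
Proof. by rewrite (ipC sip) (ipZl sip) (ipC sip z). Qed.

Lemma ipNl x z : ip (- x) z = - ip x z.
Proof. by rewrite -scaleN1r (ipZl sip) mulN1r. Qed.

Lemma ipNr x z : ip z (- x) = - ip z x.
Proof. by rewrite (ipC sip) ipNl (ipC sip). Qed.

Lemma ip0l x : ip 0 x = 0.
Proof. by rewrite -(scale0r 0) (ipZl sip) mul0r. Qed.

Definition ipE := (ipDl sip, ipDr, ipNl, ipNr, ipZl sip, ipZr).

Lemma ip_CS x y : ip x y ^+ 2 <= ip x x * ip y y.
Proof.
apply: discriminant_le => [|t]; first exact: ip_ge0.
have := ip_ge0 sip (x + t *: y); rewrite !ipE (ipC sip y x).
by congr (_ <= _); ring.
Qed.

Lemma ip_null x y : ip x x = 0 -> ip x y = 0.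
Proof.
move=> x0; apply/eqP; rewrite -sqrf_eq0 eq_le sqr_ge0 andbT.
by rewrite (le_trans (ip_CS x y))// x0 mul0r.
Qed.

Lemma ip_le x y : 2 * `|ip x y| <= ip x x + ip y y.
Proof.
have := ip_ge0 sip (x + y); have := ip_ge0 sip (x - y); rewrite !ipE (ipC sip y x).
have [h|h] := ger0P (ip x y); lra.
Qed.

Lemma ip_sum n (c : 'I_n -> R) (F : 'I_n -> X) x :
  ip (\sum_(i < n) c i *: F i) x = \sum_(i < n) c i * ip (F i) x.
Proof.
elim/big_ind2 : _ => [|u a v b <- <-|i _]; first exact: ip0l.
  exact: ipDl.
exact: ipZl.
Qed.

End SemiInnerTheory.

(* The operator associated with the form [ip p q], where [G] is the graph of
   the closure of the gradient: [G u p] says that [u] lies in the form domain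
   with gradient [p]. *)
Section FormOperator.
Variables (R : realType) (X : lmodType R) (ip : X -> X -> R).
Variable G : X -> X -> Prop.

(** The relation [G] may give [u] several gradients, as happens when null functions can be added to
    them, so the identity is required for each of them. *)
Definition form_op u w := (exists p, G u p) /\
  forall p v q, G u p -> G v q -> ip p q = ip w v.

Definition rho (z : R) :=
  (forall g, exists u, form_op u (z *: u + g)) /\
  exists C : R, forall u g, form_op u (z *: u + g) -> ip u u <= C * ip g g.

Definition form_ge (V : seq X) (m : R) := forall u p, G u p ->
  (forall v, v \in V -> ip u v = 0) -> m * ip u u <= ip p p.

Hypothesis sip : semi_inner ip.
Hypothesis GD : forall u p v q, G u p -> G v q -> G (u + v) (p + q).
Hypothesis GZ : forall a u p, G u p -> G (a *: u) (a *: p).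
Let iE := ipE sip.
Let ip0 := ip_ge0 sip.
Let iC := ipC sip.

Lemma form_opD u w u' w' :
  form_op u w -> form_op u' w' -> form_op (u + u') (w + w').
Proof.
move=> [[p up] h] [[p' up'] h']; split; first by exists (p + p'); exact: GD.
move=> r v q ur vq.
(* A gradient [r] of the sum need not be [p + p']; subtracting [p'] leaves some gradient of [u], to
   which the hypothesis applies. *)
have ur' : G u (r - p').
  by have := GD ur (GZ (- 1) up'); rewrite !scaleN1r addrK.
have := h _ _ _ ur' vq; have := h' _ _ _ up' vq.
by rewrite !iE => <- <-; ring.
Qed.

Lemma form_opZ a u w : form_op u w -> form_op (a *: u) (a *: w).
Proof.
move=> [[p up] h]; split; first by exists (a *: p); exact: GZ.
move=> r v q ur vq.
(* Writing [u] as [a u - (a - 1) u] avoids dividing by [a], so [a = 0] is included. *)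
have ur' : G u (r - (a - 1) *: p).
  have := GD ur (GZ (1 - a) up).
  by rewrite -scalerDl addrC subrK scale1r -scaleNr opprB.
have := h _ _ _ ur' vq; have := h _ _ _ up vq.
by rewrite !iE => -> /eqP; rewrite subr_eq => /eqP ->; ring.
Qed.

Lemma form_op_sym u w v z : form_op u w -> form_op v z -> ip w v = ip u z.
Proof.
move=> [[p up] h] [[q vq] h'].
by rewrite -(h _ _ _ up vq) (iC u) -(h' _ _ _ vq up).
Qed.

Lemma form_op_congr u w w' :
  form_op u w -> ip (w - w') (w - w') = 0 -> form_op u w'.
Proof.
move=> [ex h] e; split=> // p v q up vq; rewrite (h _ _ _ up vq).
by have := ip_null sip v e; rewrite !iE => /eqP; rewrite subr_eq0 => /eqP.
Qed.

Lemma rho_bound z : rho z ->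
  exists2 C : R, 1 <= C & forall u g, form_op u (z *: u + g) -> ip u u <= C * ip g g.
Proof.
move=> [_ [C h]]; exists (Num.max C 1); first by rewrite le_max lexx orbT.
move=> u g /h/le_trans; apply; rewrite ler_wpM2r//.
by rewrite le_max lexx.
Qed.

(** The clause on [[::]] lets the bottom of the spectrum, where nothing is orthogonalised, share
    [near_minimizer] with the essential spectrum. *)
Lemma seq_witness (T : eqType) (P : T -> T -> Prop) (s : seq T) :
  (forall x, exists y, P x y) ->
  exists s' : seq T, (s = [::] -> s' = [::]) /\
    forall x, x \in s -> exists2 y, y \in s' & P x y.
Proof.
move=> /choice[f fP]; exists (map f s); split=> [->//|x xs].
by exists (f x) => //; exact: map_f.
Qed.

(* If [mu] is nearly a lower bound of the form on the orthogonal of [V], then a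
   near minimiser [f] is an approximate eigenvector; its image [u] under the
   resolvent at [mu + th] is then almost [- f / th]. *)
Lemma near_minimizer (mu th eta : R) : 0 < eta -> rho (mu + th) ->
  exists2 e : R, 0 < e & forall V, form_ge V (mu - e) ->
  exists W : seq X, (V = [::] -> W = [::]) /\
    forall f p u, G f p ->
    (forall v, v \in V -> ip f v = 0) -> (forall w, w \in W -> ip f w = 0) ->
    ip p p <= (mu + e) * ip f f ->
    form_op u ((mu + th) *: u + f) -> `|ip f f + th * ip u f| <= eta * ip f f.
Proof.
move=> eta0 rh; have [C C1 hC] := rho_bound rh.
(* [K |f|^2] will bound the form [t - (mu - e)] at [u]; the choice of [e] ensures
   [e |ip u f| <= eta / 2 |f|^2] and [2 K e <= (eta / 2)^2]. *)
pose K : R := C * (`|th| + 2).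
have K0 : 0 < K by rewrite mulr_gt0//; have := normr_ge0 th; lra.
pose e := Num.min 1 (Num.min (eta / (2 * C)) (eta ^+ 2 / (8 * K))).
have e0 : 0 < e.
  rewrite !lt_min ltr01/=; apply/andP; split.
    by apply: divr_gt0 => //; lra.
  by rewrite divr_gt0 ?exprn_gt0 // mulr_gt0.
have e1 : e <= 1 by rewrite !ge_min lexx.
have eC : e * C <= eta / 2.
  have : e <= eta / (2 * C) by rewrite !ge_min lexx !orbT.
  rewrite ler_pdivlMr; lra.
have eK : 8 * (K * e) <= eta ^+ 2.
  have : e <= eta ^+ 2 / (8 * K) by rewrite !ge_min lexx !orbT.
  rewrite ler_pdivlMr; lra.
exists e => // V hV.
have [W [W0 hW]] := seq_witness V rh.1.
exists W; split=> // f p u fp fV fW pf uf.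
(* [W] holds preimages [r] of the [v] in [V] under [H - (mu + th)]; by symmetry
   [ip u v = ip f r = 0], so the lower bound of the form also applies to [u]. *)
have uV v : v \in V -> ip u v = 0.
  move=> vV; have [r rW rv] := hW _ vV.
  have := form_op_sym uf rv; rewrite !iE (fW _ rW); lra.
have [[q uq] hu] := uf.
have qp := hu _ _ _ uq fp; have qq := hu _ _ _ uq uq; rewrite !iE in qp qq.
(* Cauchy-Schwarz for [t - (mu - e)], nonnegative on the orthogonal of [V]. Its value at the near
   minimiser [f] is at most [2 e |f|^2]. *)
have CS : (ip q p - (mu - e) * ip u f) ^+ 2 <=
    (ip q q - (mu - e) * ip u u) * (ip p p - (mu - e) * ip f f).
  apply: discriminant_le => [|t]; first by rewrite subr_ge0; exact: hV fp fV.
  have := hV _ _ (GD uq (GZ t fp)).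
  have -> : (forall v, v \in V -> ip (u + t *: f) v = 0) <-> True.
    by split=> // _ v vV; rewrite !iE uV// fV// mulr0 addr0.
  move=> /(_ I); rewrite !iE (iC f u) (iC p q) -subr_ge0.
  by congr (_ <= _); ring.
have uu := hC _ _ uf; have uf2 := ip_le sip u f.
set F := ip f f in pf CS uu uf2 qp *; have F0 : 0 <= F by exact: ip0.
set a := ip u f in qp CS uf2 *; set U := ip u u in qq CS uu uf2.
have U0 : 0 <= U by exact: ip0.
rewrite (iC f u) -/a in qq.
have aF : `|a| <= C * F by have h : F <= C * F by [rewrite ler_peMl]; lra.
have ae : `|e * a| <= eta / 2 * F.
  rewrite normrM gtr0_norm// (le_trans (ler_wpM2l (ltW e0) aF))// mulrA.
  exact: ler_wpM2r.
set s := ip q p - (mu - e) * a in CS.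
(* [t(u, f) = (mu + th) ip u f + |f|^2] identifies the mixed term with the quantity to be bounded,
   up to [e a]. *)
have sE : F + th * a = s - e * a by rewrite /s qp; ring.
have s2 : s ^+ 2 <= (eta / 2 * F) ^+ 2.
  have b1 : ip q q - (mu - e) * U <= K * F.
    have -> : ip q q - (mu - e) * U = (th + e) * U + a by rewrite qq; ring.
    have := ler_norm a; have := ler_norm th.
    have thU : `|th| * U <= `|th| * (C * F) by rewrite ler_wpM2l.
    have eU : e * U <= C * F by rewrite (le_trans _ uu)// ler_piMl.
    have : th * U <= `|th| * U by rewrite ler_wpM2r// ler_norm.
    rewrite /K; lra.
  have c1 : ip p p - (mu - e) * F <= 2 * e * F by lra.
  apply: (le_trans CS); apply: (@le_trans _ _ (K * F * (2 * e * F))).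
    apply: ler_pM => //; rewrite subr_ge0; first exact: hV uq uV.
    exact: hV fp fV.
  have -> : K * F * (2 * e * F) = (8 * (K * e)) * (F ^+ 2 / 4) by field.
  have -> : (eta / 2 * F) ^+ 2 = eta ^+ 2 * (F ^+ 2 / 4) by field.
  by rewrite ler_wpM2r// divr_ge0// sqr_ge0.
have sF : `|s| <= eta / 2 * F.
  by move: s2; rewrite -real_normK ?num_real// ler_pXn2r ?nnegrE// mulr_ge0// divr_ge0// ltW.
by rewrite sE (le_trans (ler_normB _ _))//; lra.
Qed.

Lemma rho_le_rayleigh f p : G f p -> 0 < ip f f ->
  exists2 l : R, ~ rho l & l <= ip p p / ip f f.
Proof.
move=> fp f0; pose L := [set l | form_ge [::] l].
have nil0 (x : X) v : v \in [::] -> ip x v = 0 by [].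
have L0 : L 0 by move=> u q _ _; rewrite mul0r.
have Lub : ubound L (ip p p / ip f f).
  by move=> l /(_ _ _ fp (nil0 f)); rewrite ler_pdivlMr.
have Lsup : has_sup L by split; [exists 0|exists (ip p p / ip f f)].
exists (sup L); last by apply: ge_sup => //; exists 0.
rewrite -[sup L]addr0 => rh.
(* With [th = 0] and [eta = 1 / 2], a near minimiser [f] would satisfy [|f|^2 <= |f|^2 / 2]. *)
have [e e0 he] := near_minimizer (divr_gt0 ltr01 (ltr0Sn R 1)) rh.
have [|W [W0 {}he]] := he [::].
  have [l Ll sl] := sup_adherent e0 Lsup.
  move=> u q uq uV; apply: le_trans (Ll _ _ uq uV).
  by rewrite ler_wpM2r// ltW.
have : ~ L (sup L + e).
  by move=> /(ub_le_sup Lsup.2); rewrite gerDl leNgt e0.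
apply => u q uq _; rewrite leNgt; apply/negP => qu.
have [r ur] := rh.1 u.
have := he u q r uq (nil0 u); rewrite W0// => /(_ (nil0 u) (ltW qu) ur).
rewrite mul0r addr0 ger0_norm ?ip0// => uu.
have u0 : ip u u = 0 by have := ip0 u; lra.
by move: qu; rewrite u0 mulr0 ltNge ip0.
Qed.

Lemma form_op_shift y k u w : form_op u (y *: u + w) ->
  form_op u ((y + k) *: u + (w - k *: u)).
Proof. by rewrite scalerDl addrACA subrr addr0. Qed.

(* If [c] is the largest constant with [c |u| <= |(H - y) u|] and [y - c],
   [y + c] are regular, then testing [(H - y) ^ 2 - c ^ 2] against its inverse
   improves [c]. *)
Lemma gap_lower_bound (y k : R) : 0 <= k ->
  (forall z, `|z - y| < k -> rho z) ->
  forall u w, form_op u (y *: u + w) -> k ^+ 2 * ip u u <= ip w w.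
Proof.
move=> k0 hr.
pose K := [set c : R | 0 <= c <= k /\
  forall u w, form_op u (y *: u + w) -> c ^+ 2 * ip u u <= ip w w].
have K0 : K 0 by split=> [|u w _]; rewrite ?lexx// expr0n mul0r.
have Kk : ubound K k by move=> c [/andP[]].
have Ksup : has_sup K by split; [exists 0|exists k].
pose c := sup K.
have c0 : 0 <= c by exact: (ub_le_sup Ksup.2 K0).
have ck : c <= k by apply: ge_sup => //; exists 0.
have cK u w : form_op u (y *: u + w) -> c ^+ 2 * ip u u <= ip w w.
  move=> uw; have [u0|u0] := eqVneq (ip u u) 0; first by rewrite u0 mulr0.
  have {}u0 : 0 < ip u u by rewrite lt_def u0 ip0.
  rewrite -ler_pdivlMr//.
  have s0 : 0 <= ip w w / ip u u by rewrite divr_ge0.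
  rewrite -[leRHS](sqr_sqrtr s0) ler_pXn2r ?nnegrE ?sqrtr_ge0//.
  apply: ge_sup; first by exists 0.
  move=> d [/andP[d0 _] /(_ _ _ uw)]; rewrite -ler_pdivlMr// => h.
  by rewrite -(@ler_pXn2r _ 2) ?nnegrE ?sqrtr_ge0// sqr_sqrtr.
have [ckE|] := eqVneq c k; first by rewrite -ckE.
rewrite eq_le ck/= -ltNge => {}ck; exfalso.
have rp : rho (y + c) by apply: hr; rewrite addrC addKr ger0_norm.
have rm : rho (y - c) by apply: hr; rewrite addrC addKr normrN ger0_norm.
have [C1 C11 hC1] := rho_bound rp; have [C2 C21 hC2] := rho_bound rm.
pose C : R := C1 * (1 + c * (1 + C2)).
have cC0 : 0 <= c * (1 + C2) by apply: mulr_ge0 => //; lra.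
have C0 : 0 < C by apply: mulr_gt0; lra.
have D0 : 0 < C * (2 * c + 1) by apply: mulr_gt0 => //; lra.
pose e : R := Num.min 1 (Num.min (k - c) (1 / (2 * (C * (2 * c + 1))))).
have e0 : 0 < e.
  rewrite !lt_min ltr01 subr_gt0 ck/=; apply: divr_gt0 => //; lra.
have e1 : e <= 1 by rewrite !ge_min lexx.
have eck : c + e <= k by rewrite addrC -lerBrDr !ge_min lexx orbT.
have eC : 2 * (e * (C * (2 * c + 1))) <= 1.
  have : e <= 1 / (2 * (C * (2 * c + 1))) by rewrite !ge_min lexx !orbT.
  by rewrite ler_pdivlMr; lra.
have [] : ~ K (c + e).
  by move=> /(ub_le_sup Ksup.2); rewrite -/c gerDl leNgt e0.
split; first by rewrite eck addr_ge0// ltW.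
move=> f g fg; rewrite leNgt; apply/negP => gf.
(* [(H - y - c) v = f] and [(H - y + c) u = v], so [u] is the image of [f] under the inverse of
   [(H - y) ^ 2 - c ^ 2]. *)
have [v fv] := rp.1 f; have [u uv] := rm.1 v.
have vF := hC1 _ _ fv; have uV := hC2 _ _ uv.
have {}uv : form_op u (y *: u + (v - c *: u)).
  by have := form_op_shift c uv; rewrite subrK.
have {}fv : form_op v (y *: v + (f + c *: v)).
  by have := form_op_shift (- c) fv; rewrite addrK scaleNr opprK.
have gv := form_op_sym fg fv; have gu := form_op_sym fg uv.
rewrite !iE in gv gu.
(* For [q(x) = |(H - y) x|^2 - c^2 |x|^2], the choice of [u] gives [q(u, f) = |f|^2] and
   [q(u, u) <= C |f|^2], while [q(f, f) <= e (2 c + 1) |f|^2] because [f] violates the bound with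
   [c + e]. Hence [|f|^4 <= |f|^4 / 2]. *)
have CS : (ip (v - c *: u) g - c ^+ 2 * ip u f) ^+ 2 <=
   (ip (v - c *: u) (v - c *: u) - c ^+ 2 * ip u u) *
   (ip g g - c ^+ 2 * ip f f).
  apply: discriminant_le => [|t]; first by rewrite subr_ge0; exact: cK fg.
  have : form_op (u + t *: f) (y *: (u + t *: f) + ((v - c *: u) + t *: g)).
    rewrite scalerDr addrACA scalerA [y * t]mulrC -scalerA -scalerDr.
    by apply: form_opD => //; exact: form_opZ.
  move=> /cK; rewrite -subr_ge0 [ip (u + _) _](ipDl sip) [ip _ (u + _)](ipDr sip).
  rewrite ![ip _ (t *: f)](ipZr sip) ![ip _ (u + _)](ipDr sip).
  rewrite ![ip _ (t *: f)](ipZr sip) ![ip (t *: f) _](ipZl sip).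
  rewrite [ip (_ + t *: g) _](ipDl sip) ![ip _ (_ + t *: g)](ipDr sip).
  rewrite ![ip (t *: g) _](ipZl sip) ![ip _ (t *: g)](ipZr sip).
  rewrite (iC g (v - _)) (iC f u).
  by congr (_ <= _); ring.
have qE : ip (v - c *: u) g - c ^+ 2 * ip u f = ip f f.
  by rewrite !iE (iC v g) (iC u g) (iC u f); nra.
have quE : ip (v - c *: u) (v - c *: u) - c ^+ 2 * ip u u <= C * ip f f.
  have -> : ip (v - c *: u) (v - c *: u) - c ^+ 2 * ip u u =
      ip v v + c * (2 * - ip u v) by rewrite !iE (iC v u); ring.
  have h : 2 * - ip u v <= (1 + C2) * ip v v.
    have := ip_le sip u v; have := ler_norm (- ip u v).
    rewrite normrN; lra.
  apply: (@le_trans _ _ ((1 + c * (1 + C2)) * ip v v)).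
    by rewrite [leRHS]mulrDl mul1r lerD2l -mulrA ler_wpM2l.
  rewrite /C [C1 * _]mulrC -mulrA ler_wpM2l//; lra.
have gfE : ip g g - c ^+ 2 * ip f f <= e * (2 * c + 1) * ip f f.
  have : e * (e * ip f f) <= e * ip f f by rewrite ler_piMl// mulr_ge0 ?ip0 ?(ltW e0).
  by lra.
have f0 : ip f f = 0.
  rewrite qE in CS; have := ip0 f; set F := ip f f in CS quE gfE * => F0.
  have : F ^+ 2 <= C * F * (e * (2 * c + 1) * F).
    by rewrite (le_trans CS)// ler_pM// subr_ge0; [exact: cK uv|exact: cK fg].
  have -> : C * F * (e * (2 * c + 1) * F) = e * (C * (2 * c + 1)) * F ^+ 2 by ring.
  move=> h; apply/eqP; rewrite -sqrf_eq0 eq_le sqr_ge0 andbT.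
  have : 2 * (e * (C * (2 * c + 1))) * F ^+ 2 <= F ^+ 2 by rewrite ler_piMl// sqr_ge0.
  by lra.
by move: gf; rewrite f0 mulr0 ltNge ip0.
Qed.
End FormOperator.

(** * Isolated points of the spectrum *)

Section IsolatedPoint.
Variables (R : realType) (X : lmodType R) (ip : X -> X -> R).
Variable G : X -> X -> Prop.
Hypothesis sip : semi_inner ip.
Hypothesis cip : ip_complete ip.
Hypothesis GD : forall u p v q, G u p -> G v q -> G (u + v) (p + q).
Hypothesis GZ : forall a u p, G u p -> G (a *: u) (a *: p).
Let iE := ipE sip.
Let ip0 := ip_ge0 sip.
Let iC := ipC sip.
Local Notation form_op := (form_op ip G).
Local Notation rho := (rho ip G).

(* With [B = H - mu] and [T] its resolvent at [th], the operator
   [D = 1 + th T = B T] satisfies [D >= 0] and [D ^ 2 >= (2 / 3) D], hence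
   [D >= 2 / 3] on the range of [D]. That range is dense in the orthogonal of the
   eigenspace: the residual of the projection onto its closure is killed by [D],
   so [T] maps it to an eigenvector. *)
Lemma isolated_resolvent_gap (mu th : R) : 0 < th ->
  (forall z, 0 < `|z - mu| < 3 * th -> rho z) ->
  forall f, (forall u, form_op u (mu *: u) -> ip f u = 0) ->
  forall u, form_op u ((mu + th) *: u + f) ->
  2 / 3 * ip f f <= ip f f + th * ip u f.
Proof.
move=> th0 hr f fE u uf.
pose y := mu + th.
have ry : rho y by apply: hr; rewrite addrC addKr gtr0_norm//; lra.
have [T TP] := choice ry.1.
have Tsym g h : ip (T g) h = ip g (T h).
  by have := form_op_sym sip (TP g) (TP h); rewrite !iE; lra.
have [D DE] : {D | forall g, D g = g + th *: T g} by exists (fun g => g + th *: T g).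
have Dsym g h : ip (D g) h = ip g (D h) by rewrite !DE !iE Tsym.
have DB g : form_op (T g) (mu *: T g + D g).
  by rewrite DE [g + _]addrC addrA -scalerDl.
(* [T] comes from a choice, so [D] is linear only when tested against vectors; its symmetry yields
   this. *)
have Dlin g t h z : ip (D (g + t *: h)) z = ip (D g + t *: D h) z.
  by rewrite Dsym !iE -!Dsym.
(* The gap to the right of [mu], centred at [mu + th], gives [th |T g| <= |g|]. The gap to the left,
   centred at [mu - th] where [(H - mu + th) T g = g + 2 th T g], gives [|g|^2 + 4 th ip (T g) g + 3
   th^2 |T g|^2 >= 0]. The left side is three times the form of [D ^ 2 - (2 / 3) D], whence the
   constant [2 / 3]. *)
have TDineq g :
    [/\ 0 <= ip (D g) g, 2 / 3 * ip (D g) g <= ip (D g) (D g) &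
      ip (D g) (D g) <= 4 * ip g g].
  have h1 : th ^+ 2 * ip (T g) (T g) <= ip g g.
    apply: (gap_lower_bound sip GD GZ (ltW th0) _ (TP g)) => z zy.
    apply: hr; move: zy; rewrite /y !ltr_norml => /andP[z1 z2].
    apply/andP; split; first by rewrite normr_gt0; apply/eqP; lra.
    by apply/andP; split; lra.
  have h2 : th ^+ 2 * ip (T g) (T g) <=
      ip (g - - (2 * th) *: T g) (g - - (2 * th) *: T g).
    have /(_ (- (2 * th)))/(_ (T g))/(_ g) := @form_op_shift _ _ ip G y.
    move=> /(_ (TP g)).
    apply: (gap_lower_bound sip GD GZ (ltW th0)) => z zy.
    apply: hr; move: zy; rewrite /y !ltr_norml => /andP[z1 z2].
    apply/andP; split; first by rewrite normr_gt0; apply/eqP; lra.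
    by apply/andP; split; lra.
  have h3 := ip_le sip (th *: T g) g.
  have h4 := ler_norm (ip (th *: T g) g).
  have gT := iC g (T g).
  by rewrite !DE; rewrite !iE gT in h2 h3 h4 *; split; lra.
(* Cauchy-Schwarz for the nonnegative form of [D] at [w] and [D w], combined with
   [(2 / 3) ip (D w) w <= |D w|^2]. *)
have DD w : 2 / 3 * ip (D w) (D w) <= ip (D (D w)) (D w).
  have [Q0 _ _] := TDineq (D w).
  have [_ N0 _] := TDineq w.
  have : ip (D w) (D w) ^+ 2 <= ip (D w) w * ip (D (D w)) (D w).
    apply: discriminant_le => // t.
    have [+ _ _] := TDineq (w + t *: D w).
    rewrite Dlin !iE (Dsym (D w) w).
    by congr (_ <= _); ring.
  set Q := ip (D (D w)) _ in Q0 *; set N := ip (D w) (D w) in N0 *.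
  have NN : 0 <= N by exact: ip0.
  move=> h; have [->|Nn] := eqVneq N 0; first by rewrite mulr0.
  have {}NN : 0 < N by rewrite lt_def Nn.
  rewrite -(ler_pM2l NN); nra.
(* The projection onto the closed range is a minimising sequence: [x n] is the residual of [f],
   almost orthogonal to the range of [D], and [h] its limit. *)
pose L := [set ip (f - D w) (f - D w) | w in [set: X]].
have Linf : has_inf L.
  by split; [exists (ip (f - D 0) (f - D 0)), 0|exists 0 => _ [w _ <-]].
pose m := inf L.
have /choice[w wP] : forall n : nat, exists w,
    ip (f - D w) (f - D w) < m + n.+1%:R^-1.
  move=> n; have n0 : 0 < n.+1%:R^-1 :> R by rewrite invr_gt0 ltr0Sn.
  by have [_ [v _ <-] hv] := inf_adherent n0 Linf; exists v.
have [x xE] : {x : nat -> X | forall n, x n = f - D (w n)}.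
  by exists (fun n => f - D (w n)).
have xlow n t v : m <= ip (x n - t *: D v) (x n - t *: D v).
  have e z : ip (x n - t *: D v) z = ip (f - D (w n + t *: v)) z.
    by rewrite xE !iE Dlin !iE; ring.
  rewrite e iC e; apply: ge_inf; last by exists (w n + t *: v).
  exact: Linf.2.
have xD n v : ip (x n) (D v) ^+ 2 <= n.+1%:R^-1 * ip (D v) (D v).
  rewrite -sqrrN; apply: discriminant_le => // t.
  have := xlow n t v; have := wP n; rewrite -xE !iE (iC (D v) (x n)); set e := _^-1; lra.
have xcauchy n k :
    ip (x n - x k) (x n - x k) <= 2 * (n.+1%:R^-1 + k.+1%:R^-1).
  have e z : ip z (D (w k + (- 1) *: w n)) = ip z (x n - x k).
    by rewrite iC Dlin iC !xE !iE; ring.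
  have := xD n (w k + (- 1) *: w n); have := xD k (w k + (- 1) *: w n).
  have -> : ip (D (w k + (- 1) *: w n)) (D (w k + (- 1) *: w n)) =
    ip (x n - x k) (x n - x k) by rewrite e iC e.
  rewrite !e; set d := ip (x n - x k) (x n - x k).
  have : d = ip (x n) (x n - x k) - ip (x k) (x n - x k) by rewrite /d (ipDl sip) (ipNl sip).
  have : 0 <= d by exact: ip0.
  set p := ip (x n) _; set q := ip (x k) _; move=> d0 dE hq hp.
  have [->|dn] := eqVneq d 0.
    by rewrite mulr_ge0// addr_ge0// invr_ge0.
  have {}d0 : 0 < d by rewrite lt_def dn.
  rewrite -(ler_pM2r d0); have := sqr_ge0 (p + q).
  have -> : d * d = (p - q) ^+ 2 by rewrite dE; ring.
  move: hp hq; set en := n.+1%:R^-1; set ek := k.+1%:R^-1; lra.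
have small (e : R) : 0 < e -> exists N : nat, forall n : nat, (N <= n)%N ->
    n.+1%:R^-1 < e.
  move=> e0; exists (Num.Def.truncn e^-1) => n hn.
  rewrite invf_plt ?posrE ?ltr0Sn//.
  have := truncnS_gt e^-1; move=> /lt_le_trans; apply.
  by rewrite ler_nat.
have [h hx] : exists h, forall e, 0 < e -> exists N : nat, forall n : nat,
    (N <= n)%N -> ip (x n - h) (x n - h) < e.
  apply: cip => e e0.
  have [N hN] := small (e / 4) (divr_gt0 e0 (ltr0Sn _ _)).
  exists N => k n /hN hk /hN hn; apply: le_lt_trans (xcauchy _ _) _.
  by move: hk hn; set ek := k.+1%:R^-1; set en := n.+1%:R^-1; lra.
have h_lim z : (forall n, ip (x n) z ^+ 2 <= n.+1%:R^-1 * ip z z) -> ip h z = 0.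
  move=> xz; apply/eqP; rewrite -sqrf_eq0; apply/negP => /negP b0.
  have {}b0 : 0 < ip h z ^+ 2 by rewrite lt_def b0 sqr_ge0.
  have N0 := ip0 z; set N := ip z z in xz N0.
  have e0 : 0 < ip h z ^+ 2 / (4 * N + 1) by rewrite divr_gt0//; lra.
  have [n1 hn1] := small _ e0; have [n2 hn2] := hx _ e0.
  pose n := maxn n1 n2.
  have := hn1 n (leq_maxl _ _); have := hn2 n (leq_maxr _ _).
  have := xz n; have := ip_CS sip (x n - h) z; rewrite -/N.
  have -> : ip (x n - h) z = ip (x n) z - ip h z by rewrite !iE.
  rewrite !ltr_pdivlMr; try lra.
  set b := ip h z; set a := ip (x n) z; set d := ip (x n - h) _.
  set en := n.+1%:R^-1 => h1 h2 h3 h4.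
  have d0 : 0 <= d by exact: ip0.
  have := sqr_ge0 (2 * a - b).
  have en0 : 0 < en by rewrite invr_gt0 ltr0Sn.
  nra.
have hD v : ip h (D v) = 0 by exact: h_lim.
have Dh0 : ip (D h) (D h) = 0 by rewrite Dsym hD.
have Th : form_op (T h) (mu *: T h).
  by apply: (form_op_congr sip (DB h)); rewrite addrC addKr.
have DT0 z : ip (D (T h)) z = 0.
  apply: (ip_null sip); have [C C1 hC] := rho_bound sip ry.
  have : form_op (D (T h)) (y *: D (T h) + 0).
    have := form_opD sip GD GZ Th (form_opZ sip GD GZ th (TP (T h))).
    rewrite DE addr0; congr (form_op _ _).
    by rewrite !scalerDr addrCA addrC -scalerDl -/y !scalerA [y * th]mulrC.
  by move=> /hC; rewrite (ip0l sip) mulr0 => ?; apply/eqP; rewrite eq_le ip0 andbT.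
(* [f] is orthogonal to the eigenvector [T h] by hypothesis, and every [D w] is because [D (T h)] is
   null. Then [0 = ip (D h) h = |h|^2 + th ip (T h) h] makes [h] null. *)
have hT : ip h (T h) = 0.
  apply: h_lim => n; rewrite xE.
  have -> : ip (f - D (w n)) (T h) = 0.
    by rewrite !iE fE// Dsym iC DT0 subr0.
  by rewrite expr0n/= mulr_ge0// ?invr_ge0.
have h0 : ip h h = 0.
  have := ip_null sip h Dh0; rewrite DE !iE Tsym hT; lra.
have qf : 0 <= ip (D f) f - 2 / 3 * ip f f.
  rewrite leNgt; apply/negP; set q := _ - _ => q0.
  pose a := D f - 2 / 3 *: f.
  have A0 := ip0 a; set A := ip a a in A0.
  (* [s] is such that [|x n|^2 < min s (s^2)] keeps the error of replacing [f] by [f - x n], which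
     is in the range of [D] up to null vectors, below [s (A + 4) = - q]. *)
  pose s := - q / (A + 4).
  have s0 : 0 < s by rewrite divr_gt0 ?oppr_gt0//; lra.
  have sq : s * (A + 4) = - q by rewrite /s divfK//; apply/eqP; lra.
  have e0 : 0 < Num.min s (s ^+ 2) by rewrite lt_min s0 exprn_gt0.
  have [n /(_ _ (leqnn _))] := hx _ e0.
  have xh : ip (x n - h) (x n - h) = ip (x n) (x n).
    by have := ip_null sip (x n) h0; rewrite !iE (iC (x n) h) h0; lra.
  rewrite xh lt_min => /andP[xs xs2].
  have fx : f - x n = D (w n) by rewrite xE opprB addrC subrK.
  have := DD (w n); rewrite -fx.
  have -> : f - x n = f + (- 1) *: x n by rewrite scaleN1r.
  rewrite Dlin !iE (Dsym (x n) f) (iC (x n) f) (iC (x n) (D f)).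
  have [_ _ D4] := TDineq (x n).
  have D5 := ip_le sip (D (x n)) (x n).
  have D6 := ler_norm (ip (D (x n)) (x n)).
  have := ip_le sip (s *: a) (x n); have := ler_norm (- ip (s *: a) (x n)).
  rewrite normrN !(ipZl sip, ipZr sip) -/A.
  have -> : ip a (x n) = ip (D f) (x n) - 2 / 3 * ip f (x n) by rewrite /a !iE.
  set ax := ip (D f) (x n) - _ => h1 h2 h3.
  have : 0 <= q - 2 * ax + 2 * ip (x n) (x n) by have := ip0 (x n); rewrite /q /ax; lra.
  have : s * - (2 * ax) <= s * (s * (A + 1)) by lra.
  rewrite ler_pM2l//; lra.
have -> : ip u f = ip (T f) f.
  have := form_op_sym sip uf (TP f); rewrite -/y !iE (iC f (T f)); lra.
by move: qf; rewrite DE !iE; lra.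
Qed.

End IsolatedPoint.

(** * The bottom of the essential spectrum *)

Section EssentialSpectrum.
Variables (R : realType) (X : lmodType R) (ip : X -> X -> R).
Variable G : X -> X -> Prop.
Hypothesis sip : semi_inner ip.
Hypothesis cip : ip_complete ip.
Hypothesis GD : forall u p v q, G u p -> G v q -> G (u + v) (p + q).
Hypothesis GZ : forall a u p, G u p -> G (a *: u) (a *: p).
Let ip0 := ip_ge0 sip.
Local Notation form_op := (form_op ip G).
Local Notation rho := (rho ip G).
Local Notation form_ge := (form_ge ip G).

(* The point found is the supremum of the lower bounds of the form on
   orthogonals of finite families. *)
Lemma essential_le_rayleigh (c : R) :
  (forall V : seq X, exists f p, [/\ G f p, forall v, v \in V -> ip f v = 0,
     0 < ip f f & ip p p <= c * ip f f]) ->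
  exists l : R, [/\ l <= c, ~ rho l &
    forall (e : R) (b : seq X), 0 < e ->
      (forall z, 0 < `|z - l| < e -> rho z) ->
      ~ (forall u, form_op u (l *: u) ->
          forall x, (forall v, v \in b -> ip x v = 0) -> ip x u = 0)].
Proof.
move=> small.
pose L := [set l | exists V, form_ge V l].
have L0 : L 0 by exists [::] => u q _ _; rewrite mul0r.
have Lub : ubound L c.
  move=> l [V hV]; have [f [p [fp fV f0 pf]]] := small V.
  by rewrite -(ler_pM2r f0) (le_trans _ pf)// hV.
have Lsup : has_sup L by split; [exists 0|exists c].
pose mu := sup L.
(* The lower bound [2 / 3] exceeds the [1 / 2] that near minimisers orthogonal to [V], [W] and [b]
   allow. At [th = 0] the refuted inequality is trivially true, so the same statement shows that
   [mu] is not regular. *)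
have gap th (b : seq X) : rho (mu + th) ->
    ~ (forall f u, (forall v, v \in b -> ip f v = 0) ->
        form_op u ((mu + th) *: u + f) -> 2 / 3 * ip f f <= ip f f + th * ip u f).
  move=> rh hgap.
  have [e e0 he] := near_minimizer sip GD GZ (divr_gt0 ltr01 (ltr0Sn R 1)) rh.
  have [l [V hV] sl] := sup_adherent e0 Lsup.
  have [|W [_ {}he]] := he V.
    move=> u q uq uV; apply: le_trans (hV _ _ uq uV).
    by rewrite ler_wpM2r// ltW.
  have : ~ L (mu + e).
    by move=> /(ub_le_sup Lsup.2); rewrite gerDl leNgt e0.
  apply; exists (V ++ W ++ b) => f p fp fo; rewrite leNgt; apply/negP => pf.
  have [u uf] := rh.1 f.
  have fV v : v \in V -> ip f v = 0 by move=> h; rewrite fo// mem_cat h.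
  have fW v : v \in W -> ip f v = 0 by move=> h; rewrite fo// !mem_cat h orbT.
  have fb v : v \in b -> ip f v = 0 by move=> h; rewrite fo// !mem_cat h !orbT.
  have := he f p u fp fV fW (ltW pf) uf; have := hgap f u fb uf.
  rewrite ler_norml => h1 /andP[_ h2].
  have f0 : ip f f = 0 by have := ip0 f; lra.
  by move: pf; rewrite f0 mulr0 ltNge ip0.
exists mu; split.
- by apply: ge_sup => //; exists 0.
- rewrite -[mu]addr0 => /(gap _ [::]); apply => f u _ _.
  rewrite mul0r addr0; have := ip0 f; lra.
- move=> e b e0 hr hb.
  have th0 : 0 < e / 3 by lra.
  apply: (gap (e / 3) b).
    by apply: hr; rewrite addrC addKr gtr0_norm// th0/=; lra.
  move=> f u fb; apply: (isolated_resolvent_gap sip cip GD GZ th0) => [z hz|v hv].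
    by apply: hr; rewrite (_ : e = 3 * (e / 3))//; field.
  exact: hb hv _ fb.
Qed.

End EssentialSpectrum.

(** * Square-integrable functions *)

Section SquareIntegrable.
Context d (T : measurableType d) (R : realType).
Variables (mu : {measure set T -> \bar R}) (D : set T).
Hypothesis mD : measurable D.
Implicit Types f g h : T -> R.

Definition sqint f := measurable_fun D f /\
  (\int[mu]_(x in D) ((f x) ^+ 2)%:E < +oo)%E.

Definition sqip f g := \int[mu]_(x in D) (f x * g x).

Lemma sqint_sqr f : sqint f -> mu.-integrable D (fun x => ((f x) ^+ 2)%:E).
Proof.
move=> [mf f2]; apply/integrableP; split.
  by apply/measurable_EFinP; exact: measurable_funX.
move: f2; congr (_ < _)%E; apply: eq_integral => x _.
by rewrite gee0_abs// lee_fin sqr_ge0.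
Qed.

Lemma sqint_mul f g : sqint f -> sqint g ->
  mu.-integrable D (EFin \o (fun x => f x * g x)).
Proof.
move=> hf hg; apply: (@le_integrable _ _ _ mu D mD _
    (fun x => ((f x) ^+ 2)%:E + ((g x) ^+ 2)%:E)%E).
- by apply/measurable_EFinP; apply: measurable_funM; [exact: hf.1|exact: hg.1].
- move=> x _; rewrite /= lee_fin [leRHS]ger0_norm ?addr_ge0 ?sqr_ge0//.
  have := sqr_ge0 (f x + g x); have := sqr_ge0 (f x - g x).
  have [_|_] := ger0P (f x * g x); nra.
- by apply: integrableD => //; exact: sqint_sqr.
Qed.

Lemma sqint_lin a f g : sqint f -> sqint g -> sqint (fun x => a * f x + g x).
Proof.
move=> hf hg; split.
  apply: measurable_funD; last exact: hg.1.
  by apply: measurable_funM => //; exact: hf.1.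
have i : mu.-integrable D (fun x => ((2 * a ^+ 2)%:E * ((f x) ^+ 2)%:E +
    2%:E * ((g x) ^+ 2)%:E)%E).
  by apply: integrableD => //; apply: integrableZl => //; exact: sqint_sqr.
have /integrableP[m ] := i; apply: le_lt_trans.
apply: ge0_le_integral => //.
- by move=> x _; rewrite lee_fin sqr_ge0.
- apply/measurable_EFinP; apply: measurable_funX.
  apply: measurable_funD; last exact: hg.1.
  by apply: measurable_funM => //; exact: hf.1.
- by apply: measurableT_comp => //; exact: measurable_int i.
- move=> x _; rewrite /= lee_fin.
  have := ler_norm (2 * a ^+ 2 * f x ^+ 2 + 2 * g x ^+ 2).
  by apply: le_trans; have := sqr_ge0 (a * f x - g x); nra.
Qed.

Lemma sqip_lin a f g h : sqint f -> sqint g -> sqint h ->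
  sqip (fun x => a * f x + g x) h = a * sqip f h + sqip g h.
Proof.
move=> hf hg hh; rewrite /sqip -RintegralZl//; last exact: sqint_mul.
rewrite -RintegralD//; last exact: sqint_mul.
  by apply: eq_Rintegral => x _; ring.
have := integrableZl mD a (sqint_mul hf hh).
by apply: eq_integrable.
Qed.

Lemma sqipE f : sqint f -> (sqip f f)%:E = (\int[mu]_(x in D) ((f x) ^+ 2)%:E)%E.
Proof.
move=> hf; rewrite /sqip /Rintegral fineK.
  by apply: eq_integral => x _; rewrite expr2.
exact: integrable_fin_num (sqint_mul hf hf).
Qed.

Lemma sqip_ge0 f : 0 <= sqip f f.
Proof. by apply: Rintegral_ge0 => x _; rewrite -expr2 sqr_ge0. Qed.

Lemma sqintB f g : sqint f -> sqint g -> sqint (fun x => f x - g x).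
Proof.
move=> hf hg; have := sqint_lin (- 1) hg hf.
by congr sqint; apply/funext => x; ring.
Qed.

Lemma limn_einf_le (u : nat -> \bar R) (c : \bar R) N :
  (forall n, (N <= n)%N -> (u n <= c)%E) -> (limn_einf u <= c)%E.
Proof.
move=> h; rewrite limn_einf_lim; apply: lime_le; first exact: is_cvg_einfs.
apply: nearW => n; apply: (@le_trans _ _ (u (maxn n N))).
  by apply: ereal_inf_lbound; exists (maxn n N) => //=; exact: leq_maxl.
exact/h/leq_maxr.
Qed.

Lemma sum_half_le n : \sum_(k < n) 2^-1 ^+ k <= 2 :> R.
Proof.
have h2 : `|2^-1| < 1 :> R by rewrite ger0_norm ?invr_ge0//; lra.
have h1 : 0 < 2^-1 :> R by rewrite invr_gt0.
have := @geometric_le_lim R n 1 2^-1 ler01 h1 h2.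
rewrite /series/= big_mkord (_ : (1 - 2^-1 : R) = 2^-1) ?invrK; last by lra.
by rewrite mul1r; apply: le_trans; apply: ler_sum => i _; rewrite mul1r.
Qed.

(* [2 ^ n d n ^ 2] summable forces [d n] summable: |d| <= 2 ^ - n + 2 ^ n d ^ 2. *)
Lemma cvg_series_weighted (u : nat -> R) (M : R) :
  (forall n, \sum_(k < n) 2 ^+ k * (u k.+1 - u k) ^+ 2 <= M) -> cvgn u.
Proof.
move=> hM.
have -> : u = (fun n => u 0%N + series (telescope u) n).
  by apply/funext => n; exact: eq_sum_telescope.
apply: is_cvgD; first exact: is_cvg_cst.
apply: normed_cvg; apply: nondecreasing_is_cvgn.
  by apply: nondecreasing_series => n _ _; exact: normr_ge0.
exists (M + 2) => _ [n _ <-].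
change (\sum_(0 <= k < n) `|telescope u k| <= M + 2); rewrite big_mkord.
have h (k : nat) : `|telescope u k| <= 2^-1 ^+ k + 2 ^+ k * (u k.+1 - u k) ^+ 2.
  rewrite /telescope; set v := u k.+1 - u k.
  rewrite exprVn; have e0 : 0 < 2 ^+ k :> R by rewrite exprn_gt0.
  set e := 2 ^+ k in e0 *; rewrite -(ler_pM2l e0) mulrDr mulfV ?gt_eqF//.
  rewrite -[v ^+ 2]real_normK ?num_real//.
  have := sqr_ge0 (e * `|v| - 1); nra.
apply: (@le_trans _ _ (\sum_(k < n) (2^-1 ^+ k + 2 ^+ k * (u k.+1 - u k) ^+ 2))).
  exact: ler_sum.
by rewrite big_split/= addrC lerD ?hM ?sum_half_le.
Qed.

(** Along a subsequence whose increments have squared norm below [4^-k], the sum of the squared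
    increments weighted by [2^k] is integrable. This gives convergence almost everywhere without the
    triangle inequality of [L^2]; Fatou's lemma then gives convergence in the mean. *)
Lemma riesz_fischer (f : nat -> T -> R) : (forall n, sqint (f n)) ->
  (forall e, 0 < e -> exists N : nat, forall m n, (N <= m)%N -> (N <= n)%N ->
     sqip (fun x => f m x - f n x) (fun x => f m x - f n x) < e) ->
  exists2 g, sqint g & forall e, 0 < e -> exists N : nat, forall n, (N <= n)%N ->
     sqip (fun x => f n x - g x) (fun x => f n x - g x) < e.
Proof.
move=> hf hc.
have /choice[N hN] : forall k : nat, exists N : nat, forall m n,
    (N <= m)%N -> (N <= n)%N ->
    sqip (fun x => f m x - f n x) (fun x => f m x - f n x) < 4^-1 ^+ k.
  by move=> k; apply: hc; rewrite exprn_gt0.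
(* Partial sums are monotone, so both [s k] and [s k.+1] lie beyond [N k]. *)
pose s k := (\sum_(i < k.+1) (N i).+1)%N.
have sN k : (N k <= s k)%N.
  by rewrite /s big_ord_recr/= (leq_trans (leqnSn _))// leq_addl.
have sk k : (k <= s k)%N.
  apply: (@leq_trans (\sum_(i < k) 1)%N); first by rewrite sum1_card card_ord.
  rewrite /s big_ord_recr/= (@leq_trans (\sum_(i < k) (N i).+1)%N) ?leq_addr//.
  exact: leq_sum.
have sS k : (N k <= s k.+1)%N.
  by rewrite /s big_ord_recr/= (leq_trans (sN k))// leq_addr.
(* An upper limit is measurable without knowing where the subsequence converges; it is infinite only
   on a null set, where [fine] replaces it by 0. *)
pose g x := fine (limn_esup (fun k => (f (s k) x)%:E)).
have mg : measurable_fun D g.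
  apply: measurableT_comp => //; apply: measurable_fun_limn_esup => k.
  by apply/measurable_EFinP; exact: (hf _).1.
have fg : {ae mu, forall x, D x -> f (s k) x @[k --> \oo] --> g x}.
  pose H x := (\sum_(k <oo) (2 ^+ k * (f (s k.+1) x - f (s k) x) ^+ 2)%:E)%E.
  have H0 k x : (0 <= (2 ^+ k * (f (s k.+1) x - f (s k) x) ^+ 2)%:E)%E.
    by rewrite lee_fin mulr_ge0 ?sqr_ge0// exprn_ge0.
  have mH k : measurable_fun D
      (fun x => (2 ^+ k * (f (s k.+1) x - f (s k) x) ^+ 2)%:E).
    apply/measurable_EFinP; apply: measurable_funM => //.
    apply: measurable_funX; apply: measurable_funB; exact: (hf _).1.
  have iH : mu.-integrable D H.
    apply/integrableP; split; first by apply: ge0_emeasurable_sum => // k x _ _.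
    under eq_integral do rewrite gee0_abs ?nneseries_ge0//.
    rewrite integral_nneseries//; apply: (@le_lt_trans _ _ 2%:E); last exact: ltry.
    apply: lime_le.
      by apply: is_cvg_nneseries => k _ _; exact: integral_ge0.
    apply: nearW => n; apply: (@le_trans _ _ (\sum_(0 <= k < n) (2^-1 ^+ k)%:E)%E).
      apply: lee_sum => k _; under eq_integral do rewrite EFinM.
      rewrite ge0_integralZl//; last 2 first.
      - by apply/measurable_EFinP; apply: measurable_funX; apply: measurable_funB;
          exact: (hf _).1.
      - by move=> x _; rewrite lee_fin sqr_ge0.
      rewrite -sqipE; last exact: sqintB.
      rewrite -EFinM lee_fin; have := ltW (hN k _ _ (sS k) (sN k)).
      move=> /(ler_wpM2l (exprn_ge0 k (ler0n R 2))) /le_trans; apply.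
      by rewrite -exprMn (_ : (2 * 4^-1 : R) = 2^-1)//; lra.
    rewrite sumEFin lee_fin big_mkord; exact: sum_half_le.
  apply: filterS (integrable_ae mD iH) => x h /h {}h.
  have : cvgn (fun k => f (s k) x).
    apply: (@cvg_series_weighted _ (fine (H x))) => n.
    rewrite -lee_fin fineK// -sumEFin.
    by have := @nneseries_lim_ge _ (fun k =>
      (2 ^+ k * (f (s k.+1) x - f (s k) x) ^+ 2)%:E) predT 0%N n (fun k _ _ => H0 k x);
      rewrite big_mkord.
  move=> cx; suff -> : g x = limn (fun k => f (s k) x) by [].
  rewrite /g; have : (EFin \o (fun k => f (s k) x)) @ \oo --> (limn (fun k => f (s k) x))%:E.
    by apply: cvg_EFin => //; exact: nearW.
  by move=> /cvg_limn_einf_sup [_ ->].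
(* Fatou along the subsequence with [n] fixed; the same bound yields both [g] in [L^2] and the
   convergence to [g]. *)
have key n c M : (forall k, (M <= k)%N ->
    sqip (fun x => f n x - f (s k) x) (fun x => f n x - f (s k) x) <= c) ->
    (\int[mu]_(x in D) ((f n x - g x) ^+ 2)%:E <= c%:E)%E.
  move=> hM; have md k : measurable_fun D (fun x => ((f n x - f (s k) x) ^+ 2)%:E).
    apply/measurable_EFinP; apply: measurable_funX; apply: measurable_funB;
    exact: (hf _).1.
  have d0 k x : D x -> (0 <= ((f n x - f (s k) x) ^+ 2)%:E)%E.
    by rewrite lee_fin sqr_ge0.
  apply: (@le_trans _ _ (\int[mu]_(x in D)
      limn_einf (fun k => ((f n x - f (s k) x) ^+ 2)%:E))%E).
    apply: ae_ge0_le_integral => //.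
    - by move=> x _; rewrite lee_fin sqr_ge0.
    - apply/measurable_EFinP; apply: measurable_funX; apply: measurable_funB => //.
      exact: (hf _).1.
    - move=> x Dx; rewrite limn_einf_lim; apply: lime_ge; first exact: is_cvg_einfs.
      apply: nearW => k; apply: le_ereal_inf_tmp => _ [j _ <-]; exact: d0.
    - apply: measurableT_comp => //; apply: measurable_fun_limn_esup => k.
      exact: measurableT_comp.
    apply: filterS fg => x h /h {}h.
    have : (fun k => ((f n x - f (s k) x) ^+ 2)%:E) @ \oo --> ((f n x - g x) ^+ 2)%:E.
      apply: cvg_EFin; first exact: nearW.
      rewrite /comp/= !expr2; under eq_fun do rewrite expr2.
      by apply: cvgM; apply: cvgB => //; exact: cvg_cst.
    by move=> /cvg_limn_einf_sup [-> _].
  apply: le_trans (fatou mu mD md d0) _; apply: (@limn_einf_le _ _ M) => k /hM.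
  by rewrite -lee_fin sqipE//; exact: sqintB.
have gint : sqint g.
  have [M hM] := hc 1 ltr01.
  have h : sqint (fun x => f M x - g x).
    split; first by apply: measurable_funB => //; exact: (hf _).1.
    apply: (@le_lt_trans _ _ 1%:E); last exact: ltry.
    by apply: (key _ _ M) => k Mk; apply/ltW/hM => //; rewrite (leq_trans Mk).
  have := sqintB (hf M) h; congr sqint; apply/funext => x; ring.
exists g => // e e0; have [M hM] := hc (e / 2) (divr_gt0 e0 (ltr0Sn _ _)).
exists M => n Mn; apply: (@le_lt_trans _ _ (e / 2)); last by lra.
rewrite -lee_fin sqipE; last exact: sqintB.
by apply: (key _ _ M) => k Mk; apply/ltW/hM => //; rewrite (leq_trans Mk).
Qed.

End SquareIntegrable.

(** * The space L2(G) *)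

Local Open Scope complex_scope.

Section ComplexParts.
Variable R : realType.
Implicit Types (a : R) (x y : R[i]).

Lemma ReD x y : complex.Re (x + y) = complex.Re x + complex.Re y.
Proof. by case: x y => [? ?] [? ?]. Qed.
Lemma ImD x y : complex.Im (x + y) = complex.Im x + complex.Im y.
Proof. by case: x y => [? ?] [? ?]. Qed.
Lemma ReN x : complex.Re (- x) = - complex.Re x. Proof. by case: x. Qed.
Lemma ImN x : complex.Im (- x) = - complex.Im x. Proof. by case: x. Qed.
Lemma ReM x y : complex.Re (x * y) =
  complex.Re x * complex.Re y - complex.Im x * complex.Im y.
Proof. by case: x y => [? ?] [? ?]. Qed.
Lemma ImM x y : complex.Im (x * y) =
  complex.Re x * complex.Im y + complex.Im x * complex.Re y.
Proof. by case: x y => [? ?] [? ?]. Qed.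
Lemma ReJ x : complex.Re x^* = complex.Re x. Proof. by case: x. Qed.
Lemma ImJ x : complex.Im x^* = - complex.Im x. Proof. by case: x. Qed.

Definition partsE := (ReD, ImD, ReN, ImN, ReM, ImM, ReJ, ImJ).

Lemma eq_parts x y :
  complex.Re x = complex.Re y -> complex.Im x = complex.Im y -> x = y.
Proof. by case: x y => [? ?] [? ?] /= -> ->. Qed.

Lemma scale_Rcomplex a x : a *: (x : Rcomplex R) = a%:C * x.
Proof. by apply: eq_parts; rewrite partsE/=; case: x => ? ? /=; ring. Qed.

End ComplexParts.

Lemma measurable_cc (R : realType) (a b : R) :
  measurable (`[a, b]%classic : set (measurableTypeR R)).
Proof. exact: measurable_itv. Qed.

Section EdgeInner.
Variables (R : realType) (l : R).
Local Notation mu := (@lebesgue_measure R).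
Local Notation re h := (fun x => complex.Re (h x)).
Local Notation im h := (fun x => complex.Im (h x)).
Implicit Types h k m : R -> R[i].

Definition sqc h := sqint mu `[0, l] (re h) /\ sqint mu `[0, l] (im h).

(** The real part of the inner product of [L^2(0, l)]; the imaginary part is recovered by testing
    with ['i * k]. *)
Definition cip h k : R :=
  sqip mu `[0, l] (re h) (re k) + sqip mu `[0, l] (im h) (im k).

Let mD := measurable_cc 0 l.

Lemma normsq_onE h : meas_on l h -> normsq_on l h =
  (\int[mu]_(x in `[0%R, l]) ((complex.Re (h x)) ^+ 2)%:E +
   \int[mu]_(x in `[0%R, l]) ((complex.Im (h x)) ^+ 2)%:E)%E.
Proof.
move=> [mr mi]; rewrite /normsq_on -ge0_integralD//.
- by move=> x _; rewrite lee_fin sqr_ge0.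
- by apply/measurable_EFinP; exact: measurable_funX.
- by move=> x _; rewrite lee_fin sqr_ge0.
- by apply/measurable_EFinP; exact: measurable_funX.
Qed.

Lemma sqcP h : sqc h <-> meas_on l h /\ (normsq_on l h < +oo)%E.
Proof.
split=> [[[mr r2] [mi i2]]|[mh]].
  by split; [split|rewrite normsq_onE; [exact: lte_add_pinfty|split]].
have p0 (k : R -> R) :
    (0 <= \int[mu]_(x in `[0%R, l]) ((k x) ^+ 2)%:E)%E.
  by apply: integral_ge0 => x _; rewrite lee_fin sqr_ge0.
rewrite normsq_onE// => h2; split; (split; [by case: mh|]);
  by apply: le_lt_trans h2; rewrite ?leeDl ?leeDr.
Qed.

Lemma normsq_on_cip h : sqc h -> normsq_on l h = (cip h h)%:E.
Proof.
move=> hh; have [mh _] := (sqcP h).1 hh.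
by case: hh => hr hi; rewrite normsq_onE// EFinD !sqipE.
Qed.

Lemma sqc_lin (a : R[i]) h k : sqc h -> sqc k -> sqc (fun x => a * h x + k x).
Proof.
move=> [hr hi] [kr ki]; split.
  have := sqint_lin mD (complex.Re a) hr (sqint_lin mD (- complex.Im a) hi kr).
  by congr sqint; apply/funext => x; rewrite !partsE; ring.
have := sqint_lin mD (complex.Re a) hi (sqint_lin mD (complex.Im a) hr ki).
by congr sqint; apply/funext => x; rewrite !partsE; ring.
Qed.

Lemma cip_lin (a : R) h k m : sqc h -> sqc k -> sqc m ->
  cip (fun x => a%:C * h x + k x) m = a * cip h m + cip k m.
Proof.
move=> [hr hi] [kr ki] [mr mi].
have -> : a * cip h m + cip k m =
    (a * sqip mu `[0, l] (re h) (re m) + sqip mu `[0, l] (re k) (re m)) +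
    (a * sqip mu `[0, l] (im h) (im m) + sqip mu `[0, l] (im k) (im m)).
  by rewrite /cip; ring.
by rewrite -!sqip_lin// /cip; congr (_ + _); congr sqip;
  apply/funext => x; rewrite !partsE/=; ring.
Qed.

Lemma cipC h k : cip h k = cip k h.
Proof.
by rewrite /cip /sqip; congr (_ + _); apply: eq_Rintegral => x _; rewrite mulrC.
Qed.

Lemma cip_ge0 h : 0 <= cip h h.
Proof. by rewrite addr_ge0// sqip_ge0. Qed.

Lemma cip_le (s : R) h k : sqc h -> sqc k ->
  2 * (s * cip h k) <= s ^+ 2 * cip h h + cip k k.
Proof.
move=> hh hk; pose m x := (- s)%:C * h x + k x.
have hm : sqc m by exact: sqc_lin.
have := cip_ge0 m; rewrite {1}/m cip_lin// [cip h m]cipC [cip k m]cipC.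
rewrite /m !cip_lin// (cipC k h).
have -> : - s * (- s * cip h h + cip h k) + (- s * cip h k + cip k k) =
   s ^+ 2 * cip h h + cip k k - 2 * (s * cip h k) by ring.
by rewrite subr_ge0.
Qed.

Lemma cip_norm h k : sqc h -> sqc k -> 2 * `|cip h k| <= cip h h + cip k k.
Proof.
move=> hh hk; have := cip_le 1 hh hk.
have := cip_le (- 1) hh hk.
by have [_|_] := ger0P (cip h k); lra.
Qed.

Lemma cip_complete (h : nat -> R -> R[i]) : (forall n, sqc (h n)) ->
  (forall e, 0 < e -> exists N : nat, forall i j : nat, (N <= i)%N -> (N <= j)%N ->
     cip (fun x => h i x - h j x) (fun x => h i x - h j x) < e) ->
  exists2 g, sqc g & forall e, 0 < e -> exists N : nat, forall n, (N <= n)%N ->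
     cip (fun x => h n x - g x) (fun x => h n x - g x) < e.
Proof.
move=> hh hc.
have [n|e e0|gr hgr cr] := @riesz_fischer _ _ _ mu _ mD (fun n => re (h n)).
- by case: (hh n).
- have [N hN] := hc e e0; exists N => m n Nm Nn.
  apply: le_lt_trans (hN m n Nm Nn).
  rewrite (_ : (fun x => _) = re (fun x => h m x - h n x)) ?lerDl ?sqip_ge0//.
  by apply/funext => x; rewrite !partsE.
have [n|e e0|gi hgi ci] := @riesz_fischer _ _ _ mu _ mD (fun n => im (h n)).
- by case: (hh n).
- have [N hN] := hc e e0; exists N => m n Nm Nn.
  apply: le_lt_trans (hN m n Nm Nn).
  rewrite (_ : (fun x => _) = im (fun x => h m x - h n x)) ?lerDr ?sqip_ge0//.
  by apply/funext => x; rewrite !partsE.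
exists (fun x => gr x +i* gi x); first by split.
move=> e e0; have [N1 h1] := cr (e / 2) (divr_gt0 e0 (ltr0Sn _ _)).
have [N2 h2] := ci (e / 2) (divr_gt0 e0 (ltr0Sn _ _)).
exists (maxn N1 N2) => n; rewrite geq_max => /andP[/h1 {}h1 /h2 {}h2].
have -> : e = e / 2 + e / 2 by lra.
apply: ltrD.
  by move: h1; congr (_ < _); congr sqip; apply/funext => x; rewrite !partsE.
by move: h2; congr (_ < _); congr sqip; apply/funext => x; rewrite !partsE.
Qed.

End EdgeInner.

(** One inequality suffices, since with [c^-1] it gives the reverse one. *)
Lemma esumZl (R : realType) (I : choiceType) (c : R) (a : I -> R) :
  0 <= c -> (forall i, 0 <= a i) ->
  (\esum_(i in [set: I]) (c * a i)%:E = c%:E * \esum_(i in [set: I]) (a i)%:E)%E.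
Proof.
have le (d : R) (b : I -> R) : 0 < d -> (forall i, 0 <= b i) ->
    (\esum_(i in [set: I]) (d * b i)%:E <= d%:E * \esum_(i in [set: I]) (b i)%:E)%E.
  move=> d0 b0; apply: ge_ereal_sup => _ [A [finA _] <-].
  under eq_fsbigr do rewrite EFinM.
  rewrite -ge0_mule_fsumr; last by move=> i; rewrite lee_fin.
  rewrite lee_pmul2l//; apply: ereal_sup_ubound; by exists A.
rewrite le_eqVlt => /predU1P[<- _|c0 a0].
  by rewrite mul0e esum1// => i _; rewrite mul0r.
apply/eqP; rewrite eq_le le//= -lee_pdivlMl//.
apply: le_trans (le c^-1 (fun i => c * a i) _ _).
- by apply: le_esum => i _; rewrite mulKf ?gt_eqF.
- by rewrite invr_gt0.
- by move=> i; rewrite mulr_ge0// ltW.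
Qed.

Section RealSum.
Variables (R : realType) (G : metric_graph R).
Implicit Types a b p q : edge G -> R.

Local Notation es a := (\esum_(e in [set: edge G]) (a e)%:E).

Definition abs_summable a := (es (fun e => `|a e|) < +oo)%E.

(** Frees [rsum] from the canonical parts [P], [Q] of the family: any summable nonnegative [p], [q]
    with the same difference satisfy [P + q = Q + p]. Linearity of [rsum] follows from this. *)
Lemma rsum_sub p q : (forall e, 0 <= p e) -> (forall e, 0 <= q e) ->
  (es p < +oo)%E -> (es q < +oo)%E ->
  rsum (fun e => p e - q e) = fine (es p) - fine (es q).
Proof.
move=> p0 q0 hp hq; rewrite /rsum.
pose P e := Num.max (p e - q e) 0; pose Q e := Num.max (- (p e - q e)) 0.
have P0 e : 0 <= P e by rewrite le_max lexx orbT.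
have Q0 e : 0 <= Q e by rewrite le_max lexx orbT.
have Pp e : P e <= p e by rewrite ge_max p0 andbT gerBl.
have Qq e : Q e <= q e by rewrite ge_max q0 andbT opprB gerBl.
have fin (r : edge G -> R) : (forall e, 0 <= r e) -> (es r < +oo)%E -> es r \is a fin_num.
  by move=> r0 hr; rewrite ge0_fin_numE//; apply: esum_ge0 => e _; rewrite lee_fin.
have hP : (es P < +oo)%E.
  by apply: le_lt_trans hp; apply: le_esum => e _; rewrite lee_fin.
have hQ : (es Q < +oo)%E.
  by apply: le_lt_trans hq; apply: le_esum => e _; rewrite lee_fin.
have : (es P + es q = es Q + es p)%E.
  rewrite -!esumD; do ?by move=> e _; rewrite lee_fin.
  apply: eq_esum => e _; rewrite -!EFinD; congr EFin; rewrite /P /Q.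
  by have [h|h] := leP (p e - q e) 0; have [h'|h'] := leP (- (p e - q e)) 0; lra.
move=> /(congr1 fine); rewrite !fineD ?fin// -/(es P) -/(es Q).
by rewrite [es (fun e => Num.max (p e - q e) 0)]/(es P) => h; lra.
Qed.

Lemma abs_summable_parts a : abs_summable a ->
  (es (fun e => Num.max (a e) 0) < +oo)%E /\
  (es (fun e => Num.max (- a e) 0) < +oo)%E.
Proof.
move=> ha; split; apply: le_lt_trans ha; apply: le_esum => e _;
  by rewrite lee_fin ge_max normr_ge0 andbT ?ler_norm// -normrN ler_norm.
Qed.

Lemma rsum_lin (c : R) a b : abs_summable a -> abs_summable b ->
  rsum (fun e => c * a e + b e) = c * rsum a + rsum b.
Proof.
move=> /abs_summable_parts[ap an] /abs_summable_parts[bp bn].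
pose ap' e := Num.max (a e) 0; pose an' e := Num.max (- a e) 0.
pose bp' e := Num.max (b e) 0; pose bn' e := Num.max (- b e) 0.
have ap0 e : 0 <= ap' e by rewrite le_max lexx orbT.
have an0 e : 0 <= an' e by rewrite le_max lexx orbT.
have bp0 e : 0 <= bp' e by rewrite le_max lexx orbT.
have bn0 e : 0 <= bn' e by rewrite le_max lexx orbT.
pose cp := Num.max c 0; pose cn := Num.max (- c) 0.
have cp0 : 0 <= cp by rewrite le_max lexx orbT.
have cn0 : 0 <= cn by rewrite le_max lexx orbT.
have maxB (x : R) : x = Num.max x 0 - Num.max (- x) 0.
  by have [h|h] := leP x 0; have [h'|h'] := leP (- x) 0; lra.
have sum3 (x y : R) (r s t : edge G -> R) : 0 <= x -> 0 <= y -> (forall e, 0 <= r e) ->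
    (forall e, 0 <= s e) -> (forall e, 0 <= t e) ->
    es (fun e => x * r e + y * s e + t e) =
    (x%:E * es r + y%:E * es s + es t)%E.
  move=> x0 y0 r0 s0 t0; rewrite -!esumZl// -!esumD//;
    by move=> e _; rewrite lee_fin ?addr_ge0 ?mulr_ge0.
have fin (r : edge G -> R) : (forall e, 0 <= r e) -> (es r < +oo)%E -> es r = (fine (es r))%:E.
  by move=> r0 hr; rewrite fineK// ge0_fin_numE//; apply: esum_ge0 => e _; rewrite lee_fin.
have -> : (fun e => c * a e + b e) =
    (fun e => (cp * ap' e + cn * an' e + bp' e) - (cp * an' e + cn * ap' e + bn' e)).
  apply/funext => e; rewrite [in LHS](maxB c) [in LHS](maxB (a e)).
  by rewrite [in LHS](maxB (b e)) -/cp -/cn -/(ap' e) -/(an' e) -/(bp' e) -/(bn' e); ring.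
have fap := fin _ ap0 ap; have fan := fin _ an0 an.
have fbp := fin _ bp0 bp; have fbn := fin _ bn0 bn.
rewrite rsum_sub.
- rewrite !sum3// fap fan fbp fbn -!EFinM -!EFinD /=.
  rewrite /rsum -/(es ap') -/(es an') -/(es bp') -/(es bn') [in RHS](maxB c).
  rewrite -/cp -/cn; ring.
- by move=> e; rewrite !addr_ge0 ?mulr_ge0.
- by move=> e; rewrite !addr_ge0 ?mulr_ge0.
- by rewrite sum3// fap fan fbp -!EFinM -!EFinD ltry.
- by rewrite sum3// fap fan fbn -!EFinM -!EFinD ltry.
Qed.

Lemma rsum_ge0E a : (forall e, 0 <= a e) -> rsum a = fine (es a).
Proof.
move=> a0; rewrite /rsum [X in _ - fine X]esum1 ?subr0.
  by congr fine; apply: eq_esum => e _; rewrite max_l.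
by move=> e _; rewrite max_r// oppr_le0.
Qed.

End RealSum.

(** * L2(G) as a real vector space *)

Section L2Theory.
Variables (R : realType) (G : metric_graph R).
Local Notation es a := (\esum_(e in [set: edge G]) (a e)%:E).
Implicit Types f g : gfun G.

Definition eip f g (e : edge G) : R := cip (len e) (f e) (g e).

Definition L2loc f := forall e, sqc (len e) (f e).

Lemma normsq_eip f : L2loc f -> normsq f = es (eip f f).
Proof. by move=> hf; apply: eq_esum => e _; rewrite normsq_on_cip. Qed.

Lemma L2P f : L2 f <-> L2loc f /\ (normsq f < +oo)%E.
Proof.
split=> [[mf nf]|[lf nf]]; split=> // e; last by case/sqcP: (lf e).
apply/sqcP; split=> //; apply: le_lt_trans nf.
have n0 e' : (0 <= normsq_on (len e') (f e'))%E.
  by apply: integral_ge0 => x _; rewrite lee_fin addr_ge0// sqr_ge0.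
rewrite /normsq (esumID [set e])// setTI esum_set1// leeDl// esum_ge0// => i _; exact: n0.
Qed.

Lemma L2_fin f : L2 f -> normsq f \is a fin_num.
Proof.
move=> [_ nf]; rewrite ge0_fin_numE//; apply: esum_ge0 => e _.
by apply: integral_ge0 => x _; rewrite lee_fin addr_ge0// sqr_ge0.
Qed.

Lemma L2_i f : L2 f -> L2 (fun e x => 'i * f e x).
Proof.
move=> /L2P[lf nf].
have lh : L2loc (fun e x => 'i * f e x).
  move=> e; case: (lf e) => fr fi; split.
    have := sqintB (measurable_cc _ _) (sqintB (measurable_cc _ _) fi fi) fi.
    by congr sqint; apply/funext => x; rewrite !partsE/=; ring.
  by move: fr; congr sqint; apply/funext => x; rewrite !partsE/=; ring.
apply/L2P; split=> //; move: nf; rewrite !normsq_eip//.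
congr (_ < _)%E; apply: eq_esum => e _; congr EFin.
rewrite /eip /cip addrC; congr (_ + _).
  by apply: eq_Rintegral => x _; rewrite !partsE/=; ring.
by apply: eq_Rintegral => x _; rewrite !partsE/=; ring.
Qed.

Lemma L2_linr (a : R) f g : L2 f -> L2 g -> L2 (fun e x => a%:C * f e x + g e x).
Proof.
move=> /L2P[lf nf] /L2P[lg ng].
have lh : L2loc (fun e x => a%:C * f e x + g e x) by move=> e; exact: sqc_lin.
apply/L2P; split=> //; rewrite normsq_eip//.
rewrite !normsq_eip// in nf ng.
have e0 k e : 0 <= eip k k e by exact: cip_ge0.
have a0 : 0 <= 2 * a ^+ 2 by rewrite mulr_ge0// sqr_ge0.
apply: (@le_lt_trans _ _ (es (fun e => 2 * a ^+ 2 * eip f f e + 2 * eip g g e))).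
  apply: le_esum => e _; rewrite lee_fin /eip.
  rewrite (cip_lin _ (lf e) (lg e) (lh e)) [cip _ (f e) _]cipC [cip _ (g e) _]cipC.
  rewrite (cip_lin _ (lf e) (lg e) (lf e)) (cip_lin _ (lf e) (lg e) (lg e)).
  rewrite [cip _ (g e) (f e)]cipC.
  have := cip_le a (lf e) (lg e); lra.
under eq_esum do rewrite EFinD.
rewrite esumD; try by move=> e _; rewrite lee_fin mulr_ge0.
by rewrite !esumZl// lte_add_pinfty// lte_mul_pinfty// lee_fin.
Qed.

Lemma L2_lin (a : R[i]) f g : L2 f -> L2 g -> L2 (fun e x => a * f e x + g e x).
Proof.
move=> hf hg; have := L2_linr (complex.Re a) hf (L2_linr (complex.Im a) (L2_i hf) hg).
congr L2; apply/funext => e; apply/funext => x.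
by apply: eq_parts; rewrite !partsE/=; ring.
Qed.

Lemma ReInner f g : L2 f -> L2 g -> complex.Re (inner f g) = rsum (eip f g).
Proof.
move=> /L2P[lf _] /L2P[lg _]; rewrite /inner /csum /=; congr rsum.
apply/funext => e /=; rewrite /eip /cip /sqip.
case: (lf e) (lg e) => [fr fi] [gr gi].
rewrite -RintegralD//; try exact: sqint_mul.
by apply: eq_Rintegral => x _; rewrite !partsE; ring.
Qed.

Lemma ImInner f g :
  complex.Im (inner f g) = complex.Re (inner f (fun e x => 'i * g e x)).
Proof.
rewrite /inner /csum /=; congr rsum; apply/funext => e /=.
by apply: eq_Rintegral => x _; rewrite !partsE /=; ring.
Qed.

Lemma eip_summable f g : L2 f -> L2 g -> abs_summable (eip f g).
Proof.
move=> /L2P[lf nf] /L2P[lg ng]; rewrite !normsq_eip// in nf ng.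
apply: (@le_lt_trans _ _ (es (fun e => eip f f e + eip g g e))).
  apply: le_esum => e _; rewrite lee_fin.
  have := cip_norm (lf e) (lg e); have := normr_ge0 (eip f g e); rewrite /eip; lra.
under eq_esum do rewrite EFinD.
by rewrite esumD ?lte_add_pinfty// => e _; rewrite lee_fin cip_ge0.
Qed.

Lemma normsqE f : L2 f -> normsq f = (complex.Re (inner f f))%:E.
Proof.
move=> hf; rewrite ReInner// rsum_ge0E => [|e]; last exact: cip_ge0.
have [lf _] := (L2P f).1 hf.
by rewrite -normsq_eip// fineK// L2_fin.
Qed.

(** [Rcomplex] carries the scalar multiplication by reals, which makes the square-integrable
    functions a real module as the abstract spectral lemmas require. *)
Definition rgfun : Type := edge G -> R -> Rcomplex R.
HB.instance Definition _ := GRing.Lmodule.on rgfun.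
Definition L2pred : {pred rgfun} := fun f => `[< L2 (f : gfun G) >].

Lemma L2_0 : L2 ((fun _ _ => 0) : gfun G).
Proof.
have i0 e : normsq_on (len e : R) (fun=> 0) = 0%E.
  by apply: integral0_eq => x _; rewrite /sqmod/= expr0n addr0.
split; first by move=> e; split; exact: measurable_cst.
by rewrite /normsq esum1// => e _; exact: i0.
Qed.

Lemma L2_submod : submod_closed L2pred.
Proof.
split; first by apply/asboolP; exact: L2_0.
move=> a f g /asboolP hf /asboolP hg; apply/asboolP.
have := L2_linr a hf hg; congr L2; apply/funext => e; apply/funext => x.
by rewrite -scale_Rcomplex.
Qed.
HB.instance Definition _ := GRing.isSubmodClosed.Build R rgfun L2pred L2_submod.

Record L2space := MkL2 { l2fun :> rgfun; _ : l2fun \in L2pred }.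
HB.instance Definition _ := [isSub for l2fun].
HB.instance Definition _ := [Choice of L2space by <:].
HB.instance Definition _ := [SubChoice_isSubLmodule of L2space by <:].

Definition l2 (u : L2space) : gfun G := l2fun u.
Lemma l2P u : L2 (l2 u).
Proof. by case: u => u /= hu; have /asboolP := hu. Qed.

Lemma L2_l2 f : L2 f -> exists u, l2 u = f.
Proof.
move=> hf; have hf' : (f : rgfun) \in L2pred by apply/asboolP.
by exists (MkL2 hf').
Qed.

Lemma l2D u v : l2 (u + v) = fun e x => l2 u e x + l2 v e x.
Proof. by []. Qed.
Lemma l2Z (a : R) u : l2 (a *: u) = fun e x => a%:C * l2 u e x.
Proof. by apply/funext => e; apply/funext => x; rewrite -scale_Rcomplex. Qed.
Lemma l2B u v : l2 (u - v) = fun e x => l2 u e x - l2 v e x.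
Proof. by []. Qed.

Definition ip2 (u v : L2space) : R := complex.Re (inner (l2 u) (l2 v)).

Lemma ip2_lin (a : R) u v w : ip2 (a *: u + v) w = a * ip2 u w + ip2 v w.
Proof.
rewrite /ip2 !ReInner; try exact: l2P.
rewrite -rsum_lin; try by apply: eip_summable; exact: l2P.
congr rsum; apply/funext => e; rewrite l2D l2Z /eip.
have loc z : L2loc (l2 z) by have /L2P[] := l2P z.
exact: cip_lin (loc u e) (loc v e) (loc w e).
Qed.

Lemma semi_inner_L2 : semi_inner ip2.
Proof.
have ip0 w : ip2 0 w = 0.
  by have := ip2_lin (- 1) 0 0 w; rewrite scaler0 addr0; lra.
split=> [u v|u v w|a u w|u].
- by rewrite /ip2 !ReInner; try exact: l2P; congr rsum; apply/funext => e; exact: cipC.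
- by have := ip2_lin 1 u v w; rewrite scale1r mul1r.
- by have := ip2_lin a u 0 w; rewrite addr0 ip0 addr0.
- have := normsqE (l2P u); rewrite -/(ip2 u u) => h; rewrite -lee_fin -h.
  apply: esum_ge0 => e _; apply: integral_ge0 => x _.
  by rewrite lee_fin addr_ge0// sqr_ge0.
Qed.

End L2Theory.

Section L2Complete.
Variables (R : realType) (G : metric_graph R).
Implicit Types u : L2space G.

Lemma sum_eip_le (s : seq (edge G)) u : uniq s ->
  \sum_(e <- s) eip (l2 u) (l2 u) e <= ip2 u u.
Proof.
move=> us; rewrite -lee_fin -(normsqE (l2P u)) normsq_eip; last by case/L2P: (l2P u).
apply: esum_ge; exists [set` s]; first by split=> //; exact: finite_seq.
by rewrite -fsbig_seq// sumEFin.
Qed.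

(** Limits exist edge by edge. On a finite set of edges the remainder is compared with a later index
    that depends on the set, but the resulting bound does not, so it passes to the supremum over all
    finite sets. *)
Lemma L2_complete : ip_complete (@ip2 R G).
Proof.
move=> x xc.
have loc (z : L2space G) : L2loc (l2 z) by have /L2P[] := l2P z.
have /choice[u hu] : forall e : edge G, exists k : R -> R[i], sqc (len e) k /\
    forall d, 0 < d -> exists N : nat, forall n, (N <= n)%N ->
    cip (len e) (fun t => l2 (x n) e t - k t) (fun t => l2 (x n) e t - k t) < d.
  move=> e.
  have [n|d d0|g hg cg] := @cip_complete _ (len e) (fun n => l2 (x n) e).
  - exact: loc.
  - have [N hN] := xc d d0; exists N => m n Nm Nn.
    apply: le_lt_trans (hN m n Nm Nn).
    by have := @sum_eip_le [:: e] (x m - x n) isT; rewrite big_seq1.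
  - by exists g.
have locu : L2loc u by move=> e; case: (hu e).
pose xu n : gfun G := fun e t => l2 (x n) e t - u e t.
have locxu n : L2loc (xu n).
  move=> e; have := sqc_lin (- 1) (locu e) (loc (x n) e); congr sqc.
  by apply/funext => t; rewrite /xu mulN1r addrC.
have fsmall (s : seq (edge G)) (d : R) : 0 < d -> exists N : nat, forall n, (N <= n)%N ->
    \sum_(e <- s) eip (xu n) (xu n) e < d.
  elim: s d => [|e s IH] d d0; first by exists 0%N => n _; rewrite big_nil.
  have d2 : 0 < d / 2 by rewrite divr_gt0.
  have [N1 h1] := IH _ d2; have [N2 h2] := (hu e).2 _ d2.
  exists (maxn N1 N2) => n; rewrite geq_max => /andP[/h1 {}h1 /h2 {}h2].
  by rewrite big_cons (_ : d = d / 2 + d / 2) ?ltrD//; lra.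
have xuP n k e : eip (xu n) (xu n) e <=
    2 * eip (l2 (x n - x k)) (l2 (x n - x k)) e + 2 * eip (xu k) (xu k) e.
  have h1 := loc (x n - x k) e; have h2 := locxu k e.
  have E : xu n e = (fun t => 1%:C * l2 (x n - x k) e t + xu k e t).
    by apply/funext => t; rewrite /xu l2B mul1r addrA subrK.
  rewrite /eip E; have h3 := sqc_lin 1%:C h1 h2.
  rewrite (cip_lin _ h1 h2 h3) [cip _ (l2 _ _) _]cipC [cip _ (xu k e) _]cipC.
  rewrite (cip_lin _ h1 h2 h1) (cip_lin _ h1 h2 h2) [cip _ (xu k e) (l2 _ _)]cipC.
  have := cip_le 1 h1 h2; lra.
have xu_le (d : R) : 0 < d -> exists N : nat, forall n, (N <= n)%N ->
    (normsq (xu n) <= (4 * d)%:E)%E.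
  move=> d0; have [N hN] := xc d d0; exists N => n Nn.
  rewrite normsq_eip//; apply: ge_ereal_sup => _ [A [finA _] <-].
  rewrite fsbig_finite// sumEFin lee_fin.
  have [K hK] := fsmall (fset_set A) d d0.
  pose k := maxn N K.
  apply: (le_trans (ler_sum _ (fun e _ => xuP n k e))).
  rewrite big_split/= -!mulr_sumr.
  have := hK k (leq_maxr _ _); have := hN n k Nn (leq_maxl _ _).
  have := @sum_eip_le (fset_set A) (x n - x k) (fset_uniq _).
  lra.
have L2xu n : exists2 N : nat, (n <= N)%N & L2 (xu N).
  have [N hN] := xu_le 1 ltr01; exists (maxn n N); first exact: leq_maxl.
  by apply/L2P; split=> //; rewrite (le_lt_trans (hN _ (leq_maxr _ _)))// ltry.
have [N _ hN] := L2xu 0%N.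
have L2u : L2 u.
  have := L2_lin (- 1) hN (l2P (x N)); congr L2; apply/funext => e; apply/funext => t.
  by rewrite /xu mulN1r opprB subrK.
have [v vu] := L2_l2 L2u.
exists v => d d0; have d8 : 0 < d / 8 by rewrite divr_gt0.
have [M hM] := xu_le _ d8; exists M => n /hM; rewrite /xu -vu -l2B.
rewrite normsqE; last exact: l2P.
by rewrite lee_fin => /le_lt_trans; apply; lra.
Qed.

End L2Complete.

(** * The form domain and the Kirchhoff Laplacian *)

Section RealInterval.
Variables (R : realType) (l : R).
Local Notation mu := (@lebesgue_measure R).
Implicit Types f g : R -> R.

Lemma within_continuous_sqint f :
  {within `[0, l], continuous f} -> sqint mu `[0, l] f.
Proof.
move=> cf; split.
  exact: subspace_continuous_measurable_fun (measurable_cc _ _) cf.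
have cf2 : {within `[0, l], continuous (fun x => f x ^+ 2)}.
  rewrite (_ : (fun x => _) = (fun x => f x * f x)).
    by move=> x; apply: cvgM; exact: cf.
  by apply/funext => x; rewrite expr2.
have /integrableP[_] := continuous_compact_integrable (@segment_compact _ 0 l) cf2.
apply: le_lt_trans; apply: ge0_le_integral => //.
- by move=> x _; rewrite lee_fin sqr_ge0.
- apply/measurable_EFinP.
  exact: subspace_continuous_measurable_fun (measurable_cc _ _) cf2.
- apply: measurableT_comp => //; apply/measurable_EFinP.
  exact: subspace_continuous_measurable_fun (measurable_cc _ _) cf2.
- by move=> x _; rewrite lee_fin ler_norm.
Qed.

Lemma sqint_integrable f : sqint mu `[0, l] f -> mu.-integrable `[0, l] (EFin \o f).
Proof.
move=> hf; have h1 : sqint mu `[0, l] (fun _ => 1).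
  by apply: within_continuous_sqint => x; exact: cvg_cst.
have := sqint_mul (measurable_cc _ _) hf h1.
by apply: eq_integrable => // x _; rewrite /= mulr1.
Qed.

Lemma sqint_interior f g : {in `]0, l[, f =1 g} ->
  sqint mu `[0, l] f -> sqint mu `[0, l] g /\
  (\int[mu]_(x in `[0%R, l]) ((f x) ^+ 2)%:E =
   \int[mu]_(x in `[0%R, l]) ((g x) ^+ 2)%:E)%E.
Proof.
move=> fg [mf f2].
have mfo : measurable_fun `]0, l[ f.
  by apply: measurable_funS mf => //; exact: subset_itv_oo_cc.
have mgo : measurable_fun `]0, l[ g.
  by apply: eq_measurable_fun mfo => x; rewrite inE; exact: fg.
have E : (\int[mu]_(x in `[0%R, l]) ((f x) ^+ 2)%:E =
   \int[mu]_(x in `[0%R, l]) ((g x) ^+ 2)%:E)%E.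
  have oo (h : R -> R) : measurable_fun `]0, l[ h ->
      (\int[mu]_(x in `[0%R, l]) ((h x) ^+ 2)%:E =
       \int[mu]_(x in `]0%R, l[) ((h x) ^+ 2)%:E)%E.
    move=> mh; apply: integral_itv_bndoo.
    by apply/measurable_EFinP; exact: measurable_funX.
  rewrite oo// oo//; apply: eq_integral => x xl.
  by rewrite fg//; move: xl; rewrite inE.
split=> //; split; last by rewrite -E.
exact: measurable_fun_itv_cc mgo.
Qed.

Lemma primitive_continuous f g : 0 < l -> mu.-integrable `[0, l] (EFin \o g) ->
  (forall x, 0 <= x <= l -> f x = f 0 + \int[mu]_(t in `[0, x]) g t) ->
  {within `[0, l], continuous f}.
Proof.
move=> l0 ig fE.
have cF := parameterized_integral_continuous (ltW l0) ig.
apply: (@subspace_eq_continuous _ _ _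
  (fun x => f 0 + parameterized_integral mu 0 x g)).
  by move=> x; rewrite inE/= in_itv/= => /fE; exact: esym.
by move=> x; apply: cvgD; [exact: cvg_cst|exact: cF].
Qed.

Lemma primitive_derive f g : 0 < l -> {within `[0, l], continuous g} ->
  (forall x, 0 <= x <= l -> f x = f 0 + \int[mu]_(t in `[0, x]) g t) ->
  forall x, 0 < x < l -> is_derive x 1 f (g x).
Proof.
move=> l0 cg fE x /andP[x0 xl].
have ig := sqint_integrable (within_continuous_sqint cg).
have cgx : {for x, continuous g}.
  have [+ _ _] := (continuous_within_itvP _ l0).1 cg.
  by apply; rewrite in_itv/= x0.
have [dF FE] := continuous_FTC1_closed xl ig x0 cgx.
apply: (@near_eq_is_derive R R R
    (fun y => f 0 + \int[mu]_(t in `[0, y]) g t)).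
  near=> y; apply/esym/fE; apply/andP; split.
    by apply: ltW; near: y; exact: lt_nbhsr.
  by apply: ltW; near: y; exact: lt_nbhsl.
rewrite -[g x]add0r -FE derive1E; apply: is_deriveD.
exact: DeriveDef.
Unshelve. all: by end_near. Qed.

End RealInterval.

Section Sobolev.
Variables (R : realType) (l : R).
Hypothesis l0 : 0 < l.
Local Notation mu := (@lebesgue_measure R).
Local Notation re h := (fun x => complex.Re (h x)).
Local Notation im h := (fun x => complex.Im (h x)).
Implicit Types h k : R -> R[i].

Lemma sobolev2_primitives h h1 h2 : sobolev2 l h h1 h2 ->
  [/\ sqc l h2,
    forall x, 0 <= x <= l -> re h x = re h 0 + \int[mu]_(t in `[0, x]) re h1 t,
    forall x, 0 <= x <= l -> im h x = im h 0 + \int[mu]_(t in `[0, x]) im h1 t,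
    forall x, 0 <= x <= l -> re h1 x = re h1 0 + \int[mu]_(t in `[0, x]) re h2 t &
    forall x, 0 <= x <= l -> im h1 x = im h1 0 + \int[mu]_(t in `[0, x]) im h2 t].
Proof.
move=> [m2 n2 hE h1E]; split; first exact/sqcP.
- by move=> x /hE ->; rewrite ReD.
- by move=> x /hE ->; rewrite ImD.
- by move=> x /h1E ->; rewrite ReD.
- by move=> x /h1E ->; rewrite ImD.
Qed.

Lemma sobolev2_continuous h h1 h2 : sobolev2 l h h1 h2 ->
  {within `[0, l], continuous (re h1)} /\ {within `[0, l], continuous (im h1)}.
Proof.
move=> /sobolev2_primitives[[r2 i2] _ _ r1 i1]; split.
  exact: primitive_continuous l0 (sqint_integrable r2) r1.
exact: primitive_continuous l0 (sqint_integrable i2) i1.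
Qed.

Lemma sobolev2_sqc1 h h1 h2 : sobolev2 l h h1 h2 -> sqc l h1.
Proof.
by move=> /sobolev2_continuous[cr ci]; split; exact: within_continuous_sqint.
Qed.

Lemma sobolev2_sqc h h1 h2 : sobolev2 l h h1 h2 -> sqc l h.
Proof.
move=> hs; have [_ hr hi _ _] := sobolev2_primitives hs.
have [r1 i1] := sobolev2_sqc1 hs; split; apply: within_continuous_sqint.
  exact: primitive_continuous l0 (sqint_integrable r1) hr.
exact: primitive_continuous l0 (sqint_integrable i1) hi.
Qed.

Lemma sobolev2_derive h h1 h2 : sobolev2 l h h1 h2 -> forall x, 0 < x < l ->
  is_derive x 1 (re h) (re h1 x) /\ is_derive x 1 (im h) (im h1 x).
Proof.
move=> hs x xl; have [_ hr hi _ _] := sobolev2_primitives hs.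
have [cr ci] := sobolev2_continuous hs.
by split; [exact: (primitive_derive l0 cr hr)|exact: (primitive_derive l0 ci hi)].
Qed.

Lemma cintegral_lin (a : R[i]) h k x : x <= l -> sqc l h -> sqc l k ->
  cintegral `[0, x] (fun t => a * h t + k t) =
  a * cintegral `[0, x] h + cintegral `[0, x] k.
Proof.
move=> xl [hr hi] [kr ki].
have sub : `[0, x] `<=` `[0, l] by apply: subset_itvl; rewrite bnd_simp.
have int (f : R -> R) : sqint mu `[0, l] f -> mu.-integrable `[0, x] (EFin \o f).
  by move=> /sqint_integrable; apply: integrableS => //; exact: measurable_cc.
have int2 (b : R) (f : R -> R) : sqint mu `[0, l] f ->
    mu.-integrable `[0, x] (EFin \o (fun t => b * f t)).
  move=> /int /(integrableZl (measurable_cc _ _) b).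
  by apply: eq_integrable => //; exact: measurable_cc.
have int3 (b c : R) (f g : R -> R) : sqint mu `[0, l] f -> sqint mu `[0, l] g ->
    mu.-integrable `[0, x] (EFin \o (fun t => b * f t + c * g t)).
  move=> hf hg; have := integrableD (measurable_cc _ _) (int2 b _ hf) (int2 c _ hg).
  by apply: eq_integrable => //; exact: measurable_cc.
have lin (b c : R) (f g m : R -> R) : sqint mu `[0, l] f -> sqint mu `[0, l] g ->
    sqint mu `[0, l] m ->
    \int[mu]_(t in `[0, x]) (b * f t + c * g t + m t) =
    b * \int[mu]_(t in `[0, x]) f t + c * \int[mu]_(t in `[0, x]) g t +
    \int[mu]_(t in `[0, x]) m t.
  move=> hf hg hm; have mx := @measurable_cc R 0 x.
  by rewrite RintegralD ?RintegralD ?RintegralZl//; (exact: int3 || exact: int2 || exact: int).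
apply: eq_parts; rewrite !partsE /cintegral/=.
  rewrite -mulNr -lin//; apply: eq_Rintegral => t _; rewrite !partsE; ring.
by rewrite -lin//; apply: eq_Rintegral => t _; rewrite !partsE; ring.
Qed.

Lemma sobolev2_lin (a : R[i]) h h1 h2 k k1 k2 :
  sobolev2 l h h1 h2 -> sobolev2 l k k1 k2 ->
  sobolev2 l (fun x => a * h x + k x) (fun x => a * h1 x + k1 x)
    (fun x => a * h2 x + k2 x).
Proof.
move=> hs ks; have h1s := sobolev2_sqc1 hs; have k1s := sobolev2_sqc1 ks.
have [h2s _ _ _ _] := sobolev2_primitives hs.
have [k2s _ _ _ _] := sobolev2_primitives ks.
have [m n] := (sqcP _ _).1 (sqc_lin a h2s k2s).
case: hs ks => [_ _ hE h1E] [_ _ kE k1E]; split=> // x xl.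
  rewrite (cintegral_lin a (proj2 (andP xl)) h1s k1s) [h x](hE x xl) [k x](kE x xl).
  by ring.
rewrite (cintegral_lin a (proj2 (andP xl)) h2s k2s) [h1 x](h1E x xl) [k1 x](k1E x xl).
by ring.
Qed.

End Sobolev.

(** * Functions in the domain of H_0 and their gradients *)

Section DomH0.
Variables (R : realType) (G : metric_graph R).
Local Notation mu := (@lebesgue_measure R).
Local Notation re h := (fun x => complex.Re (h x)).
Local Notation im h := (fun x => complex.Im (h x)).
Implicit Types f g h : gfun G.

Lemma len_gt0 (e : edge G) : 0 < len e.
Proof. by move: e; case: G. Qed.

Lemma dom_H0_lin (a : R[i]) f g : dom_H0 f -> dom_H0 g ->
  dom_H0 (fun e x => a * f e x + g e x).
Proof.
move=> [f1 [f2 [fs ff fD fC fK]]] [g1 [g2 [gs gf gD gC gK]]].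
exists (fun e x => a * f1 e x + g1 e x), (fun e x => a * f2 e x + g2 e x).
have tr (h k : gfun G) b e :
    trace (fun e x => a * h e x + k e x) b e = a * trace h b e + trace k b e.
  by rewrite /trace; case: ifP.
have inw (h k : gfun G) b e :
    inward (fun e x => a * h e x + k e x) b e = a * inward h b e + inward k b e.
  by rewrite /inward; case: ifP => // _; rewrite opprD mulrN.
split.
- by move=> e; apply: sobolev2_lin; [exact: len_gt0|exact: fs|exact: gs].
- apply: (@sub_finite_set _ _ ([set e | exists2 x, 0 <= x <= len e & f e x != 0] `|`
    [set e | exists2 x, 0 <= x <= len e & g e x != 0])); last by rewrite finite_setU.
  move=> e [x xe]; have [f0|f0] := eqVneq (f e x) 0.
    by rewrite f0 mulr0 add0r => g0; right; exists x.
  by move=> _; left; exists x.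
- by move=> b bD e be; rewrite tr fD// gD// mulr0 addr0.
- by move=> b bD e e' be be'; rewrite !tr (fC b bD e e')// (gC b bD e e').
- move=> b bD; under eq_bigr do rewrite inw.
  by rewrite big_split/= -mulr_sumr fK// gK// mulr0 addr0.
Qed.

Lemma L2_finite (A : set (edge G)) f : finite_set A -> L2loc f ->
  (forall e, ~ A e -> normsq_on (len e) (f e) = 0%E) -> L2 f.
Proof.
move=> finA lf f0; apply/L2P; split=> //.
have -> : normsq f = \esum_(e in A) normsq_on (len e) (f e).
  rewrite esum_mkcond; apply: eq_esum => e _; case: ifPn => //.
  by rewrite notin_setE => /f0.
rewrite -[A]set_mem_set esum_fset ?set_mem_set//.
  rewrite fsbig_finite//; apply: lte_sum_pinfty => e _.
  by rewrite normsq_on_cip// ltry.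
by move=> e _; rewrite normsq_on_cip// lee_fin cip_ge0.
Qed.

Lemma normsq_on0 (e : edge G) (h : R -> R[i]) : sqc (len e) h ->
  (forall x, 0 < x < len e -> h x = 0) -> normsq_on (len e) h = 0%E.
Proof.
move=> [hr hi] h0; have [mh _] := (sqcP _ _).1 (conj hr hi); rewrite normsq_onE//.
have z (k : R -> R) : sqint mu `[0, len e] k -> (forall x, 0 < x < len e -> k x = 0) ->
    (\int[mu]_(x in `[0%R, len e]) ((k x) ^+ 2)%:E = 0)%E.
  move=> hk k0; have [|_ ->] := @sqint_interior _ (len e) k (fun _ => 0) _ hk.
    by move=> x; rewrite in_itv/=; exact: k0.
  by apply: integral0_eq => x _; rewrite expr0n.
by rewrite !z ?adde0// => x /h0 ->.
Qed.

Lemma dom_H0_regular f : dom_H0 f -> L2 f /\ exists f1 : gfun G, L2 f1 /\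
  forall e x, 0 < x < len e -> is_derive x 1 (re (f e)) (re (f1 e) x) /\
    is_derive x 1 (im (f e)) (im (f1 e) x).
Proof.
move=> [f1 [f2 [fs ff _ _ _]]].
set A := (X in finite_set X) in ff.
have lf : L2loc f by move=> e; exact: (sobolev2_sqc (len_gt0 e) (fs e)).
have lf1 : L2loc f1 by move=> e; exact: (sobolev2_sqc1 (len_gt0 e) (fs e)).
have fA e x : ~ A e -> 0 <= x <= len e -> f e x = 0.
  by move=> Ae xe; apply/eqP/negPn/negP => fx; apply: Ae; exists x.
have df e x : 0 < x < len e -> is_derive x 1 (re (f e)) (re (f1 e) x) /\
    is_derive x 1 (im (f e)) (im (f1 e) x).
  by move=> xe; exact: (sobolev2_derive (len_gt0 e) (fs e)).
split.
  apply: (L2_finite ff) => // e Ae; apply: normsq_on0 => // x /andP[x0 xl].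
  by rewrite fA// !ltW.
exists f1; split=> //.
(* The finite support is that of [f]; inside an edge where [f] vanishes, [f1] is the derivative of a
   locally zero function. *)
apply: (L2_finite ff) => // e Ae; apply: normsq_on0 => // x xe.
have [dr di] := df e x xe; case/andP: xe => x0 xl.
have c0 (P : R[i] -> R) : P 0 = 0 -> \forall y \near x, P (f e y) = cst 0 y.
  move=> P0; near=> y; rewrite fA//; apply/andP; split; apply/ltW; near: y.
    exact: lt_nbhsr.
  exact: lt_nbhsl.
apply: eq_parts.
  rewrite -[LHS](@derive_val _ _ _ _ _ _ _ dr).
  by rewrite (near_eq_derive _ (c0 (@complex.Re R) erefl)) derive_cst.
rewrite -[LHS](@derive_val _ _ _ _ _ _ _ di).
by rewrite (near_eq_derive _ (c0 (@complex.Im R) erefl)) derive_cst.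
Unshelve. all: by end_near. Qed.

Lemma L2_interior f g : (forall e x, 0 < x < len e -> f e x = g e x) -> L2 f ->
  L2 g /\ normsq g = normsq f.
Proof.
move=> fg /L2P[lf nf].
have E e : sqc (len e) (g e) /\ normsq_on (len e) (g e) = normsq_on (len e) (f e).
  have [fr fi] := lf e.
  have [|gr rE] := @sqint_interior _ (len e) (re (f e)) (re (g e)) _ fr.
    by move=> x; rewrite in_itv/= => /fg ->.
  have [|gi iE] := @sqint_interior _ (len e) (im (f e)) (im (g e)) _ fi.
    by move=> x; rewrite in_itv/= => /fg ->.
  have hg : sqc (len e) (g e) by split.
  have [mg _] := (sqcP _ _).1 hg; have [mf _] := (sqcP _ _).1 (lf e).
  by split=> //; rewrite !normsq_onE// rE iE.
have nE : normsq g = normsq f by apply: eq_esum => e _; case: (E e).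
by split=> //; apply/L2P; split; [move=> e; case: (E e)|rewrite nE].
Qed.

Lemma gradE f (f1 : gfun G) (e : edge G) (x : R) : is_derive x 1 (re (f e)) (re (f1 e) x) ->
  is_derive x 1 (im (f e)) (im (f1 e) x) -> grad f e x = f1 e x.
Proof.
move=> dr di; rewrite /grad !derive1E (@derive_val _ _ _ _ _ _ _ dr).
by rewrite (@derive_val _ _ _ _ _ _ _ di); exact: eq_parts.
Qed.

Lemma L2_grad f : dom_H0 f -> L2 (grad f).
Proof.
move=> /dom_H0_regular[_ [f1 [lf1 df]]].
by have [] := @L2_interior f1 (grad f) _ lf1; last by [];
  move=> e x /df[dr di]; rewrite (gradE dr di).
Qed.

Lemma grad_lin (a : R[i]) f g (e : edge G) (x : R) : dom_H0 f -> dom_H0 g -> 0 < x < len e ->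
  grad (fun e x => a * f e x + g e x) e x = a * grad f e x + grad g e x.
Proof.
move=> /dom_H0_regular[_ [f1 [_ df]]] /dom_H0_regular[_ [g1 [_ dg]]] xe.
have [fr fi] := df e x xe; have [gr gi] := dg e x xe.
rewrite (gradE fr fi) (gradE gr gi).
have dlin (b c : R) (F1 F2 F3 : R -> R) (d1 d2 d3 : R) :
    is_derive x 1 F1 d1 -> is_derive x 1 F2 d2 -> is_derive x 1 F3 d3 ->
    is_derive x 1 (fun y => b * F1 y + c * F2 y + F3 y) (b * d1 + c * d2 + d3).
  move=> h1 h2 h3; apply: is_deriveD; apply: is_deriveD; exact: is_deriveZ.
apply: (@gradE _ (fun e x => a * f1 e x + g1 e x)).
  have := dlin (complex.Re a) (- complex.Im a) _ _ _ _ _ _ fr fi gr.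
  rewrite (_ : (fun y => _) = re (fun x => a * f e x + g e x)).
    by congr is_derive; rewrite !partsE; ring.
  by apply/funext => y; rewrite !partsE; ring.
have := dlin (complex.Re a) (complex.Im a) _ _ _ _ _ _ fi fr gi.
rewrite (_ : (fun y => _) = im (fun x => a * f e x + g e x)).
  by congr is_derive; rewrite !partsE; ring.
by apply/funext => y; rewrite !partsE; ring.
Qed.

End DomH0.

(** * Limits and closures of relations *)

Section SemiInnerLimits.
Variables (R : realType) (X : lmodType R) (ip : X -> X -> R).
Hypothesis sip : semi_inner ip.
Implicit Types x y z : X.
Let iE := ipE sip.
Let ip0 := ip_ge0 sip.

Lemma lt_quarters (a b e : R) : a < e / 4 -> b < e / 4 -> 2 * a + 2 * b < e.
Proof. lra. Qed.

Definition ip_cvg (x : nat -> X) y := forall e, 0 < e ->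
  exists N : nat, forall n, (N <= n)%N -> ip (x n - y) (x n - y) < e.

Lemma ip_normD x y : ip (x + y) (x + y) <= 2 * ip x x + 2 * ip y y.
Proof. by have := ip0 (x - y); rewrite !iE; lra. Qed.

Lemma ip_cvg_lim (x z : nat -> X) y w : ip_cvg x y -> ip_cvg z w ->
  (fun n => ip (x n) (z n)) @ \oo --> ip y w.
Proof.
move=> xy zw; apply/cvgrPdist_lt => /= e e0.
have half (a : R) : 0 <= a -> 0 < a + 1 by lra.
pose d := Num.min (e / 2) (Num.min ((e / 4) ^+ 2 / (ip y y + 1))
  ((e / 4) ^+ 2 / (ip w w + 1))).
have d0 : 0 < d.
  by rewrite !lt_min !divr_gt0 ?exprn_gt0 ?divr_gt0 ?half ?ip0.
have [N1 h1] := xy d d0; have [N2 h2] := zw d d0.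
exists (maxn N1 N2) => // n; rewrite /= geq_max => /andP[/h1 {}h1 /h2 {}h2].
have E : ip y w - ip (x n) (z n) =
    - (ip (x n - y) (z n - w) + ip (x n - y) w + ip (z n - w) y).
  by rewrite !iE (ipC sip y (z n)) (ipC sip w y); ring.
have small a b : ip a a < d -> (e / 4) ^+ 2 / (ip b b + 1) >= d -> `|ip a b| < e / 4.
  move=> ad; rewrite ler_pdivlMr ?half ?ip0// => bd.
  have : ip a b ^+ 2 < (e / 4) ^+ 2.
    apply: le_lt_trans (ip_CS sip a b) _; apply: lt_le_trans bd.
    by have := ip0 b; have := ip0 a; nra.
  by rewrite -real_normK ?num_real// ltr_pXn2r ?nnegrE// divr_ge0// ltW.
have a1 : `|ip (x n - y) w| < e / 4 by apply: small; rewrite // !ge_min lexx !orbT.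
have a2 : `|ip (z n - w) y| < e / 4 by apply: small; rewrite // !ge_min lexx !orbT.
have a3 : 2 * `|ip (x n - y) (z n - w)| < e.
  apply: le_lt_trans (ip_le sip _ _) _; have : d <= e / 2 by rewrite ge_min lexx.
  lra.
rewrite E normrN; apply: le_lt_trans (ler_normD _ _) _.
have := ler_normD (ip (x n - y) (z n - w)) (ip (x n - y) w); lra.
Qed.

Lemma ip_add_null x y : ip x x = 0 -> ip (x + y) (x + y) = ip y y.
Proof.
move=> x0; have n0 := ip_null sip _ x0.
by rewrite (ipDl sip) n0 add0r (ipC sip) (ipDl sip) n0 add0r.
Qed.

Definition ip_closure (G : X -> X -> Prop) u p := forall e, 0 < e ->
  exists f g, [/\ G f g, ip (f - u) (f - u) < e & ip (g - p) (g - p) < e].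

Lemma ip_closureD (G : X -> X -> Prop) :
  (forall u p v q, G u p -> G v q -> G (u + v) (p + q)) ->
  forall u p v q, ip_closure G u p -> ip_closure G v q -> ip_closure G (u + v) (p + q).
Proof.
move=> GD u p v q up vq e e0; have e4 : 0 < e / 4 by rewrite divr_gt0.
have [f [g [fg fu gp]]] := up _ e4; have [f' [g' [fg' fv gq]]] := vq _ e4.
exists (f + f'), (g + g'); split; first exact: GD.
  by rewrite opprD addrACA; apply: le_lt_trans (ip_normD _ _) _; lra.
by rewrite opprD addrACA; apply: le_lt_trans (ip_normD _ _) _; lra.
Qed.

Lemma ip_closureZ (G : X -> X -> Prop) :
  (forall a u p, G u p -> G (a *: u) (a *: p)) ->
  forall a u p, ip_closure G u p -> ip_closure G (a *: u) (a *: p).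
Proof.
move=> GZ a u p up e e0; have a1 : 0 < a ^+ 2 + 1 by have := sqr_ge0 a; lra.
have [f [g [fg fu gp]]] := up _ (divr_gt0 e0 a1).
exists (a *: f), (a *: g); split; first exact: GZ.
  rewrite -scalerBr (ipZl sip) (ipZr sip) mulrA -expr2.
  by move: fu; rewrite ltr_pdivlMr//; have := ip0 (f - u); lra.
rewrite -scalerBr (ipZl sip) (ipZr sip) mulrA -expr2.
by move: gp; rewrite ltr_pdivlMr//; have := ip0 (g - p); lra.
Qed.

End SemiInnerLimits.

(** * The Kirchhoff Laplacian as an abstract form operator *)

Section Kirchhoff.
Variables (R : realType) (G : metric_graph R).
Implicit Types f g h : gfun G.
Implicit Types u v w p q : L2space G.
Local Notation ip := (@ip2 R G).
Let sip := @semi_inner_L2 R G.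

Lemma normsq_l2 u : normsq (l2 u) = (ip u u)%:E.
Proof. exact: normsqE (l2P u). Qed.

Lemma normsqB u v : normsq (fun e x => l2 u e x - l2 v e x) = (ip (u - v) (u - v))%:E.
Proof. by rewrite -normsq_l2. Qed.

Lemma l2_inj u v : l2 u = l2 v -> u = v.
Proof. by move=> h; apply: val_inj. Qed.

Definition l2i u : L2space G := projT1 (cid (L2_l2 (L2_i (l2P u)))).
Lemma l2iE u : l2 (l2i u) = fun e x => 'i * l2 u e x.
Proof. by rewrite /l2i; case: cid. Qed.

Lemma l2iB u v : l2i (u - v) = l2i u - l2i v.
Proof.
apply: l2_inj; rewrite l2B !l2iE l2B; apply/funext => e; apply/funext => x.
by rewrite mulrBr.
Qed.

Lemma ip_l2i u v : ip u (l2i v) = complex.Im (inner (l2 u) (l2 v)).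
Proof. by rewrite ImInner /ip2 l2iE. Qed.

Lemma ip_l2i_l2i u : ip (l2i u) (l2i u) = ip u u.
Proof.
rewrite /ip2 l2iE /inner /csum/=; congr rsum; apply/funext => e.
by apply: eq_Rintegral => x _; rewrite !partsE/=; ring.
Qed.

(* The graph of the gradient on [dom_H0]; the gradient of [Defs] is a junk value
   at the endpoints of the edges, which form a null set. *)
Definition grad0 u p := dom_H0 (l2 u) /\
  forall e x, 0 < x < len e -> l2 p e x = grad (l2 u) e x.

(** Closing the form amounts to closing the gradient [A]: the form domain consists of the [u] with
    some [gradc u p], and the closed form is the inner product of such gradients. In these terms the
    operator is [A^* A]. *)
Definition gradc := ip_closure ip grad0.

Lemma grad0_lin (a : R) u p v q : grad0 u p -> grad0 v q ->
  grad0 (a *: u + v) (a *: p + q).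
Proof.
move=> [du up] [dv vq]; have E z w : l2 (a *: z + w) = fun e x => a%:C * l2 z e x + l2 w e x.
  by rewrite l2D l2Z.
split; first by rewrite E; exact: dom_H0_lin.
by move=> e x xe; rewrite !E grad_lin// up// vq.
Qed.

Lemma grad0_sub u p v q : grad0 u p -> grad0 v q -> grad0 (u - v) (p - q).
Proof.
by move=> up vq; have := grad0_lin (- 1) vq up; rewrite !scaleN1r ![- _ + _]addrC.
Qed.

Lemma grad0D u p v q : grad0 u p -> grad0 v q -> grad0 (u + v) (p + q).
Proof. by move=> up vq; have := grad0_lin 1 up vq; rewrite !scale1r. Qed.

Lemma grad0Z a u p : grad0 u p -> grad0 (a *: u) (a *: p).
Proof.
by move=> up; have := grad0_lin (a - 1) up up; rewrite !scalerBl !scale1r !subrK.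
Qed.

Lemma gradcD u p v q : gradc u p -> gradc v q -> gradc (u + v) (p + q).
Proof. by apply: (ip_closureD sip); exact: grad0D. Qed.

Lemma gradcZ a u p : gradc u p -> gradc (a *: u) (a *: p).
Proof. by apply: (ip_closureZ sip); exact: grad0Z. Qed.

Lemma grad0_i u p : grad0 u p -> grad0 (l2i u) (l2i p).
Proof.
move=> [du up].
(* Writing ['i] as [('i - 1) + 1] gives the multiple the shape of the linear combinations in
   [dom_H0_lin]. *)
have E z : l2 (l2i z) = fun e x => ('i - 1) * l2 z e x + l2 z e x.
  by rewrite l2iE; apply/funext => e; apply/funext => x; ring.
split; first by rewrite E; exact: dom_H0_lin.
by move=> e x xe; rewrite !E grad_lin// up.
Qed.

Lemma gradc_i u p : gradc u p -> gradc (l2i u) (l2i p).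
Proof.
move=> up e e0; have [f [g [fg fu gp]]] := up e e0.
exists (l2i f), (l2i g); split; first exact: grad0_i.
  by rewrite -l2iB ip_l2i_l2i; exact: fu.
by rewrite -l2iB ip_l2i_l2i; exact: gp.
Qed.

Lemma grad0_exists f : dom_H0 f -> exists u p,
  [/\ l2 u = f, l2 p = grad f & grad0 u p].
Proof.
move=> df; have [u uf] := L2_l2 (dom_H0_regular df).1.
have [p pf] := L2_l2 (L2_grad df); exists u, p; split=> //.
by split; rewrite uf// pf.
Qed.

Lemma grad0_energy u p : grad0 u p -> energy (l2 u) = (ip p p)%:E.
Proof.
move=> [du up]; rewrite -normsq_l2 /energy.
by have [] := @L2_interior R G (l2 p) (grad (l2 u)) (fun e x xe => up e x xe) (l2P p).
Qed.

Lemma grad0_null u p q : grad0 u p -> grad0 u q -> ip (p - q) (p - q) = 0.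
Proof.
move=> [_ up] [_ uq]; have := @L2_interior R G (fun _ _ => 0) (l2 (p - q)) _ (L2_0 G).
case=> [e x xe|_]; first by rewrite l2B up// uq// subrr.
rewrite normsq_l2 => h.
have : normsq ((fun _ _ => 0) : gfun G) = 0%E.
  rewrite /normsq esum1// => e _; apply: integral0_eq => x _.
  by rewrite /sqmod/= expr0n addr0.
by rewrite -h => -[].
Qed.

(** The Cauchy condition on energies is one on gradients, so completeness provides their limit
    [p]. *)
Lemma form_approx_gradc F u : form_approx F (l2 u) ->
  exists (P : nat -> L2space G) p, [/\ forall n, l2 (P n) = grad (F n),
    ip_cvg ip P p & gradc u p].
Proof.
move=> [dF Fu Fc].
have /choice[UP hUP] : forall n, exists z : L2space G * L2space G,
    [/\ l2 z.1 = F n, l2 z.2 = grad (F n) & grad0 z.1 z.2].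
  by move=> n; have [z [p h]] := grad0_exists (dF n); exists (z, p).
pose P n := (UP n).2; pose U n := (UP n).1.
have UPn n : grad0 (U n) (P n) by case: (hUP n).
have [|p Pp] := @L2_complete R G P.
  move=> e e0; have [N hN] := Fc e e0; exists N => m n Nm Nn.
  have := hN m n Nm Nn.
  have -> : (fun e x => F m e x - F n e x) = l2 (U m - U n).
    by rewrite l2B; have [-> _ _] := hUP m; have [-> _ _] := hUP n.
  by rewrite (grad0_energy (grad0_sub (UPn m) (UPn n))) lte_fin.
exists P, p; split=> // [n|e e0]; first by case: (hUP n).
have [N hN] := Pp e e0.
have Uu : (fun n => ip (U n - u) (U n - u)) @ \oo --> (0 : R).
  move: Fu; under eq_fun => n.
    have [<- _ _] := hUP n; rewrite -/(U n) normsqB; over.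
  by move=> /fine_cvgP[].
move/cvgrPdist_lt: Uu => /(_ e e0)[M _ hM].
exists (U (maxn N M)), (P (maxn N M)); split=> //.
  have := hM (maxn N M) (leq_maxr _ _); rewrite sub0r normrN.
  by move=> /(le_lt_trans (ler_norm _)).
exact: hN (leq_maxl _ _).
Qed.

Lemma gradc_form_approx u p : gradc u p ->
  exists F (P : nat -> L2space G), [/\ form_approx F (l2 u),
    forall n, l2 (P n) = grad (F n) & ip_cvg ip P p].
Proof.
move=> up.
have /choice[UP hUP] : forall n : nat, exists z : L2space G * L2space G,
    [/\ l2 z.2 = grad (l2 z.1), grad0 z.1 z.2,
      ip (z.1 - u) (z.1 - u) < n.+1%:R^-1 & ip (z.2 - p) (z.2 - p) < n.+1%:R^-1].
  move=> n; have n0 : 0 < n.+1%:R^-1 :> R by rewrite invr_gt0.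
  have [f [g [fg fu gp]]] := up _ n0; have [df _] := fg.
  (* The form uses [grad] itself, while [g] agrees with it only inside the edges; [g'] agrees
     everywhere and differs from [g] by a null function. *)
  have [f' [g' [/l2_inj ff gg fg']]] := grad0_exists df; rewrite ff in fg'.
  exists (f, g'); split; [exact: gg|exact: fg'|exact: fu|].
  change (ip (g' - p) (g' - p) < n.+1%:R^-1); have -> : g' - p = (g' - g) + (g - p) by rewrite addrA subrK.
  by rewrite ip_add_null//; exact: grad0_null fg' fg.
pose P n := (UP n).2; pose U n := (UP n).1.
have small (e : R) : 0 < e -> exists N : nat, forall n : nat, (N <= n)%N ->
    n.+1%:R^-1 < e.
  move=> e0; exists (Num.Def.truncn e^-1) => n hn.
  rewrite invf_plt ?posrE ?ltr0Sn//.
  by have := truncnS_gt e^-1; move=> /lt_le_trans; apply; rewrite ler_nat.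
have Pp : ip_cvg ip P p.
  move=> e e0; have [N hN] := small e e0; exists N => n /hN.
  by apply: lt_trans; have [_ _ _ h] := hUP n; exact: h.
exists (fun n => l2 (U n)), P; split=> //; last by move=> n; case: (hUP n).
split.
- by move=> n; have [_ []] := hUP n.
- under eq_fun do rewrite normsqB.
  apply: cvg_EFin; first exact: nearW.
  apply/cvgrPdist_lt => e e0; have [N hN] := small e e0.
  exists N => // n /= /hN nN; rewrite sub0r normrN ger0_norm ?(ip_ge0 sip)//.
  by apply: lt_trans nN; have [_ _ h _] := hUP n; exact: h.
- move=> e e0; have e4 : 0 < e / 4 by rewrite divr_gt0.
  have [N hN] := Pp _ e4; exists N => m n Nm Nn; rewrite -l2B.
  have h k : grad0 (U k) (P k) by case: (hUP k).
  rewrite (grad0_energy (grad0_sub (h m) (h n))) lte_fin.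
  have -> : P m - P n = (P m - p) + - (P n - p) by rewrite opprB addrA subrK.
  apply: le_lt_trans (ip_normD sip _ _) _; rewrite (ipNl sip) (ipNr sip) opprK.
  exact: lt_quarters (hN m Nm) (hN n Nn).
Qed.

Lemma ip_cvg_l2i P p : ip_cvg ip P p -> ip_cvg ip (fun n => l2i (P n)) (l2i p).
Proof.
by move=> h e e0; have [N hN] := h e e0; exists N => n /hN; rewrite -l2iB ip_l2i_l2i.
Qed.

Lemma form_cvg F F' (P Q : nat -> L2space G) p q :
  (forall n, l2 (P n) = grad (F n)) -> (forall n, l2 (Q n) = grad (F' n)) ->
  ip_cvg ip P p -> ip_cvg ip Q q ->
  (fun n => complex.Re (Defs.form (F n) (F' n))) @ \oo --> ip p q /\
  (fun n => complex.Im (Defs.form (F n) (F' n))) @ \oo --> ip p (l2i q).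
Proof.
move=> PF QF Pp Qq; split.
  rewrite (_ : (fun n => _) = (fun n => ip (P n) (Q n))).
    exact (ip_cvg_lim sip Pp Qq).
  by apply/funext => n; rewrite /ip2 PF QF.
rewrite (_ : (fun n => _) = (fun n => ip (P n) (l2i (Q n)))).
  exact (ip_cvg_lim sip Pp (ip_cvg_l2i Qq)).
by apply/funext => n; rewrite ip_l2i PF QF.
Qed.

(** [form_op] records the real part of the defining identity; the imaginary part is the same
    identity tested with ['i v], which also lies in the form domain. *)
Lemma kirchhoffP u w : kirchhoff (l2 u) (l2 w) <-> form_op ip gradc u w.
Proof.
split=> [[[_ [F0 hF0]] _ h]|[[p up] h]].
  split; first by have [P [p []]] := form_approx_gradc hF0; exists p.
  move=> p v q up vq.
  have [F [P [uF PF Pp]]] := gradc_form_approx up.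
  have [F' [Q [vF QF Qq]]] := gradc_form_approx vq.
  have [cr ci] := form_cvg PF QF Pp Qq.
  have dv : closed_form_dom (l2 v) by split; [exact: l2P|exists F'].
  have cf : closed_form (l2 u) (l2 v) (ip p q +i* ip p (l2i q)).
    by exists F, F'; split; [exact: uF|exact: vF|exact: cr|exact: ci].
  exact: (congr1 (@complex.Re R) (h _ _ dv cf)).
split.
- by split; [exact: l2P|have [F [P []]] := gradc_form_approx up; exists F].
- exact: l2P.
move=> v0 c [L2v _] [F [F' [uF vF cr ci]]].
have [v vE] := L2_l2 L2v; rewrite -vE in vF *.
have [P [p' [PF Pp up']]] := form_approx_gradc uF.
have [Q [q [QF Qq vq]]] := form_approx_gradc vF.
have [cr' ci'] := form_cvg PF QF Pp Qq.
apply: eq_parts.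
  rewrite -/(ip w v) -(h _ _ _ up' vq); exact: cvg_unique cr cr'.
rewrite -ip_l2i -(h _ _ _ up' (gradc_i vq)); exact: cvg_unique ci ci'.
Qed.

End Kirchhoff.

(** * Spectral bounds from test functions *)

Section SpectralBounds.
Variables (R : realType) (G : metric_graph R).
Implicit Types f g h : gfun G.
Implicit Types u v w p q : L2space G.
Local Notation ip := (@ip2 R G).
Local Notation gradc := (@gradc R G).
Let sip := @semi_inner_L2 R G.

Lemma l2_scale_add (x : R) u (g : L2space G) :
  l2 (x *: u + g) = fun e t => x%:C * l2 u e t + l2 g e t.
Proof. by rewrite l2D l2Z. Qed.

(** Read contrapositively, it places every real point where [rho] fails in the spectrum. *)
Lemma rho_resolvent (x : R) : resolvent_set G x%:C -> rho ip gradc x.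
Proof.
move=> [hs [C hC]]; split.
  move=> g; have [u0 k] := hs (l2 g) (l2P g).
  have [[L2u _] _ _] := k; have [u uE] := L2_l2 L2u.
  by exists u; apply/kirchhoffP; rewrite l2_scale_add uE.
exists C => u g /kirchhoffP; rewrite l2_scale_add => /hC.
by rewrite !normsq_l2 -EFinM lee_fin.
Qed.

Lemma grad0_gradc u p : grad0 u p -> gradc u p.
Proof.
move=> up e e0; exists u, p; have z v : ip (v - v) (v - v) = 0.
  by rewrite subrr (ip0l sip).
by split=> //; rewrite z.
Qed.

Lemma lambda0_le (c : R) f : dom_H0 f -> (0 < normsq f)%E ->
  (energy f <= c%:E * normsq f)%E -> (lambda0 G <= c%:E)%E.
Proof.
move=> /grad0_exists[u [p [<- pE up]]].
rewrite (grad0_energy up) normsq_l2 lte_fin -EFinM lee_fin => u0 uc.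
have [l lr lle] := rho_le_rayleigh sip (@gradcD R G) (@gradcZ R G) (grad0_gradc up) u0.
apply: (@le_trans _ _ l%:E).
  by apply: ereal_inf_lbound; exists l => //; move=> /rho_resolvent.
by rewrite lee_fin (le_trans lle)// ler_pdivrMr.
Qed.

Lemma ip2_disjoint u v :
  (forall e, (forall x, l2 u e x = 0) \/ (forall x, l2 v e x = 0)) -> ip u v = 0.
Proof.
move=> uv; rewrite /ip2 ReInner; try exact: l2P.
have E e : eip (l2 u) (l2 v) e = 0.
  rewrite /eip /cip /sqip /Rintegral !integral0_eq ?addr0// => x _.
    by case: (uv e) => ->; rewrite /= ?mul0r ?mulr0.
  by case: (uv e) => ->; rewrite /= ?mul0r ?mulr0.
rewrite (_ : eip _ _ = fun=> 0); last exact/funext.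
by rewrite rsum_ge0E// esum1.
Qed.

Lemma gradc_sum n (c : 'I_n.+1 -> R) (U P : 'I_n.+1 -> L2space G) :
  (forall i, gradc (U i) (P i)) ->
  gradc (\sum_i c i *: U i) (\sum_i c i *: P i).
Proof.
move=> h; elim/big_ind2 : _ => [|u p v q|i _]; last exact: gradcZ.
  by have := gradcZ 0 (h ord0); rewrite !scale0r.
exact: gradcD.
Qed.

Lemma ip_sum_orthogonal n (c : 'I_n -> R) (U : 'I_n -> L2space G) :
  (forall i j, i != j -> ip (U i) (U j) = 0) ->
  ip (\sum_i c i *: U i) (\sum_i c i *: U i) = \sum_i c i ^+ 2 * ip (U i) (U i).
Proof.
move=> h; rewrite (ip_sum sip); apply: eq_bigr => i _.
rewrite (ipC sip) (ip_sum sip) (bigD1 i)//= big1 ?addr0 => [|j ji].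
  by rewrite mulrA expr2.
by rewrite h// mulr0.
Qed.

Lemma kernel_vector n m (M : 'M[R]_(n, m)) : (m < n)%N ->
  exists c : 'I_n -> R, (exists i, c i != 0) /\
    forall j, \sum_i c i * M i j = 0.
Proof.
move=> mn; have : kermx M != 0.
  rewrite kermx_eq0 /row_free; apply/eqP => h.
  by have := rank_leq_col M; rewrite h leqNgt mn.
move=> /eqP k0.
have [i ki] : exists i, row i (kermx M) <> 0.
  apply: contrapT => h; apply: k0; apply/row_matrixP => i; rewrite row0.
  by apply: contrapT => ki; apply: h; exists i.
exists (fun j => kermx M i j); split.
  apply: contrapT => h; apply: ki; apply/rowP => j; rewrite [LHS]mxE [RHS]mxE.
  by apply: contrapT => /eqP kj; apply: h; exists j.
by move=> j; have := mulmx_ker M => /matrixP/(_ i j); rewrite !mxE.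
Qed.

(* Test functions with disjoint supports are orthogonal, also for the form; a
   combination of [n + 1] of them is orthogonal to [n] given vectors. *)
Lemma lambda0_ess_le (c : R) :
  (forall S : {fset edge G}, exists f (A : {fset edge G}),
    [/\ dom_H0 f, forall e x, e \notin A -> f e x = 0, [disjoint A & S]%fset,
      (0 < normsq f)%E & (energy f <= c%:E * normsq f)%E]) ->
  (lambda0_ess G <= c%:E)%E.
Proof.
move=> tests.
have /choice[F hF] : forall S : {fset edge G}, exists z : L2space G * L2space G * {fset edge G},
    [/\ grad0 z.1.1 z.1.2, forall e x, e \notin z.2 -> l2 z.1.1 e x = 0,
     forall e x, e \notin z.2 -> l2 z.1.2 e x = 0, [disjoint z.2 & S]%fset &
     0 < ip z.1.1 z.1.1 /\ ip z.1.2 z.1.2 <= c * ip z.1.1 z.1.1].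
  move=> S; have [f [A [df fA AS f0 fc]]] := tests S.
  have [u [p [uf pf up]]] := grad0_exists df; exists (u, p, A); split.
  - exact: up.
  - by rewrite /= uf.
  - move=> e x eA; rewrite /= pf /grad !derive1E.
    have E (P : R[i] -> R) : (fun t => P (f e t)) = cst (P 0).
      by apply/funext => t; rewrite fA.
    rewrite (E (@complex.Re R)) (E (@complex.Im R)).
    by rewrite !derive_cst.
  - exact: AS.
  - rewrite -uf normsq_l2 lte_fin (grad0_energy up) -EFinM lee_fin in f0 fc.
    by split.
(* [S k] accumulates the supports chosen so far, and the next one is taken outside it. *)
pose S k := iter k (fun T => T `|` (F T).2)%fset fset0.
pose u k := (F (S k)).1.1; pose p k := (F (S k)).1.2.
have SS k j : (j <= k)%N -> (S j `<=` S k)%fset.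
  elim: k => [|k IH]; first by rewrite leqn0 => /eqP ->.
  rewrite leq_eqVlt => /predU1P[->//|]; rewrite ltnS => /IH h.
  by rewrite (fsubset_trans h)//= fsubsetUl.
have disj j k e : (j < k)%N -> (e \notin (F (S j)).2) \/ (e \notin (F (S k)).2).
  move=> jk; have [eS|eS] := boolP (e \in S k).
    right; have [_ _ _ /fdisjointP_sym h _] := hF (S k); exact: h.
  left; apply: contra eS => eF; have := SS k j.+1 jk; move=> /fsubsetP; apply.
  by rewrite /= inE eF orbT.
have disjn j k e : j != k -> (e \notin (F (S j)).2) \/ (e \notin (F (S k)).2).
  by case: ltngtP => // jk _; [exact: disj|case: (disj k j e jk); [right|left]].
have uu j k : j != k -> ip (u j) (u k) = 0.
  move=> jk; apply: ip2_disjoint => e; case: (disjn _ _ e jk) => h; [left|right] => x.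
    by have [_ + _ _ _] := hF (S j); apply.
  by have [_ + _ _ _] := hF (S k); apply.
have pp j k : j != k -> ip (p j) (p k) = 0.
  move=> jk; apply: ip2_disjoint => e; case: (disjn _ _ e jk) => h; [left|right] => x.
    by have [_ _ + _ _] := hF (S j); apply.
  by have [_ _ + _ _] := hF (S k); apply.
have up k : gradc (u k) (p k) by apply: grad0_gradc; case: (hF (S k)).
have [u0 pu] : (forall k, 0 < ip (u k) (u k)) /\
    forall k, ip (p k) (p k) <= c * ip (u k) (u k).
  by split=> k; case: (hF (S k)) => _ _ _ _ [].
have [|l [lc lr ld]] := essential_le_rayleigh sip (@L2_complete R G)
    (@gradcD R G) (@gradcZ R G) (c := c).
  move=> V; set n := size V.
  pose M : 'M[R]_(n.+1, n) := \matrix_(i, j) ip (u i) (nth 0 V j).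
  have [a [[i0 ai0] aM]] := kernel_vector M (ltnSn n).
  exists (\sum_(i < n.+1) a i *: u i), (\sum_(i < n.+1) a i *: p i); split.
  - by apply: gradc_sum.
  - move=> v vV; rewrite (ip_sum sip).
    have iv : (index v V < n)%N by rewrite index_mem.
    rewrite -[RHS](aM (Ordinal iv)); apply: eq_bigr => i _.
    by rewrite mxE /= nth_index.
  - rewrite ip_sum_orthogonal => [|i j ij]; last exact: uu.
    rewrite (bigD1 i0)//= ltr_pwDl//.
      by rewrite mulr_gt0// lt_def sqrf_eq0 ai0 sqr_ge0.
    by apply: sumr_ge0 => i _; rewrite mulr_ge0 ?sqr_ge0// ltW.
  - rewrite !ip_sum_orthogonal => [|i j ij|i j ij]; [|exact: uu|exact: pp].
    rewrite mulr_sumr; apply: ler_sum => i _.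
    by rewrite mulrCA ler_wpM2l ?sqr_ge0.
apply: (@le_trans _ _ l%:E); last by rewrite lee_fin.
apply: ereal_inf_lbound; exists l => //; split; first by move=> /rho_resolvent.
move=> [[e0 e00 hiso] _ [n [b [hb hspan]]]].
have /choice[b' hb'] : forall i, exists z, l2 z = b i.
  by move=> i; apply: L2_l2; case: (hb i) => -[].
(* The eigenspace is spanned over the complex numbers; real orthogonality to each [b' i] and to ['i]
   times [b' i] is complex orthogonality to the span. *)
apply: (ld e0 ([seq b' i | i <- enum 'I_n] ++ [seq l2i (b' i) | i <- enum 'I_n]) e00).
  move=> z /andP[z0 ze]; apply: contrapT => zr.
  have := hiso z%:C (fun rz => zr (rho_resolvent rz)).
  have -> : `|z%:C - l%:C| = `|z - l|%:C by rewrite -rmorphB normc_def/= expr0n/= addr0 sqrtr_sqr.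
  rewrite ltcR => /(_ ze) []zl; move: z0; rewrite zl subrr normr0 ltxx//.
move=> v vl x xb.
have [|a ha] := hspan (l2 v).
  change (kirchhoff (l2 v) (fun e t => l%:C * l2 v e t)); rewrite -l2Z.
  exact/kirchhoffP.
have xb1 i : ip x (b' i) = 0.
  apply: xb; rewrite mem_cat; apply/orP; left.
  by apply: map_f; rewrite mem_enum.
have xb2 i : ip x (l2i (b' i)) = 0.
  apply: xb; rewrite mem_cat; apply/orP; right.
  by apply: (map_f (fun i => l2i (b' i))); rewrite mem_enum.
pose w := \sum_i (complex.Re (a i) *: b' i + complex.Im (a i) *: l2i (b' i)).
have wE : l2 w = fun e t => \sum_(i < n) a i * b i e t.
  rewrite /w; apply/funext => e; apply/funext => t.
  elim/big_rec2 : _ => [//|i y z _ <-]; rewrite l2D l2D !l2Z l2iE hb'.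
  by congr (_ + _); apply: eq_parts; rewrite !partsE/=; ring.
have vw : ip (v - w) (v - w) = 0.
  by have := ha; rewrite -[fun e t => _]/(fun e t => l2 v e t - (fun e t => \sum_(i < n) a i * b i e t) e t) -wE normsqB => -[].
have xw : ip x w = 0.
  rewrite (ipC sip) /w; elim/big_rec : _ => [|i y _ IH]; first exact: (ip0l sip).
  rewrite (ipDl sip) IH addr0 (ipC sip) (ipDr sip) !(ipZr sip).
  by rewrite xb1 xb2 !mulr0 addr0.
have := ip_null sip x vw; rewrite (ipC sip) (ipDr sip) (ipNr sip) xw oppr0 addr0.
by [].
Qed.

End SpectralBounds.

(** * Test functions *)

Section Primitive.
Variable R : realType.
Local Notation mu := (@lebesgue_measure R).
Implicit Types f F g : R -> R.

Lemma is_derive_continuous F (x d : R) : is_derive x 1 F d -> {for x, continuous F}.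
Proof.
by move=> [dF _]; apply: differentiable_continuous; exact/derivable1_diffP.
Qed.

Lemma continuous_on_within F (l : R) :
  (forall x, 0 <= x <= l -> {for x, continuous F}) -> {within `[0, l], continuous F}.
Proof.
move=> cF; apply: continuous_in_subspaceT => x; rewrite inE/= in_itv/= => xl.
exact: cF.
Qed.

Lemma integral_primitive F f (x : R) : 0 <= x ->
  (forall t, 0 <= t <= x -> is_derive t 1 F (f t)) ->
  (forall t, 0 <= t <= x -> {for t, continuous f}) ->
  (\int[mu]_(t in `[0%R, x]) (f t)%:E)%E = (F x - F 0)%:E.
Proof.
rewrite le_eqVlt => /predU1P[<- _ _|x0 dF cf].
  by rewrite subrr set_itv1 integral_set1.
have cF t : 0 <= t <= x -> {for t, continuous F} by move=> /dF/is_derive_continuous.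
rewrite (@continuous_FTC2 _ _ F _ _ x0 (continuous_on_within cf)) ?EFinB//.
  split.
  - move=> t; rewrite in_itv/= => /andP[t0 tx].
    by apply: ex_derive; apply: dF; rewrite !ltW.
  - by apply: cvg_at_right_filter; apply: cF; rewrite lexx ltW.
  - by apply: cvg_at_left_filter; apply: cF; rewrite lexx ltW.
move=> t; rewrite in_itv/= => /andP[t0 tx]; rewrite derive1E.
by apply: derive_val; apply: dF; rewrite !ltW.
Qed.

Lemma sobolev2_real (l : R) f f1 f2 :
  (forall x, 0 <= x <= l -> is_derive x 1 f (f1 x)) ->
  (forall x, 0 <= x <= l -> is_derive x 1 f1 (f2 x)) ->
  (forall x, 0 <= x <= l -> {for x, continuous f2}) ->
  sobolev2 l (fun x => (f x)%:C) (fun x => (f1 x)%:C) (fun x => (f2 x)%:C).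
Proof.
move=> df df1 cf2.
have prim F g : (forall x, 0 <= x <= l -> is_derive x 1 F (g x)) ->
    (forall x, 0 <= x <= l -> {for x, continuous g}) ->
    forall x, 0 <= x <= l -> (F x)%:C = (F 0)%:C + cintegral `[0, x] (fun t => (g t)%:C).
  move=> dF cg x /andP[x0 xl].
  have sub t : 0 <= t <= x -> 0 <= t <= l.
    by move=> /andP[-> tx]; rewrite (le_trans tx).
  rewrite /cintegral; apply: eq_parts; rewrite partsE /=.
    rewrite /Rintegral (integral_primitive x0 (fun t tx => dF t (sub t tx))).
      by rewrite /= addrC subrK.
    by move=> t /sub; exact: cg.
  by rewrite /Rintegral integral0_eq// addr0.
have s2 : sqc l (fun x => (f2 x)%:C).
  split; apply: within_continuous_sqint; last by move=> x; exact: cvg_cst.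
  exact: continuous_on_within.
have [m n] := (sqcP _ _).1 s2; split=> //; apply: prim => //.
by move=> x /df1/is_derive_continuous.
Qed.

End Primitive.

(* The profile on an edge of length [L]: with [v x = sin (b + k x)] the optimal
   test function, [h = (1 + d) v ^ 2 / (v + d)] also has vanishing derivative where
   [v = 0], and satisfies [|h'| <= (1 + d) |v'|] and [h ^ 2 >= v ^ 2 - 2 d]. *)
Section Profile.
Variables (R : realType) (L b k d : R).
Implicit Types x y : R.
Hypothesis L0 : 0 < L.
Hypothesis d0 : 0 < d.
Hypothesis hv : forall x, 0 <= x <= L -> 0 <= b + k * x <= pi.
Hypothesis hend : sin b * cos b = 0 /\ sin (b + k * L) * cos (b + k * L) = 0.
Hypothesis hk : k = 0 -> sin b = 1.
Local Notation mu := (@lebesgue_measure R).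

Let v (x : R) := sin (b + k * x).
Let c (x : R) := cos (b + k * x).
Let r (x : R) := (v x + d)^-1.

Definition profile (x : R) := (1 + d) * (v x * v x * r x).
Definition profile1 (x : R) := (1 + d) * k * (c x * (2 * (v x * r x) - v x * v x * (r x * r x))).

Let v0 x : 0 <= x <= L -> 0 <= v x.
Proof. by move=> xL; apply: sin_ge0_pi; exact: hv. Qed.

Let vd x : 0 <= x <= L -> 0 < v x + d.
Proof. by move=> /v0 h; rewrite ltr_wpDl. Qed.

Let dlin x : is_derive x 1 (fun x => b + k * x) k.
Proof.
have -> : (fun x => b + k * x) = cst b + k *: id by [].
apply: (is_derive_eq (is_deriveD (is_derive_cst b x 1) (is_deriveZ k (is_derive_id x 1)))).
by rewrite add0r /GRing.scale/= mulr1.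
Qed.

Let dv x : is_derive x 1 v (k * c x).
Proof.
rewrite mulrC; apply: (@is_derive1_comp R (@sin R) (fun x => b + k * x)).
exact: dlin.
Qed.

Let dc x : is_derive x 1 c (- k * v x).
Proof.
rewrite mulNr mulrC -mulNr; apply: (@is_derive1_comp R (@cos R) (fun x => b + k * x)).
exact: dlin.
Qed.

Let dr x : 0 <= x <= L -> is_derive x 1 r (- k * (c x * (r x * r x))).
Proof.
move=> /vd xv; have h : is_derive x 1 (fun y => v y + d) (k * c x).
  by rewrite -[k * c x]addr0; exact: (is_deriveD (dv x) (is_derive_cst d x 1)).
apply: (is_derive_eq (@is_deriveV R (fun y => v y + d) x _ _ (lt0r_neq0 xv) h)).
by rewrite /r /GRing.scale/=; field; exact: lt0r_neq0.
Qed.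

Let mulE (f g : R -> R) (x df dg e : R) : is_derive x 1 f df -> is_derive x 1 g dg ->
  df * g x + f x * dg = e -> is_derive x 1 (fun y => f y * g y) e.
Proof.
move=> hf hg <-; rewrite [df * _]mulrC addrC; exact: is_deriveM.
Qed.

Let subE (f g : R -> R) (x df dg e : R) : is_derive x 1 f df -> is_derive x 1 g dg ->
  df - dg = e -> is_derive x 1 (fun y => f y - g y) e.
Proof. by move=> hf hg <-; exact: is_deriveB. Qed.

Let cstE (a : R) (f : R -> R) (x df e : R) : is_derive x 1 f df ->
  a * df = e -> is_derive x 1 (fun y => a * f y) e.
Proof. by move=> hf <-; exact: is_deriveZ. Qed.

Lemma profile_derive x : 0 <= x <= L -> is_derive x 1 profile (profile1 x).
Proof.
move=> xL; have hr := dr xL.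
apply: (cstE (mulE (mulE (dv x) (dv x) erefl) hr erefl)).
by rewrite /profile1; ring.
Qed.

Let profile2_ex : exists f2 : R -> R, forall x, 0 <= x <= L ->
  is_derive x 1 profile1 (f2 x) /\ {for x, continuous f2}.
Proof.
pose f2 (x : R) := (1 + d) * k * (- k * v x * (2 * (v x * r x) - v x * v x * (r x * r x)) +
  c x * (2 * (k * c x * r x + v x * (- k * (c x * (r x * r x)))) -
   ((k * c x * v x + v x * (k * c x)) * (r x * r x) + v x * v x *
    (- k * (c x * (r x * r x)) * r x + r x * (- k * (c x * (r x * r x))))))).
exists f2 => x xL; have hr := dr xL; have hv' := dv x; have hc := dc x; split.
  exact: (cstE (mulE hc (subE (cstE (mulE hv' hr erefl) erefl)
    (mulE (mulE hv' hv' erefl) (mulE hr hr erefl) erefl) erefl) erefl) erefl).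
have cv := is_derive_continuous hv'; have cc := is_derive_continuous hc.
have cr := is_derive_continuous hr.
have cm (f g : R -> R) : {for x, continuous f} -> {for x, continuous g} ->
  {for x, continuous (fun y => f y * g y)} by move=> ? ?; exact: cvgM.
have ca (f g : R -> R) : {for x, continuous f} -> {for x, continuous g} ->
  {for x, continuous (fun y => f y + g y)} by move=> ? ?; exact: cvgD.
have cn (f : R -> R) : {for x, continuous f} ->
  {for x, continuous (fun y => - f y)} by move=> ?; exact: cvgN.
have cst (a : R) : {for x, continuous (fun _ => a : R)} by exact: cvg_cst.
have vv := cm _ _ cv cv; have rr := cm _ _ cr cr.
have s1 := ca _ _ (cm _ _ (cst 2) (cm _ _ cv cr)) (cn _ (cm _ _ vv rr)).
have kc := cm _ _ (cst k) cc; have kr := cm _ _ (cst (- k)) (cm _ _ cc rr).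
have s2 := cm _ _ (cst 2) (ca _ _ (cm _ _ kc cr) (cm _ _ cv kr)).
have s3 := cm _ _ (ca _ _ (cm _ _ kc cv) (cm _ _ cv kc)) rr.
have s4 := cm _ _ vv (ca _ _ (cm _ _ kr cr) (cm _ _ cr kr)).
exact: (cm _ _ (cst ((1 + d) * k)) (ca _ _ (cm _ _ (cm _ _ (cst (- k)) cv) s1)
  (cm _ _ cc (ca _ _ s2 (cn _ (ca _ _ s3 s4)))))).
Qed.

Lemma profile_sobolev2 : exists f2, sobolev2 L (fun x => (profile x)%:C)
  (fun x => (profile1 x)%:C) (fun x => (f2 x)%:C).
Proof.
have [f2 hf2] := profile2_ex; exists f2; apply: sobolev2_real.
- exact: profile_derive.
- by move=> x /hf2[].
- by move=> x /hf2[].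
Qed.

Let vr x : 0 <= x <= L -> 0 <= v x * r x <= 1.
Proof.
move=> xL; have h2 := v0 xL; have h1 := vd xL.
by rewrite /r mulr_ge0 ?invr_ge0 ?(ltW h1)//= ler_pdivrMr// mul1r lerDl ltW.
Qed.

(** With [s = v / (v + d)] in [[0, 1]], the derivative is [(1 + d) k c (2 s - s^2)], and [2 s - s^2]
    stays in [[0, 1]]. *)
Lemma profile1_sq x : 0 <= x <= L -> profile1 x ^+ 2 <= ((1 + d) * k) ^+ 2 * c x ^+ 2.
Proof.
move=> xL; have /andP[s0 s1] := vr xL.
have -> : profile1 x ^+ 2 = ((1 + d) * k) ^+ 2 * c x ^+ 2 *
    (2 * (v x * r x) - (v x * r x) ^+ 2) ^+ 2 by rewrite /profile1; ring.
move: s0 s1; set s := v x * r x => s0 s1.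
apply: ler_piMr; first by apply: mulr_ge0; exact: sqr_ge0.
have t0 : 0 <= 2 * s - s ^+ 2 by nra.
have t1 : 2 * s - s ^+ 2 <= 1 by have := sqr_ge0 (s - 1); nra.
by rewrite expr_le1.
Qed.

(** [(1 + d) v^2 >= (v - d) (v + d)] gives [profile >= v - d], to be squared where [d <= v];
    elsewhere [v^2 <= v < d] makes the left side negative. *)
Lemma profile_sq x : 0 <= x <= L -> v x ^+ 2 - 2 * d <= profile x ^+ 2.
Proof.
move=> xL; have h1 := vd xL; have h2 := v0 xL; have h3 : v x <= 1 := sin_le1 _.
have hd := d0; rewrite /profile /r; move: h1 h2 h3; set s := v x => h1 h2 h3.
set q := (1 + d) * _.
have q0 : 0 <= q by rewrite /q !mulr_ge0 ?invr_ge0 ?(ltW h1)//; lra.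
have sq : s - d <= q.
  rewrite /q mulrA ler_pdivlMr//; have : 0 <= d * (s * s) by rewrite !mulr_ge0// ltW.
  by have := sqr_ge0 d; lra.
have ds : 0 <= d * (1 - s) by apply: mulr_ge0; [exact: ltW|rewrite subr_ge0].
have [h|h] := leP d s; last by have := sqr_ge0 q; nra.
have : (s - d) ^+ 2 <= q ^+ 2 by rewrite ler_pXn2r ?nnegrE ?subr_ge0.
by have := sqr_ge0 d; lra.
Qed.

Let cv_cont x : {for x, continuous (fun y => v y * v y)}.
Proof. by apply: cvgM; exact: is_derive_continuous (dv x). Qed.

Let cc_cont x : {for x, continuous (fun y => c y * c y)}.
Proof. by apply: cvgM; exact: is_derive_continuous (dc x). Qed.

Lemma sin_sq_integral :
  ((L / 2)%:E <= \int[mu]_(x in `[0%R, L]) (v x * v x)%:E)%E /\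
  (\int[mu]_(x in `[0%R, L]) (k ^+ 2 * (c x * c x))%:E = (k ^+ 2 * (L / 2))%:E)%E.
Proof.
(* A constant profile, as on an edge without boundary ends: the integral of [v^2] is then [L], which
   is why the first claim is an inequality. *)
have [k0|kn0] := eqVneq k 0.
  have v1 x : v x = 1 by rewrite /v k0 mul0r addr0 hk.
  have dV x : 0 <= x <= L -> is_derive x 1 id (v x * v x).
    by move=> _; rewrite v1 mulr1; exact: is_derive_id.
  have -> := @integral_primitive _ _ _ _ (ltW L0) dV (fun x _ => @cv_cont x).
  rewrite subr0 lee_fin; split; first by have := L0; rewrite /=; lra.
  by rewrite k0 expr0n/= mul0r integral0_eq// => x _; rewrite mul0r.
(* The primitives of [v^2] and [c^2] are [x / 2] plus or minus a multiple of [v c], which vanishes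
   at both ends. *)
have [e1 e2] := hend.
have cs x := cos2Dsin2 (b + k * x).
have dV x : 0 <= x <= L ->
    is_derive x 1 (fun x => 2^-1 * x - (2 * k)^-1 * (v x * c x)) (v x * v x).
  move=> _; apply: (subE (cstE (is_derive_id x 1) erefl)
    (cstE (mulE (dv x) (dc x) erefl) erefl)).
  have := cs x; rewrite -/(v x) -/(c x) => h.
  have -> : 2^-1 * 1 - (2 * k)^-1 * (k * c x * c x + v x * (- k * v x)) =
    2^-1 * (1 - (c x ^+ 2 - v x ^+ 2)) by field.
  by lra.
have dC x : 0 <= x <= L ->
    is_derive x 1 (fun x => k ^+ 2 * (2^-1 * x - - (2 * k)^-1 * (v x * c x)))
      (k ^+ 2 * (c x * c x)).
  move=> _; apply: (cstE (subE (cstE (is_derive_id x 1) erefl)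
    (cstE (mulE (dv x) (dc x) erefl) erefl) erefl)).
  have := cs x; rewrite -/(v x) -/(c x) => h; congr (_ * _).
  have -> : 2^-1 * 1 - - (2 * k)^-1 * (k * c x * c x + v x * (- k * v x)) =
    2^-1 * (1 + (c x ^+ 2 - v x ^+ 2)) by field.
  by lra.
have cC x : {for x, continuous (fun y => k ^+ 2 * (c y * c y))}.
  by apply: cvgM; [exact: cvg_cst|exact: cc_cont].
have -> := @integral_primitive _ _ _ _ (ltW L0) dV (fun x _ => @cv_cont x).
have -> := @integral_primitive _ _ _ _ (ltW L0) dC (fun x _ => @cC x).
rewrite /v /c !mulr0 addr0 e1 e2 !mulr0 !subr0; split.
  by rewrite lee_fin mulrC.
by rewrite mulr0 subr0 [L / 2]mulrC.
Qed.

End Profile.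

(** * The test function on one edge *)

Section EdgeTest.
Variable R : realType.
Local Notation mu := (@lebesgue_measure R).

Lemma normsq_on_real (L : R) (f : R -> R) :
  normsq_on L (fun x => (f x)%:C) = (\int[mu]_(x in `[0%R, L]) (f x ^+ 2)%:E)%E.
Proof. by apply: eq_integral => x _; rewrite /sqmod/= expr0n addr0. Qed.

(** [a] and [b] mark the boundary ends. A plain sine would vanish there with nonzero slope, which
    the form tolerates; but [dom_H0] imposes the Kirchhoff condition also at boundary vertices
    outside [dirichlet]. With zero slope at both ends the edges can be glued independently, at a
    cost controlled by [d]. *)
Lemma edge_test (L d : R) (a b : bool) : 0 < L -> 0 < d ->
  exists h h1 h2 : R -> R[i],
  [/\ sobolev2 L h h1 h2, h 0 = (~~ a)%:R, h L = (~~ b)%:R, h1 0 = 0 /\ h1 L = 0 &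
   ((L / 2)%:E <= normsq_on L h + (2 * d * L)%:E)%E /\
   (normsq_on L h1 <= ((1 + d) ^+ 2 * pi ^+ 2 / (4 * L) * (a + b)%:R)%:E)%E].
Proof.
move=> L0 d0; have p0 := pi_gt0 R.
(* The phase runs from [B] to [C], a quarter period per boundary end, so that
   [k L = (a + b) pi / 2]. *)
pose B : R := if a then 0 else pi / 2; pose C : R := if b then pi else pi / 2.
pose k := (C - B) / L.
have BkL : B + k * L = C by rewrite /k divfK ?gt_eqF// addrC subrK.
have CB : 0 <= C - B by rewrite /B /C; case: (a); case: (b); lra.
have k0 : 0 <= k by rewrite divr_ge0 ?(ltW L0).
have B0 : 0 <= B by rewrite /B; case: (a); lra.
have Cp : C <= pi by rewrite /C; case: (b); lra.
have hv (x : R) : 0 <= x <= L -> 0 <= B + k * x <= pi.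
  move=> /andP[x0 xL]; apply/andP; split.
    by apply: addr_ge0 => //; exact: mulr_ge0.
  by rewrite (le_trans _ Cp)// -BkL lerD2l ler_wpM2l.
have eB : sin B * cos B = 0 /\ (sin B = (~~ a)%:R /\ (if a then true else cos B == 0)).
  by rewrite /B; case: (a); rewrite ?sin0 ?sin_pihalf ?cos_pihalf ?eqxx /= ?mul0r ?mulr0//.
have eC : sin C * cos C = 0 /\ (sin C = (~~ b)%:R /\ (if b then true else cos C == 0)).
  by rewrite /C; case: (b); rewrite ?sinpi ?sin_pihalf ?cos_pihalf ?eqxx /= ?mul0r ?mulr0//.
have hend : sin B * cos B = 0 /\ sin (B + k * L) * cos (B + k * L) = 0.
  by rewrite BkL; split; [case: eB|case: eC].
have hk : k = 0 -> sin B = 1.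
  move=> /eqP; rewrite mulf_eq0 invr_eq0 (gt_eqF L0) orbF subr_eq0 => /eqP CBE.
  move: CBE; rewrite /B /C; case: (a); case: (b); rewrite ?sin_pihalf//; lra.
have [f2 hs] := profile_sobolev2 d0 hv.
have [hB [sB cB]] := eB; have [hC [sC cC]] := eC.
exists (fun x => (profile B k d x)%:C), (fun x => (profile1 B k d x)%:C), (fun x => (f2 x)%:C).
split; first exact: hs.
- by rewrite /profile mulr0 addr0 sB; case: (a); congr (_ %:C);
    rewrite ?mul0r ?mulr0// !mul1r addrC mulfV// gt_eqF//; lra.
- by rewrite /profile BkL sC; case: (b); congr (_ %:C);
    rewrite ?mul0r ?mulr0// !mul1r addrC mulfV// gt_eqF//; lra.
- rewrite /profile1 mulr0 addr0 BkL; split; congr (_ %:C).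
    by move: cB; rewrite sB; case: (a) => [_|/eqP ->]; rewrite !(mul0r, mulr0, subr0).
  by move: cC; rewrite sC; case: (b) => [_|/eqP ->]; rewrite !(mul0r, mulr0, subr0).
have [I1 I2] := sin_sq_integral L0 hend hk.
have xL0 (x : R) : `[0%R, L]%classic x -> 0 <= x <= L by rewrite /= in_itv.
have mD := @measurable_cc R 0 L.
have [[mp _] _] := sobolev2_sqc L0 hs; have [[mp1 _] _] := sobolev2_sqc1 L0 hs.
have lin_cont (x : R) : {for x, continuous (fun x => B + k * x)}.
  apply: (@cvgD _ _ _ _ _ (fun _ => B) (fun x => k * x)); first exact: cvg_cst.
  by apply: (@cvgM _ _ _ _ (fun _ => k) (fun x => x)); [exact: cvg_cst|exact: cvg_id].
have ms : measurable_fun `[0, L] (fun x => sin (B + k * x)).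
  apply: subspace_continuous_measurable_fun => //; apply: continuous_on_within => x _.
  by apply: continuous_comp; [exact: lin_cont|exact: continuous_sin].
have mc : measurable_fun `[0, L] (fun x => cos (B + k * x)).
  apply: subspace_continuous_measurable_fun => //; apply: continuous_on_within => x _.
  by apply: continuous_comp; [exact: lin_cont|exact: continuous_cos].
split.
  apply: (le_trans I1); rewrite normsq_on_real.
  have -> : (2 * d * L)%:E = (\int[mu]_(x in `[0%R, L]) (2 * d)%:E)%E.
    rewrite integral_cst// EFinM; congr (_ * _)%E; apply: esym.
    by have := lebesgue_measure_itv `[0%R, L]; rewrite /= lte_fin L0 -EFinB subr0.
  have d20 : 0 <= 2 * d by lra.
  rewrite -ge0_integralD//.
  - apply: ge0_le_integral => //.
    + by move=> x _; rewrite lee_fin -expr2 sqr_ge0.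
    + by apply/measurable_EFinP; exact: measurable_funM.
    + apply: emeasurable_funD => //; apply/measurable_EFinP; exact: measurable_funX mp.
    + move=> x /xL0 xL; rewrite -EFinD lee_fin.
      by have := profile_sq d0 hv xL; lra.
  - by move=> x _; rewrite lee_fin sqr_ge0.
  - by apply/measurable_EFinP; exact: measurable_funX mp.
rewrite normsq_on_real.
apply: (@le_trans _ _ (\int[mu]_(x in `[0%R, L]) (((1 + d) ^+ 2)%:E *
    (k ^+ 2 * (cos (B + k * x) * cos (B + k * x)))%:E))%E).
  apply: ge0_le_integral => //.
  - by move=> x _; rewrite lee_fin sqr_ge0.
  - by apply/measurable_EFinP; exact: measurable_funX mp1.
  - apply: measurable_funeM; apply/measurable_EFinP.
    by apply: measurable_funM => //; exact: measurable_funM.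
  - move=> x /xL0 xL; rewrite -EFinM lee_fin.
    by have := profile1_sq d0 hv xL; lra.
rewrite ge0_integralZl//; last 3 first.
- by apply/measurable_EFinP; apply: measurable_funM => //; exact: measurable_funM.
- by move=> x _; rewrite lee_fin mulr_ge0 ?sqr_ge0// -expr2 sqr_ge0.
- by rewrite lee_fin sqr_ge0.
rewrite I2 -EFinM lee_fin.
have [Ln0 kE] : L != 0 /\ k = (a + b)%:R * pi / (2 * L).
  split; first exact: lt0r_neq0.
  by rewrite /k /B /C; case: (a); case: (b) => /=; field; exact: lt0r_neq0.
have -> : k ^+ 2 * (L / 2) = (a + b)%:R ^+ 2 / 2 * (pi ^+ 2 / (4 * L)).
  by rewrite kE; field.
have -> : (1 + d) ^+ 2 * pi ^+ 2 / (4 * L) * (a + b)%:R =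
  (1 + d) ^+ 2 * ((a + b)%:R * (pi ^+ 2 / (4 * L))) by field.
apply: ler_wpM2l; first exact: sqr_ge0.
apply: ler_wpM2r; first by rewrite divr_ge0 ?sqr_ge0// mulr_ge0// ltW.
(* [(a + b)^2 <= 2 (a + b)], with equality unless exactly one end is on the boundary, turns the
   energy of the sine into a cost per boundary end. *)
by case: (a); case: (b) => /=; lra.
Qed.

End EdgeTest.

(** * The test function on a finite subgraph *)

Section TestFunction.
Variables (R : realType) (G : metric_graph R).
Implicit Types (e : edge G) (a : vertex G) (Y : fin_subgraph G) (f : gfun G).

Lemma org_neq_dst e : org e != dst e.
Proof. by move: e; case: G. Qed.

Lemma finite_incident a : finite_set [set e : edge G | incident a e].
Proof. by move: a; case: G. Qed.

Lemma mem_star a e : (e \in star a) = incident a e.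
Proof. by rewrite (in_fset_set (finite_incident a)); apply/idP/idP; rewrite inE. Qed.

Lemma sedges_sverts Y e : e \in sedges Y -> (org e \in sverts Y) && (dst e \in sverts Y).
Proof. by case: Y => ? ? h /h. Qed.

Lemma sub_degree_sum Y a :
  sub_degree Y a = (\sum_(e <- sedges Y) incident a e)%N.
Proof.
rewrite /sub_degree -sum1_size -big_fset_condE/= big_mkcond/=.
by apply: eq_bigr => e _; case: (incident a e).
Qed.

(** Double counting of incidences; as no edge is a loop, an edge counts once for each of its
    boundary ends. *)
Lemma deg_boundary_sum Y : deg_boundary Y =
  (\sum_(e <- sedges Y) ((org e \in boundary Y) + (dst e \in boundary Y)))%N.
Proof.
rewrite /deg_boundary; under eq_bigr do rewrite sub_degree_sum.
rewrite exchange_big/=; apply: eq_bigr => e _.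
have mem a : (\sum_(b <- boundary Y) (b == a) = (a \in boundary Y))%N.
  rewrite -[RHS](count_uniq_mem _ (fset_uniq _)) -sum1_count [RHS]big_mkcond/=.
  by apply: eq_bigr => b _; rewrite eq_sym; case: (b == a).
rewrite -!mem -big_split/=; apply: eq_bigr => b _; rewrite /incident.
by case: (eqVneq b (org e)) => [->|//]; rewrite (negPf (org_neq_dst e)).
Qed.

(** Makes the extension by zero continuous: an edge outside [Y] can meet [Y] only at boundary
    vertices, where the test function vanishes. *)
Lemma full_degree Y a : a \in sverts Y -> a \notin boundary Y ->
  forall e, incident a e -> e \in sedges Y.
Proof.
move=> aY; rewrite !inE aY/= negb_or -leqNgt => /andP[_ ad] e ae.
have sub : ([fset e in sedges Y | incident a e] `<=` star a)%fset.
  by apply/fsubsetP => e'; rewrite !inE/= mem_star => /andP[].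
have /eqP E : [fset e in sedges Y | incident a e]%fset == star a.
  by rewrite eqEfcard sub.
by have := mem_star a e; rewrite ae -E !inE => /andP[].
Qed.

Lemma normsq_support (A : {fset edge G}) f : (forall e x, e \notin A -> f e x = 0) ->
  normsq f = (\sum_(e <- A) normsq_on (len e) (f e))%E.
Proof.
move=> f0; have ge0 e : (0 <= normsq_on (len e) (f e))%E.
  by apply: integral_ge0 => x _; rewrite lee_fin addr_ge0// sqr_ge0.
rewrite -(set_fsetK A) -fsbig_finite//= -esum_fset//.
rewrite [RHS]esum_mkcond; apply: eq_esum => e _; case: ifPn => //.
rewrite notin_setE => /= /negP eA; apply: integral0_eq => x _.
by rewrite f0// /sqmod/= expr0n addr0.
Qed.

Lemma test_function_approx Y (d : R) : 0 < d -> exists f : gfun G,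
  [/\ dom_H0 f, forall e x, e \notin sedges Y -> f e x = 0,
    ((mes Y / 2)%:E <= normsq f + (2 * d * mes Y)%:E)%E &
    (energy f <= (\sum_(e <- sedges Y) ((1 + d) ^+ 2 * pi ^+ 2 / (4 * len e) *
      ((org e \in boundary Y) + (dst e \in boundary Y))%:R))%:E)%E].
Proof.
move=> d0.
have /choice[h hh] : forall e, exists h : (R -> R[i]) * (R -> R[i]) * (R -> R[i]),
    [/\ sobolev2 (len e) h.1.1 h.1.2 h.2, h.1.1 0 = (org e \notin boundary Y)%:R,
      h.1.1 (len e) = (dst e \notin boundary Y)%:R, h.1.2 0 = 0 /\ h.1.2 (len e) = 0 &
     ((len e / 2)%:E <= normsq_on (len e) h.1.1 + (2 * d * len e)%:E)%E /\
     (normsq_on (len e) h.1.2 <= ((1 + d) ^+ 2 * pi ^+ 2 / (4 * len e) *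
       ((org e \in boundary Y) + (dst e \in boundary Y))%:R)%:E)%E].
  move=> e; have [k [k1 [k2 hk]]] :=
    edge_test (org e \in boundary Y) (dst e \in boundary Y) (len_gt0 e) d0.
  by exists (k, k1, k2).
pose f : gfun G := fun e x => if e \in sedges Y then (h e).1.1 x else 0.
pose f1 : gfun G := fun e x => if e \in sedges Y then (h e).1.2 x else 0.
pose f2 : gfun G := fun e x => if e \in sedges Y then (h e).2 x else 0.
have f0 e x : e \notin sedges Y -> f e x = 0 by rewrite /f => /negPf ->.
have f10 e x : e \notin sedges Y -> f1 e x = 0 by rewrite /f1 => /negPf ->.
have s0 (l : R) : sobolev2 l (fun _ => 0) (fun _ => 0) (fun _ => 0).
  have c0 (x : R) : cintegral `[0, x] (fun _ : R => 0) = 0 :> R[i].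
    by rewrite /cintegral /Rintegral/= integral0_eq.
  split; first by split; exact: measurable_cst.
  - have -> : normsq_on l (fun _ => 0) = 0%E; last exact: ltry.
    by apply: integral0_eq => x _; rewrite /sqmod/= expr0n addr0.
  - by move=> x _; rewrite c0 addr0.
  - by move=> x _; rewrite c0 addr0.
have fs e : sobolev2 (len e) (f e) (f1 e) (f2 e).
  rewrite /f /f1 /f2; case: (e \in sedges Y); last exact: s0.
  by have [] := hh e.
have end0 e : f1 e 0 = 0 /\ f1 e (len e) = 0.
  by rewrite /f1; case: ifP => // _; have [_ _ _ []] := hh e.
have trY a e : incident a e -> e \in sedges Y -> trace f a e = (a \notin boundary Y)%:R.
  move=> ae eY; rewrite /trace /f eY; have [_ h0 hl _ _] := hh e.
  by move: ae; rewrite /incident; case: eqP => [-> _|_ /= /eqP ->].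
have trN a e : e \notin sedges Y -> trace f a e = 0.
  by move=> eY; rewrite /trace !f0// if_same.
have incY a e : incident a e -> e \in sedges Y -> a \in sverts Y.
  by move=> ae /sedges_sverts/andP[ho hd]; case/orP: ae => /eqP ->.
have df : dom_H0 f.
  exists f1, f2; split=> //.
  - apply: (@sub_finite_set _ _ [set` sedges Y]) => // e [x _ /eqP fx] /=.
    by apply: contrapT => /negP eY; apply: fx; exact: f0.
  - move=> a aD e ae; have [eY|/trN->//] := boolP (e \in sedges Y).
    by rewrite trY// !inE (incY a e)//= aD.
  - move=> a aD e e' ae ae'.
    (* The trace depends on the vertex alone: 1 at interior vertices of [Y], 0 at all others,
       whether or not the edge lies in [Y]. *)
    have T k : incident a k -> trace f a k = ((a \in sverts Y) && (a \notin boundary Y))%:R.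
      move=> ak; have [kY|kY] := boolP (k \in sedges Y).
        by rewrite trY// (incY a k).
      rewrite trN//; case: andP => // -[aY aB].
      by move: kY; rewrite (full_degree aY aB ak).
    by rewrite !T.
  - move=> a aD; apply: big1 => e _; rewrite /inward; have [-> ->] := end0 e.
    by rewrite oppr0 if_same.
exists f; split=> //.
  rewrite (normsq_support f0).
  rewrite /mes mulr_suml mulr_sumr -!sumEFin -big_split/=.
  rewrite big_seq [leRHS]big_seq; apply: lee_sum => e eY.
  by have [_ _ _ _ []] := hh e; rewrite /f eY.
rewrite /energy.
have Lf1 : L2 f1.
  apply: (@L2_finite R G [set` sedges Y]) => //.
    by move=> e; exact: (sobolev2_sqc1 (len_gt0 e) (fs e)).
  move=> e /negP eY; apply: integral0_eq => x _.
  by rewrite f10// /sqmod/= expr0n addr0.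
have [|_ ->] := @L2_interior R G f1 (grad f) _ Lf1.
  move=> e x xe; have [dr di] := sobolev2_derive (len_gt0 e) (fs e) xe.
  by rewrite (gradE dr di).
rewrite (normsq_support f10) -sumEFin.
rewrite big_seq [leRHS]big_seq; apply: lee_sum => e eY.
by have [_ _ _ _ [_]] := hh e; rewrite /f1 eY.
Qed.

End TestFunction.

(** * Isoperimetric bounds *)

Section Hull.
Variables (R : realType) (G : metric_graph R).
Implicit Types (e : edge G) (a x y z : vertex G) (K Y : fin_subgraph G).

Definition reach K x y := exists p, path (sub_adj K) x p /\ last x p = y.

Lemma sub_adjC K x y : sub_adj K x y -> sub_adj K y x.
Proof. by move=> /asboolP[e eK h]; apply/asboolP; exists e => //; case: h; [right|left]. Qed.

Lemma reach_refl K x : reach K x x. Proof. by exists [::]. Qed.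

Lemma reach_trans K x y z : reach K x y -> reach K y z -> reach K x z.
Proof.
by move=> [p [xp py]] [q [yq qz]]; exists (p ++ q); rewrite cat_path last_cat py xp.
Qed.

Lemma reach_adj K x y : sub_adj K x y -> reach K x y.
Proof. by move=> xy; exists [:: y]; rewrite /= xy. Qed.

Lemma reach_sym K x y : reach K x y -> reach K y x.
Proof.
move=> [p [+ <-]]; elim: p x => [|z p IH] x /=; first by move=> _; exact: reach_refl.
move=> /andP[xz /IH zp]; apply: reach_trans zp _; exact/reach_adj/sub_adjC.
Qed.

Lemma reach_sub K Y x y : (sedges K `<=` sedges Y)%fset -> reach K x y -> reach Y x y.
Proof.
move=> sub [p [xp py]]; exists p; split=> //; apply: sub_path xp => a b.
by move=> /asboolP[e eK h]; apply/asboolP; exists e => //; exact: (fsubsetP sub).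
Qed.

Lemma add_edge_subproof K e e' : e' \in (e |` sedges K)%fset ->
  (org e' \in org e |` (dst e |` sverts K))%fset &&
  (dst e' \in org e |` (dst e |` sverts K))%fset.
Proof.
rewrite !inE => /predU1P[->|/sedges_sverts/andP[-> ->]]; last by rewrite !orbT.
by rewrite !eqxx !orbT.
Qed.

Definition add_edge K e := FinSubgraph (@add_edge_subproof K e).

Lemma add_edge_connected K e : sub_connected K ->
  (org e \in sverts K) || (dst e \in sverts K) -> sub_connected (add_edge K e).
Proof.
move=> cK ke.
have ao : sub_adj (add_edge K e) (org e) (dst e).
  by apply/asboolP; exists e; [rewrite /= !inE eqxx|left].
have [x0 x0K x0e] : exists2 x0, x0 \in sverts K & x0 = org e \/ x0 = dst e.
  by case/orP: ke; [exists (org e); [|left]|exists (dst e); [|right]].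
have r v : v \in sverts (add_edge K e) -> reach (add_edge K e) x0 v.
  rewrite /= !inE => /orP[/eqP ->|/orP[/eqP ->|vK]].
  - case: x0e => ->; first exact: reach_refl.
    exact/reach_adj/sub_adjC.
  - by case: x0e => ->; [exact: reach_adj|exact: reach_refl].
  - by apply: (@reach_sub K); [rewrite /= fsubsetU1|exact: cK].
by move=> x y /r xr /r; apply: reach_trans; exact: reach_sym.
Qed.

Definition extends K Y := (sedges K `<=` sedges Y)%fset /\ (sverts K `<=` sverts Y)%fset.

Lemma extend_path K x p : sub_connected K -> x \in sverts K ->
  path (fun a b => `[< exists e, (org e, dst e) = (a, b)
                              \/ (org e, dst e) = (b, a) >]) x p ->
  exists Y, [/\ sub_connected Y, extends K Y & last x p \in sverts Y].
Proof.
elim: p K x => [|z p IH] K x cK xK /=; first by exists K; split=> //; split.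
move=> /andP[/asboolP[e xz] zp].
have ke : (org e \in sverts K) || (dst e \in sverts K).
  by case: xz => -[? ?]; subst; rewrite xK ?orbT.
have zY : z \in sverts (add_edge K e).
  by case: xz => -[? ?]; subst; rewrite /= !inE eqxx ?orbT.
have [Y [cY [eY vY] lY]] := IH _ _ (add_edge_connected cK ke) zY zp.
exists Y; split=> //; split.
  by apply: fsubset_trans eY; rewrite /= fsubsetU1.
by apply: fsubset_trans vY; rewrite /= fsubsetU// fsubsetUr orbT.
Qed.

Lemma graph_connected x y : exists p,
  path (fun a b => `[< exists e : edge G, (org e, dst e) = (a, b)
                              \/ (org e, dst e) = (b, a) >]) x p /\ last x p = y.
Proof. by move: x y; case: G. Qed.

Lemma edges_infinite : infinite_set [set: edge G].
Proof. by case: G. Qed.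

Lemma fresh_edge (S : {fset edge G}) : exists e, e \notin S.
Proof.
apply: contrapT => h; apply: edges_infinite.
apply: (@sub_finite_set _ _ [set` S]) => // e _ /=.
by apply: contrapT => /negP eS; apply: h; exists e.
Qed.

(** [alpha_ess] removes connected subgraphs, whereas [ell_inf_ess] and the supports to be avoided
    involve arbitrary finite edge sets. Connectedness of the graph supplies paths that join the
    edges of such a set. *)
Lemma connected_hull (S : {fset edge G}) : exists2 K, KG K & (S `<=` sedges K)%fset.
Proof.
suff hs (s : seq (edge G)) : exists K, KG K /\ forall e, e \in s -> e \in sedges K.
  by have [K [kK sK]] := hs S; exists K => //; apply/fsubsetP.
elim: s => [|e s [K [[K0 cK] sK]]].
  have [e _] := fresh_edge fset0.
  have vP e' : e' \in [fset e]%fset ->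
      (org e' \in [fset org e; dst e]%fset) && (dst e' \in [fset org e; dst e]%fset).
    by rewrite inE => /eqP ->; rewrite !inE !eqxx orbT.
  exists (FinSubgraph vP); split=> //; split.
    by apply/fset0Pn; exists e; rewrite /= inE.
  have ao : sub_adj (FinSubgraph vP) (org e) (dst e).
    by apply/asboolP; exists e; [rewrite /= inE|left].
  move=> x y; rewrite /= !inE => /orP[/eqP ->|/eqP ->] /orP[/eqP ->|/eqP ->];
    by [exact: reach_refl|exact: reach_adj|exact/reach_adj/sub_adjC].
have [e0 e0K] := fset0Pn _ K0.
have /andP[oK _] := sedges_sverts e0K.
have [p [xp pe]] := graph_connected (org e0) (org e).
have [Y [cY [eY _] lY]] := extend_path cK oK xp.
rewrite pe in lY.
exists (add_edge Y e); split.
  split; first by apply/fset0Pn; exists e; rewrite /= !inE eqxx.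
  by apply: add_edge_connected; rewrite ?lY.
move=> e'; rewrite inE /= !inE => /predU1P[->|/sK e'K]; first by rewrite eqxx.
by rewrite (fsubsetP eY)// orbT.
Qed.

End Hull.

Section TestFunctionBound.
Variables (R : realType) (G : metric_graph R).
Implicit Types (e : edge G) (Y : fin_subgraph G) (f : gfun G).

Lemma mes_gt0 Y : sedges Y != fset0 -> 0 < mes Y.
Proof.
move=> /fset0Pn[e eY]; rewrite /mes (big_fsetD1 e)//= ltr_pwDl ?len_gt0//.
by apply: sumr_ge0 => e' _; rewrite ltW ?len_gt0.
Qed.

Lemma test_function Y (l c : R) : sedges Y != fset0 -> 0 < l ->
  (forall e, e \in sedges Y -> l <= len e) ->
  pi ^+ 2 / (2 * l) * ((deg_boundary Y)%:R / mes Y) < c ->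
  exists f : gfun G, [/\ dom_H0 f, forall e x, e \notin sedges Y -> f e x = 0,
    (0 < normsq f)%E & (energy f <= c%:E * normsq f)%E].
Proof.
move=> Y0 l0 lY hc; have M0 := mes_gt0 Y0; set M := mes Y in M0 hc *.
set D : R := (deg_boundary Y)%:R in hc.
have D0 : 0 <= D by exact: ler0n.
pose P : R := pi ^+ 2 / (2 * l).
have P0 : 0 <= P by rewrite divr_ge0 ?sqr_ge0// mulr_ge0// ltW.
have PDc : P * D < c * M by rewrite -ltr_pdivrMr// -mulrA.
have PD0 : 0 <= P * D by exact: mulr_ge0.
have cM0 : 0 < c * M by exact: le_lt_trans PDc.
have X0 : 0 < 3 * (P * D) + 4 * (c * M) by lra.
(* With [(1 + d)^2 <= 1 + 3 d] the energy bound follows from [(1 + 3 d) P D <= c M (1 - 4 d)], which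
   is linear in [d]; [d <= 1 / 8] keeps the squared norm at least [M / 4]. *)
pose d : R := Num.min (1 / 8) ((c * M - P * D) / (3 * (P * D) + 4 * (c * M))).
have d0 : 0 < d by rewrite lt_min divr_gt0 ?ltr01//= divr_gt0 ?subr_gt0.
have d8 : d <= 1 / 8 by rewrite ge_min lexx.
have dX : d * (3 * (P * D) + 4 * (c * M)) <= c * M - P * D.
  by rewrite -ler_pdivlMr// ge_min lexx orbT.
have [f [df f0 nf ef]] := test_function_approx Y d0.
exists f; have [Lf _] := dom_H0_regular df.
have /fineK nE := L2_fin Lf; set N := fine (normsq f) in nE.
rewrite -nE -/M in nf *; rewrite -EFinD lee_fin in nf.
have dM : d * M <= 1 / 8 * M by rewrite ler_wpM2r// ltW.
have N0 : 0 < N by lra.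
split=> //.
apply: (le_trans ef); rewrite -EFinM lee_fin.
have eD : \sum_(e <- sedges Y) ((1 + d) ^+ 2 * pi ^+ 2 / (4 * len e) *
   ((org e \in boundary Y) + (dst e \in boundary Y))%:R) <= (1 + d) ^+ 2 * (P / 2) * D.
  rewrite /D deg_boundary_sum natr_sum mulr_sumr big_seq [leRHS]big_seq.
  apply: ler_sum => e eY; rewrite ler_wpM2r//.
  have -> : (1 + d) ^+ 2 * (P / 2) = (1 + d) ^+ 2 * pi ^+ 2 / (4 * l).
    by rewrite /P; field; exact: lt0r_neq0.
  apply: ler_wpM2l; first by apply: mulr_ge0; exact: sqr_ge0.
  have e0 := len_gt0 e.
  by rewrite lef_pV2 ?posrE ?ler_pM2l ?lY//; apply: mulr_gt0.
apply: (le_trans eD).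
have c0 : 0 <= c by rewrite -(pmulr_lge0 _ M0) ltW.
have cN : c * (M / 2 - 2 * d * M) <= c * N by rewrite ler_wpM2l// lerBlDr.
have d2 : (1 + d) ^+ 2 <= 1 + 3 * d by nra.
have : (1 + d) ^+ 2 * (P * D) <= (1 + 3 * d) * (P * D) by rewrite ler_wpM2r.
lra.
Qed.

End TestFunctionBound.

(** * From test functions to isoperimetric constants *)

Section Bounds.
Variables (R : realType) (G : metric_graph R).
Implicit Types (e : edge G) (K Y : fin_subgraph G).

Lemma iso_quotient_ge0 Y : KG Y -> (0 <= iso_quotient Y)%E.
Proof.
move=> [Y0 _]; rewrite lee_fin divr_ge0//; exact/ltW/mes_gt0.
Qed.

Lemma lambda0_le_alpha (l a : R) : 0 < l -> ell_inf G = l%:E -> alpha G = a%:E ->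
  (lambda0 G <= (pi ^+ 2 / (2 * l) * a)%:E)%E.
Proof.
move=> l0 lE aE; apply/lee_addgt0Pr => e e0.
pose P : R := pi ^+ 2 / (2 * l).
have P0 : 0 < P by rewrite divr_gt0 ?exprn_gt0 ?pi_gt0// mulr_gt0.
have afin : alpha G \is a fin_num by rewrite aE.
have [_ [Y YK <-]] := lb_ereal_inf_adherent (divr_gt0 e0 P0) afin.
rewrite -/(alpha G) aE -EFinD lte_fin => hY.
have [Y0 _] := YK.
have [f [df _ nf ef]] : exists f : gfun G, [/\ dom_H0 f,
    forall e, forall x, e \notin sedges Y -> f e x = 0, (0 < normsq f)%E &
    (energy f <= (P * a + e)%:E * normsq f)%E].
  apply: (@test_function _ _ Y l) => // [e' _|].
    by rewrite -lee_fin -lE; apply: ereal_inf_lbound; exists e'.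
  rewrite -/P -ltr_pdivlMl//; apply: lt_le_trans hY _.
  by rewrite mulrDr mulKf ?gt_eqF// mulrC.
by rewrite -EFinD; exact: lambda0_le df nf ef.
Qed.

Lemma lambda0_ess_le_alpha (l a : R) : 0 < l -> ell_inf_ess G = l%:E ->
  alpha_ess G = a%:E -> (lambda0_ess G <= (pi ^+ 2 / (2 * l) * a)%:E)%E.
Proof.
move=> l0 lE aE; apply/lee_addgt0Pr => e e0.
pose P : R := pi ^+ 2 / (2 * l).
have P0 : 0 < P by rewrite divr_gt0 ?exprn_gt0 ?pi_gt0// mulr_gt0.
have a0 : 0 <= a.
  have [K KK _] := connected_hull (fset0 : {fset edge G}).
  rewrite -lee_fin -aE; apply: (@le_trans _ _ (alpha_minus K)).
    apply: le_ereal_inf_tmp => _ [Y [YK _] <-]; exact: iso_quotient_ge0.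
  by apply: ereal_sup_ubound; exists K.
(* The supremum [l] may not be attained, which costs a factor [1 + t], and [a] is approached up to
   [t]; in total [P (1 + t) (a + t) <= P a + P t (a + 2) <= P a + e / 2]. *)
pose t := Num.min 1 (e / (2 * P * (a + 2))).
have Pa0 : 0 < 2 * P * (a + 2) by apply: mulr_gt0; [exact: mulr_gt0|lra].
have t0 : 0 < t by rewrite lt_min ltr01 divr_gt0.
have t1 : t <= 1 by rewrite ge_min lexx.
have tP : t * (2 * P * (a + 2)) <= e by rewrite -ler_pdivlMr// ge_min lexx orbT.
pose l' := l / (1 + t).
have l'0 : 0 < l' by rewrite divr_gt0//; lra.
have l'l : l' < l by rewrite ltr_pdivrMr ?ltr_pMr//; lra.
rewrite -EFinD; apply: lambda0_ess_le => S.
have [_ [S1 _ <-] hS1] : exists2 x, [set ereal_inf [set (len e)%:E | e in [set e | e \notin S]]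
            | S in [set: {fset edge G}]] x & (l'%:E < x)%E.
  by apply: ereal_sup_gt; rewrite -/(ell_inf_ess G) lE lte_fin.
(* Removing [K] discards both the prescribed set [S] and the finite set [S1] outside which all
   lengths exceed [l']. *)
have [K KK SK] := connected_hull (S `|` S1)%fset.
have : (alpha_minus K < (a + t)%:E)%E.
  apply: (@le_lt_trans _ _ a%:E); last by rewrite lte_fin ltrDl.
  by rewrite -aE; apply: ereal_sup_ubound; exists K.
move=> /ereal_inf_lt[_ [Y [YK YKd] <-]]; rewrite lte_fin => hY.
have [Y0 _] := YK.
have YS e' : e' \in sedges Y -> e' \notin (S `|` S1)%fset.
  move=> e'Y; apply/negP => e'S; have := fdisjointP YKd e' e'Y.
  by rewrite (fsubsetP SK).
have [f [df f0 nf ef]] : exists f : gfun G, [/\ dom_H0 f,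
    forall e, forall x, e \notin sedges Y -> f e x = 0, (0 < normsq f)%E &
    (energy f <= (P * a + e)%:E * normsq f)%E].
  apply: (@test_function _ _ Y l') => // [e' /YS|].
    rewrite inE negb_or => /andP[_ e'S1]; rewrite -lee_fin ltW//.
    by apply: (lt_le_trans hS1); apply: ereal_inf_lbound; exists e'.
  have -> : pi ^+ 2 / (2 * l') = P * (1 + t).
    by rewrite /l' /P; field; rewrite !gt_eqF//; lra.
  apply: (@lt_le_trans _ _ (P * (1 + t) * (a + t))).
    by rewrite ltr_pM2l// mulr_gt0//; lra.
  have h1 : t * t <= t by rewrite ler_piMl// ltW.
  have h2 : P * (t * t) <= P * t by rewrite ler_pM2l.
  have h3 : 0 <= P * t * a by apply: mulr_ge0 => //; apply: mulr_ge0; exact: ltW.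
  have h4 : 0 < P * t by rewrite mulr_gt0.
  lra.
exists f, (sedges Y); split=> //.
by apply/fdisjointP => e' /YS; rewrite inE negb_or => /andP[].
Qed.

Lemma ell_inf_le_ess : (ell_inf G <= ell_inf_ess G)%E.
Proof.
apply: ereal_sup_ubound; exists fset0 => //; congr ereal_inf.
by apply/seteqP; split=> _ [e _ <-]; exists e.
Qed.

Lemma ell_inf_ess_le_sup : (ell_inf_ess G <= ell_sup G)%E.
Proof.
apply: ge_ereal_sup => _ [S _ <-]; have [e eS] := fresh_edge S.
apply: (@le_trans _ _ (len e)%:E); first by apply: ereal_inf_lbound; exists e.
by apply: ereal_sup_ubound; exists e.
Qed.

(** Reduces to real constants: if [x] is [+oo], so is the right-hand side, because its factor is
    positive. *)
Lemma mule_inv_le (l : R) (L x : \bar R) : (0 < l)%R ->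
  (0 <= x)%E -> (forall a : R, x = a%:E -> (L <= (pi ^+ 2 / (2 * l) * a)%:E)%E) ->
  (L <= (pi ^+ 2)%:E / (2%:E * l%:E) * x)%E.
Proof.
move=> l0; have P0 : 0 < pi ^+ 2 / (2 * l).
  by rewrite divr_gt0 ?exprn_gt0 ?pi_gt0// mulr_gt0.
have -> : ((pi ^+ 2)%:E / (2%:E * l%:E) = (pi ^+ 2 / (2 * l))%:E)%E.
  by rewrite -EFinM inver gt_eqF ?mulr_gt0// -EFinM.
case: x => [a|_ _|//]; last by rewrite gt0_muley ?leey// lte_fin.
by move=> _ /(_ a erefl); rewrite -EFinM.
Qed.

End Bounds.

Local Open Scope ereal_scope.

Theorem lemma5p1 (R : realType) (G : metric_graph R)
    (hsup : ell_sup G < +oo)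
    (hdeg : forall v : vertex G, degree v <> 2%N)
    (hinf : 0 < ell_inf G) :
  lambda0 G <= (pi ^+ 2)%:E / (2%:E * ell_inf G) * alpha G /\
  lambda0_ess G <= (pi ^+ 2)%:E / (2%:E * ell_inf_ess G) * alpha_ess G.
Proof.
have h1 := ell_inf_le_ess G; have h2 := ell_inf_ess_le_sup G.
have hess : 0 < ell_inf_ess G := lt_le_trans hinf h1.
(* Bounded edge lengths make both positive constants finite, so the division in the extended reals
   is the real one. *)
have fin1 : ell_inf G \is a fin_num.
  by rewrite gt0_fin_numE// (le_lt_trans h1)// (le_lt_trans h2).
have fin2 : ell_inf_ess G \is a fin_num by rewrite gt0_fin_numE// (le_lt_trans h2).
have := fineK fin1; have := fineK fin2.
move: (fine (ell_inf G)) (fine (ell_inf_ess G)) => l l2 E2 E1.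
rewrite -E1 lte_fin in hinf; rewrite -E2 lte_fin in hess.
rewrite -E1 -E2; split; apply: mule_inv_le => //.
- by apply: le_ereal_inf_tmp => _ [Y YK <-]; exact: iso_quotient_ge0.
- by move=> a aE; exact: lambda0_le_alpha.
- have [K KK _] := connected_hull (fset0 : {fset edge G}).
  apply: (@le_trans _ _ (alpha_minus K)).
    by apply: le_ereal_inf_tmp => _ [Y [YK _] <-]; exact: iso_quotient_ge0.
  by apply: ereal_sup_ubound; exists K.
- by move=> a aE; exact: lambda0_ess_le_alpha.
Qed.
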